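(* For each left cell $\mathfrak C$ of $\mathfrak S_n$, the character $\chi_{\mathfrak C}$ is irreducible. Two left cells $\mathfrak C,\mathfrak C'$ afford the same character if and only if $\mathfrak C,\mathfrak C'\subseteq\mathfrak R(\lambda)$ for some $\lambda\in\Lambda_n$. The total number of left cells equals $\sum_{\lambda\in\Lambda_n}d_\lambda$.
   Context: Let $W=\mathfrak S_n$ with generators $s_i=(i,i+1)$, length $l$, $\varepsilon_w=(-1)^{l(w)}$. $A=\mathbb Z[v,v^{-1}]$; $\mathcal H$ the Iwahori–Hecke algebra with basis $\{T_w\}$, $T_sT_w=T_{sw}$ if $l(sw)>l(w)$, $T_sT_w=T_{sw}+(v-v^{-1})T_w$ otherwise. With the involution $\overline{\sum a_wT_w}=\sum a_w(v^{-1})T_{w^{-1}}^{-1}$, $C_w$ (resp. $C'_w$) is the unique bar-invariant element with $C_w-T_w\in\sum v\mathbb Z[v]T_y$ (resp. $C'_w-T_w\in\sum v^{-1}\mathbb Z[v^{-1}]T_y$). $C'_xC'_y=\sum h_{x,y,z}C'_z$. $x\leftarrow_{\mathcal L}y$ iff $h_{s,y,x}\ne0$ for some generator $s$; $\le_{\mathcal L}$ its reflexive–transitive closure; left cells are classes of $\sim_{\mathcal L}$. For a left cell $\mathfrak C$, $[\mathfrak C]_A=\mathfrak I/\hat{\mathfrak I}$ where $\mathfrak I$ is the $A$-span of $C_w$ with $w\le_{\mathcal L}z$ for some $z\in\mathfrak C$ and $\hat{\mathfrak I}$ the span of those with additionally $w\notin\mathfrak C$; it is a left $\mathcal H$-module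 with basis $b_x$ (image of $\varepsilon_xC_x$), $x\in\mathfrak C$, and $C_w.b_x=\varepsilon_w\sum_{y\in\mathfrak C}h_{w,x,y}b_y$. $\chi_{\mathfrak C}$ is the character of $K\otimes_A[\mathfrak C]_A$, $K=\mathbb R(v)$. $\Lambda_n$: partitions of $n$ with dominance order $\trianglelefteq$; $\mathfrak S_\lambda$ Young subgroup generated by the $s_k$, $k\notin\{\lambda_1+\dots+\lambda_i\}$, with longest element $w_\lambda$. Irreducible characters $\chi_\lambda$ of $\mathcal H_K$ labelled so that the induced character from the sign representation $T_u\mapsto\varepsilon_uv^{-l(u)}$ of the parabolic subalgebra of $\mathfrak S_\lambda$ is $\chi_\lambda$ plus a sum of $\chi_\mu$, $\lambda\triangleleft\mu$. $d_\lambda=\chi_\lambda(T_1)$, $a(\lambda)=l(w_\lambda)$. For each $\lambda$ fix an orthogonal matrix representation $\mathfrak X_\lambda$ affording $\chi_\lambda$ ($\mathfrak X_\lambda(T_{w^{-1}})=P^{-1}\mathfrak X_\lambda(T_w)^{tr}P$, $P$ invertible diagonal with entries in $1+v\mathbb R[v]$); $v^{a(\lambda)}\mathfrak X^{ij}_\lambda(T_w)$ is regular at $v=0$ with value $\varepsilon_wc^{ij}_{w,\lambda}$ there, and the $\mathfrak X_\lambda$ are chosen with all $c^{ij}_{w,\lambda}\in\mathbb Z$. Then for each $\lambda,i,j$ there is a unique $w=\mathbf w_\lambda(i,j)$ with $c^{ij}_{w,\lambda}\ne0$, giving a bijection onto $\mathfrak S_n$; $\mathfrak R(\lambda)=\{\mathbf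 w_\lambda(i,j):1\le i,j\le d_\lambda\}$. *)

(* Defs.v *)
From HB Require Import structures.
From mathcomp Require Import all_boot all_order all_algebra all_fingroup.
From mathcomp Require Import fraction.
From mathcomp Require Import reals.
From Stdlib Require Import ClassicalEpsilon.

Set Implicit Arguments.
Unset Strict Implicit.
Unset Printing Implicit Defensive.

Import GRing.Theory Num.Theory.
Local Open Scope ring_scope.

Section Hecke.
Variable R : realType.
Variable n : nat.

Definition K : fieldType := {fraction {poly R}}.
Definition vK : K := tofrac ('X : {poly R}).
Definition embK (c : R) : K := tofrac (c%:P).
Definition evalR (p : {poly R}) (t : K) : K := (map_poly embK p).[t].
Definition evalZ (p : {poly int}) (t : K) : K :=
  (map_poly (fun z : int => (z%:~R : K)) p).[t].

Definition inA (x : K) : Prop :=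
  exists (p : {poly int}) (k : nat), x = evalZ p vK / vK ^+ k.
Definition in_vZv (x : K) : Prop :=
  exists p : {poly int}, p`_0 = 0 /\ x = evalZ p vK.
Definition in_viZvi (x : K) : Prop :=
  exists p : {poly int}, p`_0 = 0 /\ x = evalZ p vK^-1.

Definition barK (x : K) : K :=
  epsilon (inhabits 0) (fun y : K => exists p q : {poly R},
    q != 0 /\ x = tofrac p / tofrac q /\ y = evalR p vK^-1 / evalR q vK^-1).

Definition W := {perm 'I_n}.
Definition gens : {set W} :=
  [set s : W | [exists i : 'I_n, exists j : 'I_n,
                 (val j == (val i).+1) && (s == tperm i j)]].
(* Coxeter length of w in S_n (= number of inversions) *)
Definition len (w : W) : nat :=
  #|[set p : 'I_n * 'I_n | (p.1 < p.2)%N && (w p.2 < w p.1)%N]|.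
Definition sgnK (w : W) : K := (-1) ^+ len w.
Definition sgnR (w : W) : R := (-1) ^+ len w.

(* H_K : elements sum_w a_w T_w, stored as the coefficient function *)
Definition HK := {ffun W -> K}.
Definition T (w : W) : HK := [ffun x => (x == w)%:R].
Definition hlin (a : W -> K) (B : W -> HK) : HK :=
  [ffun x => \sum_w a w * B w x].

Definition Ts (s : W) (h : HK) : HK :=
  [ffun x => \sum_w h w *
    (if (len w < len (s * w)%g)%N then T (s * w)%g x
     else T (s * w)%g x + (vK - vK^-1) * T w x)].
Definition TsInv (s : W) : HK := [ffun y => T s y - (vK - vK^-1) * T 1%g y].

Definition desc (x : W) : option W := [pick s in gens | (len (s * x)%g < len x)%N].

(* T_x . h, computed along T_x = T_s T_{sx} with l(sx) < l(x) *)
Fixpoint Tact (k : nat) (x : W) (h : HK) : HK :=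
  match k with
  | 0 => h
  | k'.+1 => match desc x with Some s => Ts s (Tact k' (s * x)%g h) | None => h end
  end.
Definition hmul (h1 h2 : HK) : HK := hlin h1 (fun x => Tact (len x) x h2).

(* T_x^{-1} = T_{sx}^{-1} T_s^{-1} *)
Fixpoint Tinv (k : nat) (x : W) : HK :=
  match k with
  | 0 => T 1%g
  | k'.+1 => match desc x with Some s => hmul (Tinv k' (s * x)%g) (TsInv s) | None => T 1%g end
  end.
Definition bar (h : HK) : HK := hlin (fun w => barK (h w)) (fun w => Tinv (len w^-1%g) w^-1%g).

Definition KLC (w : W) : HK :=
  epsilon (inhabits (T 1%g)) (fun C : HK => bar C = C /\ forall y, in_vZv (C y - T w y)).
Definition KLC' (w : W) : HK :=
  epsilon (inhabits (T 1%g)) (fun C : HK => bar C = C /\ forall y, in_viZvi (C y - T w y)).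

Definition hcoef (x y : W) : HK :=
  epsilon (inhabits (T 1%g)) (fun hh : HK => hmul (KLC' x) (KLC' y) = hlin hh KLC').

Definition edgeL : rel W := fun x y => [exists s in gens, hcoef s y x != 0].
Definition leL (x y : W) : bool := connect edgeL x y.
Definition simL (x y : W) : bool := leL x y && leL y x.
Definition leftCell (C : {set W}) : bool := [exists z, C == [set w | simL w z]].

Definition Ccoord (h : HK) : HK := epsilon (inhabits h) (fun a : HK => h = hlin a KLC).
(* character of K (x) [C]_A, where C_w.b_x = eps_w sum_{y in C} h_{w,x,y} b_y *)
Definition chiCell (Cl : {set W}) (h : HK) : K :=
  \sum_y Ccoord h y * (sgnK y * \sum_(x in Cl) hcoef y x x).

Definition reprX d (X : W -> 'M[K]_d) (h : HK) : 'M[K]_d := \sum_w h w *: X w.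
Definition isRep d (X : W -> 'M[K]_d) : Prop :=
  reprX X (T 1%g) = 1%:M /\
  forall h1 h2, reprX X (hmul h1 h2) = reprX X h1 *m reprX X h2.
Definition irrRep d (X : W -> 'M[K]_d) : Prop :=
  (0 < d)%N /\ forall U : 'M[K]_d, (forall w, (U *m X w <= U)%MS) -> (U == 0) || row_full U.
Definition affords d (X : W -> 'M[K]_d) (chi : HK -> K) : Prop :=
  forall h, chi h = \tr (reprX X h).
Definition irrChar (chi : HK -> K) : Prop :=
  exists d (X : W -> 'M[K]_d), isRep X /\ irrRep X /\ affords X chi.

Definition is_part (f : {ffun 'I_n -> 'I_n.+1}) : bool :=
  [forall i : 'I_n, forall j : 'I_n, (i <= j)%N ==> (f j <= f i)%N]
  && (\sum_i (f i : nat) == n)%N.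
Definition Lam := {f : {ffun 'I_n -> 'I_n.+1} | is_part f}.
Definition psum (l : Lam) (k : nat) : nat := \sum_(i < n | (i < k)%N) (val l i : nat).
Definition domle (l m : Lam) : bool := [forall k : 'I_n.+1, psum l k <= psum m k]%N.
Definition domlt (l m : Lam) : bool := domle l m && (l != m).

Definition youngGens (l : Lam) : {set W} :=
  [set s : W | [exists i : 'I_n, exists j : 'I_n,
     [&& val j == (val i).+1,
         ~~ [exists k : 'I_n.+1, (0 < k)%N && (psum l k == val j)] &
         s == tperm i j]]].
Definition youngG (l : Lam) : {set W} := <<youngGens l>>%g.
(* a(lambda) = l(w_lambda), w_lambda the longest element of S_lambda *)
Definition aL (l : Lam) : nat := \max_(w in youngG l) len w.

(* character of H_K induced from T_u |-> eps_u v^{-l(u)} on H(S_lambda):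
   basis T_d (x) 1 with d minimal in d S_lambda *)
Definition minReps (l : Lam) : {set W} :=
  [set d : W | [forall s in youngGens l, len d < len (d * s)%g]%N].
Definition IndSign (l : Lam) (h : HK) : K :=
  \sum_(d in minReps l) \sum_(u in youngG l)
     hmul h (T d) (d * u)%g * (sgnK u * vK ^- len u).

Definition reg0 (x : K) (a : R) : Prop :=
  exists p q : {poly R}, q.[0] != 0 /\ x = tofrac p / tofrac q /\ a = p.[0] / q.[0].

End Hecke.

(* Main.v *)
(* Left Kazhdan-Lusztig cell modules are compared by means of the star operations. A right star operation preserves
   the matrix coefficients of the action on the C-basis, and so induces isomorphisms of cell modules that match their
   bases; a left star operation stays in a left cell. By column insertion, star operations on both sides connect every
   permutation to the longest element w_l of some Young subgroup S_l; in particular every cell module is isomorphic to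
   the cell module E_l of w_l for some l.

   The C_y with right descents containing S_l span a module with character IndSign l (compute the trace of k |-> h k e_l
   in the bases T and C, where e_l is the sign-symmetrizer). It is a sum of cell modules, so the triangularity of
   the induced characters gives that all constituents of E_l dominate l and that chi_l occurs in it once. Conversely, e_m is
   nonzero on E_l only if m <= l, and e_l is nonzero on E_l; a counting argument then shows that e_l is nonzero
   on chi_l, so the constituents of E_l are also dominated by l. Hence E_l affords chi_l. Moreover e_l has rank one on
   E_l, so chi_l is absolutely irreducible.

   For z_l = sum_w chi_l(T_{w^-1}) T_w, which acts by a scalar on X_l and by 0 on the other X_m, the limit at v = 0
   of the (y,y) coefficient on a cell module is sum_{ij} (c^{ij}_y)^2 up to normalization. Thus c^{ij}_{y,l} is nonzero
   for some i, j exactly when the cell of y affords chi_l, and the orthogonality relations give |R(l)| = d_l^2, which is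
   d_l cells of size d_l. *)

Require Import Defs.
From HB Require Import structures.
From mathcomp Require Import all_boot all_order all_algebra all_fingroup.
From mathcomp Require Import fraction reals.
From mathcomp Require Import ring zify.
From Stdlib Require Import ClassicalEpsilon.

Set Implicit Arguments.
Unset Strict Implicit.
Unset Printing Implicit Defensive.

Import GRing.Theory Num.Theory.
Local Open Scope ring_scope.

(** * The field K and its valuation at 0 *)

(** Three obstacles shape the argument. The bar of scalars, $C_w$, $C'_w$, $h_{x,y,z}$ and the
    $C$-coordinates are given by [epsilon], so each needs existence and uniqueness first; for the
    bases, uniqueness rests on $v\mathbb Z[v]$ having no nonzero bar-invariant element. The
    involution [jm] then turns the constants of the $C'$-basis into those of the $C$-basis, where
    all later computations take place. Second, $K=\mathbb R(v)$ is not known in advance to split the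
    Hecke algebra. Characters control modules because $K$ is formally real: the symmetry
    $\chi_l(T_{w^{-1}})=\chi_l(T_w)$ makes $\chi_l(z_l)$ a nonzero sum of squares. So the $\chi_l$
    are linearly independent, multiplicities can be read off from characters, and a module with
    character $\chi_l$ is irreducible and isomorphic to the given one. Third, the hypotheses on the
    $c^{ij}_{w,l}$ allow all of them to vanish for some $l$. This is excluded by $\chi_l(e_l)$: it
    equals the Poincare polynomial of $\mathfrak S_l$ in $v^{-2}$, whose pole at $v=0$ has order
    $2a(l)$, more than vanishing leading coefficients would permit. *)

Lemma frac_cross (F : fieldType) (a b c d : F) :
  b != 0 -> d != 0 -> a / b = c / d -> a * d = c * b.
Proof. by move=> b0 d0 /eqP; rewrite eqr_div // => /eqP. Qed.

Section Field.
Variable R : realType.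
Local Notation K := (K R).
Local Notation v := (vK R).
Local Notation tofracR := (@tofrac {poly R}).

Lemma embK_is_zmod_morphism : zmod_morphism (@embK R).
Proof. by move=> a b; rewrite /embK polyCB tofracB. Qed.
Lemma embK_is_monoid_morphism : monoid_morphism (@embK R).
Proof. by split=> [|a b]; rewrite /embK ?polyC1 ?tofrac1 // polyCM tofracM. Qed.
HB.instance Definition _ := GRing.isZmodMorphism.Build R K (@embK R) embK_is_zmod_morphism.
HB.instance Definition _ := GRing.isMonoidMorphism.Build R K (@embK R) embK_is_monoid_morphism.

Lemma evalRD p q (t : K) : evalR (p + q) t = evalR p t + evalR q t.
Proof. by rewrite /evalR rmorphD hornerD. Qed.
Lemma evalRN p (t : K) : evalR (- p) t = - evalR p t.
Proof. by rewrite /evalR rmorphN hornerN. Qed.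
Lemma evalRM p q (t : K) : evalR (p * q) t = evalR p t * evalR q t.
Proof. by rewrite /evalR rmorphM hornerM. Qed.
Lemma evalR1 (t : K) : evalR 1 t = 1.
Proof. by rewrite /evalR rmorph1 hornerC. Qed.
Lemma evalZD p q (t : K) : evalZ (p + q) t = evalZ p t + evalZ q t.
Proof. by rewrite /evalZ rmorphD hornerD. Qed.
Lemma evalZN p (t : K) : evalZ (- p) t = - evalZ p t.
Proof. by rewrite /evalZ rmorphN hornerN. Qed.
Lemma evalZM p q (t : K) : evalZ (p * q) t = evalZ p t * evalZ q t.
Proof. by rewrite /evalZ rmorphM hornerM. Qed.
Lemma evalZC m (t : K) : evalZ m%:P t = m%:~R.
Proof. by rewrite /evalZ map_polyC hornerC. Qed.
Lemma evalZX (t : K) : evalZ 'X t = t.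
Proof. by rewrite /evalZ map_polyX hornerX. Qed.

Lemma evalR_v p : evalR p v = tofracR p.
Proof.
rewrite -{2}[p]coefK poly_def rmorph_sum /evalR /= (@horner_coef_wide _ (size p)); last first.
  by rewrite size_map_poly.
apply: eq_bigr => i _; rewrite coef_map -mul_polyC rmorphM rmorphXn; congr (_ * _).
Qed.

Lemma v_neq0 : v != 0.
Proof. by rewrite /vK tofrac_eq0 polyX_eq0. Qed.

Lemma evalZ_R (p : {poly int}) t : evalZ p t = evalR (map_poly intr p : {poly R}) t.
Proof.
rewrite /evalZ /evalR -map_poly_comp; congr (horner _ _).
by apply: eq_map_poly => z /=; rewrite rmorph_int.
Qed.

Lemma frac_ex (x : K) : exists p q : {poly R}, q != 0 /\ x = tofracR p / tofracR q.
Proof.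
elim/quotW: x => r; exists (frac r).1, (frac r).2.
have dr := denom_ratioP r; split=> //.
have dr' : tofracR (frac r).2 != 0 by rewrite tofrac_eq0.
apply: (mulIf dr'); rewrite divfK //.
apply/eqP; rewrite -[_ * _]/(FracField.mul _ _) !piE.
by rewrite FracField.equivfE /FracField.mulf !numden_Ratio ?mulr1 ?oner_eq0 // mulrC.
Qed.

(** Multiplication by $v^m$ turns a polynomial in $v^{-1}$ into the one with reversed coefficients,
    so that identities in $v^{-1}$ can be compared in [{poly R}]. *)
Lemma evalR_vinv (p : {poly R}) m : (size p <= m.+1)%N ->
  evalR p v^-1 * v ^+ m = tofracR (\poly_(i < m.+1) p`_(m - i)).
Proof.
move=> sp; rewrite /evalR (@horner_coef_wide _ m.+1); last by rewrite size_map_poly.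
rewrite mulr_suml poly_def rmorph_sum /= (reindex_inj rev_ord_inj) /=.
apply: eq_bigr => i _; rewrite coef_map -mul_polyC rmorphM rmorphXn /= -mulrA; congr (_ * _).
rewrite subSS; have -> : v ^+ m = v ^+ (m - i) * v ^+ i by rewrite -exprD subnK // -ltnS.
by rewrite exprVn mulKf // expf_neq0 // v_neq0.
Qed.

(** The reversed polynomial has the leading coefficient of [p] as its constant term. *)
Lemma evalR_vinv_neq0 (p : {poly R}) : p != 0 -> evalR p v^-1 != 0.
Proof.
move=> p0; have sp : (0 < size p)%N by rewrite size_poly_gt0.
apply: contraNneq p0 => e0.
have := @evalR_vinv p (size p).-1; rewrite prednK // e0 mul0r leqnn => /(_ isT) /esym/eqP.
rewrite tofrac_eq0 => /eqP /polyP /(_ 0%N); rewrite coef_poly coef0 sp subn0 => /eqP.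
by rewrite -lead_coefE lead_coef_eq0.
Qed.

(** The choice made by [epsilon] is forced: $pq'=p'q$ survives the substitution $v\mapsto v^{-1}$,
    under which no denominator vanishes. *)
Lemma barK_frac (p q : {poly R}) : q != 0 ->
  barK (tofracR p / tofracR q) = evalR p v^-1 / evalR q v^-1.
Proof.
move=> q0; rewrite /barK; set P := fun _ => _.
have : exists y, P y by exists (evalR p v^-1 / evalR q v^-1), p, q.
move/(epsilon_spec (inhabits 0)); set y := epsilon _ _; case=> p' [q' [q0' [e ->]]].
have Q : tofracR q != 0 by rewrite tofrac_eq0.
have Q' : tofracR q' != 0 by rewrite tofrac_eq0.
have : p * q' = p' * q.
  apply/eqP; rewrite -tofrac_eq !rmorphM /=; apply/eqP.
  exact: (frac_cross Q Q' e).
move=> /(congr1 (fun p => evalR p v^-1)); rewrite !evalRM => E.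
by apply/eqP; rewrite eqr_div ?evalR_vinv_neq0 // E.
Qed.

Lemma barK_is_zmod_morphism : zmod_morphism (@barK R).
Proof.
move=> x y; have [p [q [q0 ->]]] := frac_ex x; have [p' [q' [q0' ->]]] := frac_ex y.
rewrite -mulNr addf_div ?tofrac_eq0 // -!rmorphN -!rmorphM -rmorphD.
rewrite !barK_frac ?mulf_neq0 // evalRD !evalRM evalRN.
by rewrite -mulNr addf_div // evalR_vinv_neq0.
Qed.
Lemma barK_is_monoid_morphism : monoid_morphism (@barK R).
Proof.
split=> [|x y].
  have -> : (1 : K) = tofracR 1 / tofracR 1 by rewrite tofrac1 divr1.
  by rewrite barK_frac ?oner_eq0 // evalR1 divr1.
have [p [q [q0 ->]]] := frac_ex x; have [p' [q' [q0' ->]]] := frac_ex y.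
rewrite mulf_div -!rmorphM !barK_frac ?mulf_neq0 // !evalRM.
by rewrite mulf_div.
Qed.
HB.instance Definition _ := GRing.isZmodMorphism.Build K K (@barK R) barK_is_zmod_morphism.
HB.instance Definition _ := GRing.isMonoidMorphism.Build K K (@barK R) barK_is_monoid_morphism.

Lemma barK_tofrac (p : {poly R}) : barK (tofracR p) = evalR p v^-1.
Proof.
rewrite -[tofracR p]divr1 -(tofrac1 {poly R}) barK_frac ?oner_eq0 //.
by rewrite evalR1 divr1.
Qed.

Lemma barK_v : barK v = v^-1.
Proof. by rewrite /vK barK_tofrac /evalR map_polyX hornerX. Qed.

Lemma barK_embK c : barK (@embK R c) = @embK R c.
Proof. by rewrite /embK barK_tofrac /evalR map_polyC hornerC. Qed.

Lemma barK_evalR p (t : K) : barK (evalR p t) = evalR p (barK t).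
Proof.
rewrite /evalR -horner_map -map_poly_comp; congr (horner _ _).
by apply: eq_map_poly => c /=; rewrite barK_embK.
Qed.

Lemma barKK (x : K) : barK (barK x) = x.
Proof.
have [p [q [q0 ->]]] := frac_ex x; rewrite barK_frac // fmorph_div /= !barK_evalR.
by rewrite fmorphV /= barK_v invrK !evalR_v.
Qed.

Lemma barK_evalZ p (t : K) : barK (evalZ p t) = evalZ p (barK t).
Proof. by rewrite !evalZ_R barK_evalR. Qed.

Definition in_Zv (x : K) := exists p : {poly int}, x = evalZ p v.

Lemma in_Zv_int (m : int) : in_Zv m%:~R.
Proof. by exists m%:P; rewrite evalZC. Qed.
Lemma in_ZvB (x y : K) : in_Zv x -> in_Zv y -> in_Zv (x - y).
Proof. by move=> [p ->] [q ->]; exists (p - q); rewrite evalZD evalZN. Qed.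
Lemma in_ZvD (x y : K) : in_Zv x -> in_Zv y -> in_Zv (x + y).
Proof. by move=> [p ->] [q ->]; exists (p + q); rewrite evalZD. Qed.
Lemma in_ZvM (x y : K) : in_Zv x -> in_Zv y -> in_Zv (x * y).
Proof. by move=> [p ->] [q ->]; exists (p * q); rewrite evalZM. Qed.
Lemma in_Zv_v : in_Zv v.
Proof. by exists 'X; rewrite evalZX. Qed.

Lemma in_vZv_Zv (x : K) : in_vZv x -> in_Zv x.
Proof. by case=> p [_ ->]; exists p. Qed.
Lemma in_vZv0 : in_vZv (0 : K).
Proof. by exists 0; rewrite coef0 (evalZC 0). Qed.
Lemma in_vZvD (x y : K) : in_vZv x -> in_vZv y -> in_vZv (x + y).
Proof.
move=> [p [p0 ->]] [q [q0 ->]]; exists (p + q).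
by rewrite coefD p0 q0 addr0 evalZD.
Qed.
Lemma in_vZvN (x : K) : in_vZv x -> in_vZv (- x).
Proof. by move=> [p [p0 ->]]; exists (- p); rewrite coefN p0 oppr0 evalZN. Qed.
Lemma in_vZvB (x y : K) : in_vZv x -> in_vZv y -> in_vZv (x - y).
Proof. by move=> ? /in_vZvN; apply: in_vZvD. Qed.
Lemma in_vZvMl (x y : K) : in_Zv x -> in_vZv y -> in_vZv (x * y).
Proof.
move=> [p ->] [q [q0 ->]]; exists (p * q).
by rewrite coef0M q0 mulr0 evalZM.
Qed.
Lemma in_vZv_v : in_vZv v.
Proof. by exists 'X; rewrite coefX evalZX. Qed.
Lemma in_vZv_sum (I : Type) (r : seq I) (P : pred I) (F : I -> K) :
  (forall i, P i -> in_vZv (F i)) -> in_vZv (\sum_(i <- r | P i) F i).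
Proof. by move=> h; apply: big_ind => //; [exact: in_vZv0|exact: in_vZvD]. Qed.

Lemma in_vZv_div (x : K) : in_vZv x -> in_Zv (v^-1 * x).
Proof.
move=> [p [p0 ->]]; exists (\poly_(i < (size p).-1) p`_i.+1).
have {1}-> : p = 'X * \poly_(i < (size p).-1) p`_i.+1.
  apply/polyP => -[|i]; rewrite coefXM //= coef_poly.
  by case: ltnP => // h; rewrite nth_default //; case: (size p) h.
by rewrite evalZM evalZX mulKf ?v_neq0.
Qed.

Lemma in_Zv_residue (x : K) : in_Zv x -> exists m : int, in_vZv (x - m%:~R).
Proof.
move=> [p ->]; exists p`_0, (p - (p`_0)%:P); rewrite coefB coefC subrr; split=> //.
by rewrite evalZD evalZN evalZC.
Qed.

(** With $m$ the degree, compare $v^mq(v)$ with the reversed polynomial in degree $m+i$: on one side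
    stands $q_i$, on the other $q_0=0$ if $i=0$ and nothing if $i>0$. *)
Lemma in_vZv_bar0 (x : K) : in_vZv x -> barK x = x -> x = 0.
Proof.
move=> [p [p0 ->]]; rewrite barK_evalZ barK_v !evalZ_R; set q := map_poly _ _.
have q0 : q`_0 = 0 by rewrite coef_map p0.
set m := (size q).-1; have sq : (size q <= m.+1)%N by rewrite leqSpred.
move=> /(congr1 (fun y => y * v ^+ m)); rewrite evalR_vinv // evalR_v.
rewrite -tofracXn -tofracM => /eqP; rewrite tofrac_eq => /eqP /polyP E.
suff -> : q = 0 by rewrite tofrac0.
apply/polyP => i; rewrite coef0; have := E (m + i)%N; rewrite coefMXn ltnNge leq_addr /= addKn.
rewrite coef_poly => <-; case: ltnP => // h.
by rewrite (_ : m - (m + i) = 0)%N ?q0 //; apply/eqP; rewrite subn_eq0 leq_addr.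
Qed.

Lemma reg0_uniq (x : K) a b : reg0 x a -> reg0 x b -> a = b.
Proof.
move=> [p [q [q0 [-> ->]]]] [p' [q' [q0' [E ->]]]].
have nz (r : {poly R}) : r.[0] != 0 -> tofracR r != 0.
  by rewrite tofrac_eq0; apply: contraNneq => ->; rewrite horner0.
have : p * q' = p' * q.
  apply/eqP; rewrite -tofrac_eq !rmorphM /=; apply/eqP.
  exact: (frac_cross (nz _ q0) (nz _ q0') E).
move=> /(congr1 (horner^~ 0)); rewrite !hornerM => H.
by apply/eqP; rewrite eqr_div // H.
Qed.

Lemma reg0_poly (p : {poly R}) : reg0 (tofracR p : K) p.[0].
Proof.
have e : tofracR p = tofracR p / tofracR 1 by rewrite tofrac1 divr1.
exists p, 1; split; first by rewrite hornerC oner_eq0.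
by split; [exact: e | rewrite hornerC divr1].
Qed.
Lemma reg0_emb (c : R) : reg0 (@embK R c) c.
Proof. by have := reg0_poly c%:P; rewrite hornerC. Qed.
Lemma reg0_nat (k : nat) : reg0 (k%:R : K) (k%:R : R).
Proof. by have := reg0_emb k%:R; rewrite rmorph_nat. Qed.
Lemma reg0_1 : reg0 (1 : K) (1 : R). Proof. exact: (reg0_nat 1). Qed.
Lemma reg0_0 : reg0 (0 : K) (0 : R). Proof. exact: (reg0_nat 0). Qed.
Lemma reg0D (x y : K) a b : reg0 x a -> reg0 y b -> reg0 (x + y) (a + b).
Proof.
move=> [p [q [q0 [-> ->]]]] [p' [q' [q0' [-> ->]]]].
have nz (r : {poly R}) : r.[0] != 0 -> tofracR r != 0.
  by rewrite tofrac_eq0; apply: contraNneq => ->; rewrite horner0.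
exists (p * q' + p' * q), (q * q'); split; first by rewrite hornerM mulf_neq0.
by split; [rewrite addf_div ?nz // rmorphD !rmorphM | rewrite hornerD !hornerM addf_div].
Qed.
Lemma reg0M (x y : K) a b : reg0 x a -> reg0 y b -> reg0 (x * y) (a * b).
Proof.
move=> [p [q [q0 [-> ->]]]] [p' [q' [q0' [-> ->]]]].
exists (p * p'), (q * q'); split; first by rewrite hornerM mulf_neq0.
by split; [rewrite mulf_div !rmorphM | rewrite !hornerM mulf_div].
Qed.
Lemma reg0N (x : K) a : reg0 x a -> reg0 (- x) (- a).
Proof.
by move=> h; rewrite -mulN1r -[- a]mulN1r; apply: reg0M h; have := reg0_emb (-1); rewrite rmorphN1.
Qed.
Lemma reg0V (x : K) a : a != 0 -> reg0 x a -> reg0 x^-1 a^-1.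
Proof.
move=> a0 [p [q [q0 [-> e]]]]; exists q, p; rewrite e !invf_div; split=> //.
by apply: contraNneq a0 => p0; rewrite e p0 mul0r.
Qed.
Lemma reg0_v : reg0 v (0 : R).
Proof. by have := reg0_poly 'X; rewrite hornerX. Qed.
Lemma reg0_sum (I : Type) (r : seq I) (P : pred I) (F : I -> K) (f : I -> R) :
  (forall i, P i -> reg0 (F i) (f i)) ->
  reg0 (\sum_(i <- r | P i) F i) (\sum_(i <- r | P i) f i).
Proof. by move=> h; apply: (big_ind2 (@reg0 R)) => //; [exact: reg0_0|by move=> *; apply: reg0D]. Qed.
Lemma reg0X (x : K) a k : reg0 x a -> reg0 (x ^+ k) (a ^+ k).
Proof. by move=> h; elim: k => [|k IH]; [exact: reg0_1|rewrite !exprS; apply: reg0M]. Qed.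

Lemma in_vZv_reg0 (x : K) : in_vZv x -> reg0 x (0 : R).
Proof.
move=> [p [p0 ->]]; rewrite evalZ_R evalR_v.
by have := reg0_poly (map_poly intr p); rewrite horner_coef0 coef_map p0.
Qed.

Lemma polyR_eval0 (p : {poly R}) : (forall a, p.[a] = 0) -> p = 0.
Proof.
move=> h; apply/eqP; apply: contraT => p0.
have := @max_poly_roots _ p [seq i%:R | i <- iota 0 (size p)] p0.
rewrite size_map size_iota ltnn; apply.
  by apply/allP => x /mapP [i _ ->]; apply/eqP.
by rewrite map_inj_uniq ?iota_uniq //; apply: mulrIn; rewrite oner_eq0.
Qed.

(** $\mathbb R(v)$ is formally real: over a common denominator, the numerators vanish at every real
    point. *)
Lemma sum_sqr_eq0 (I : finType) (x : I -> K) :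
  \sum_i x i ^+ 2 = 0 -> forall i, x i = 0.
Proof.
move=> H.
have [f Hf] : exists f : I -> {poly R} * {poly R},
    forall i, (f i).2 != 0 /\ x i = tofracR (f i).1 / tofracR (f i).2.
  suff /(_ _) /constructive_indefinite_description F :
      forall i, exists pq : {poly R} * {poly R}, pq.2 != 0 /\ x i = tofracR pq.1 / tofracR pq.2.
    by exists (fun i => projT1 (F i)) => i; exact: (projT2 (F i)).
  by move=> i; have [p [q H']] := frac_ex (x i); exists (p, q).
pose D := \prod_i (f i).2.
have D0 : D != 0 by apply/prodf_neq0 => i _; case: (Hf i).
pose P i := (f i).1 * \prod_(j | j != i) (f j).2.
have eP i : x i * tofracR D = tofracR (P i).
  case: (Hf i) => n0 ->; rewrite /D (bigD1 i) //= !rmorphM /=.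
  by rewrite -mulrA; congr (_ * _); rewrite mulKf // tofrac_eq0.
have sP : \sum_i P i ^+ 2 = 0.
  apply/eqP; rewrite -(tofrac_eq0 (\sum_i P i ^+ 2)) rmorph_sum /=; apply/eqP.
  transitivity (tofracR D ^+ 2 * \sum_i x i ^+ 2); last by rewrite H mulr0.
  rewrite mulr_sumr; apply: eq_bigr => i _.
  by rewrite rmorphXn /= -eP exprMn mulrC.
have P0 i : P i = 0.
  apply: polyR_eval0 => a; move: sP => /(congr1 (horner^~ a)); rewrite horner_sum horner0 => /eqP.
  rewrite psumr_eq0 => [|j _]; last by rewrite horner_exp sqr_ge0.
  by move=> /allP /(_ i); rewrite mem_index_enum horner_exp sqrf_eq0 => /(_ isT) /eqP.
move=> i; apply: (@mulIf _ (tofracR D)); first by rewrite tofrac_eq0.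
by rewrite eP P0 tofrac0 mul0r.
Qed.

End Field.

(** * Descents and reduced expressions *)

Section Perm.
Variable n : nat.
Local Notation W := (W n).
Implicit Types (s t : W) (w x y : W).
Local Open Scope group_scope.

(** Permutations compose from left to right, $(xy)(i)=y(x(i))$. A generator on the left thus
    exchanges two adjacent positions of the one-line word, on the right two adjacent values; [dl] is
    about descents of the word, [dr] about those of the inverse. *)
Definition dl s w := (len (s * w)%g < len w)%N.
Definition dr s w := (len (w * s)%g < len w)%N.

Lemma gensP s : reflect (exists i j : 'I_n, val j = (val i).+1 /\ s = tperm i j) (s \in gens n).
Proof.
rewrite inE; apply: (iffP existsP) => [[i /existsP [j /andP [/eqP h /eqP ->]]]|[i [j [h ->]]]].
  by exists i, j.
by exists i; apply/existsP; exists j; rewrite h !eqxx.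
Qed.

Lemma gens_sqr s : s \in gens n -> s * s = 1.
Proof. by case/gensP=> i [j [_ ->]]; rewrite tperm2. Qed.

Lemma gens_inv s : s \in gens n -> s^-1 = s.
Proof. by case/gensP=> i [j [_ ->]]; rewrite tpermV. Qed.

Lemma gens_mulK s w : s \in gens n -> s * (s * w) = w.
Proof. by move=> h; rewrite mulgA gens_sqr // mul1g. Qed.

Lemma gens_mulKr s w : s \in gens n -> w * s * s = w.
Proof. by move=> h; rewrite -mulgA gens_sqr // mulg1. Qed.

(** An adjacent transposition keeps the order of every pair of positions except $(i,j)$, so the
    inversions of the product are the moved inversions of [w] together with $(i,j)$. *)
Lemma len_tperm (i j : 'I_n) w : val j = (val i).+1 -> (w i < w j)%N ->
  len (tperm i j * w) = (len w).+1.
Proof.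
move=> hij hw; rewrite /len; set s := tperm i j.
pose f (p : 'I_n * 'I_n) := (s p.1, s p.2).
have fI : injective f by move=> [a b] [c d] [/perm_inj -> /perm_inj ->].
set A := [set p | _]; set B := [set p | _].
have smono (a b : 'I_n) : (a < b)%N -> (a, b) != (i, j) -> (s a < s b)%N.
  rewrite xpair_eqE negb_and -!val_eqE /= /s.
  case: tpermP => [->|->|/eqP + /eqP +]; case: tpermP => [->|->|/eqP + /eqP +];
    rewrite -?val_eqE /=; move: hij => /=; lia.
have -> : A = (i, j) |: [set f p | p in B].
  apply/setP=> p; rewrite !inE; apply/andP/orP => [[h1 h2]|].
    have [->|ne] := eqVneq p (i, j); first by left.
    right; apply/imsetP; exists (f p).
      rewrite inE smono -?surjective_pairing //=.
      by move: h2; rewrite !permM.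
    by rewrite /f /s /= !tpermK -surjective_pairing.
  case=> [/eqP ->|/imsetP [[a b]]] /=; first by rewrite !permM /s tpermL tpermR hij ltnSn.
  rewrite inE /= => /andP [ab wab] -> /=; rewrite !permM /s !tpermK; split => //.
  apply: smono => //; apply/eqP => -[e1 e2]; move: wab; rewrite e1 e2; lia.
rewrite cardsU1 card_imset // (_ : (i, j) \notin _) ?add1n //.
apply/imsetP => -[[a b]]; rewrite inE /= => /andP [ab _] [ea eb].
have ea' : a = j by rewrite -[a](tpermK i j) -/s -ea tpermL.
have eb' : b = i by rewrite -[b](tpermK i j) -/s -eb tpermR.
by move: ab hij; rewrite ea' eb' /=; lia.
Qed.

Lemma dlE (i j : 'I_n) w : val j = (val i).+1 -> dl (tperm i j) w = (w j < w i)%N.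
Proof.
move=> hij; rewrite /dl; case: (ltngtP (w j) (w i)) => [h|h|/val_inj /perm_inj e].
- rewrite -{2}[w](@gens_mulK (tperm i j)); last by apply/gensP; exists i, j.
  by rewrite (@len_tperm i j (tperm i j * w)) ?ltnSn // !permM tpermL tpermR.
- by rewrite len_tperm // ltnNge leqnSn.
- by move: hij; rewrite e /=; lia.
Qed.

Lemma len_gensN s w : s \in gens n -> ~~ dl s w -> len (s * w) = (len w).+1.
Proof.
case/gensP=> i [j [hij ->]]; rewrite dlE // -leqNgt leq_eqVlt => /orP [/eqP /val_inj /perm_inj e|h].
  by move: hij; rewrite e /=; lia.
exact: len_tperm.
Qed.

Lemma dl_mul s w : s \in gens n -> dl s (s * w) = ~~ dl s w.
Proof.
case/gensP=> i [j [hij ->]]; rewrite !dlE // !permM tpermL tpermR.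
case: (ltngtP (w j) (w i)) => // /val_inj /perm_inj e; by move: hij; rewrite e /=; lia.
Qed.

Lemma len_gens s w : s \in gens n -> dl s w -> len w = (len (s * w)).+1.
Proof.
move=> hs h; have := @len_gensN s (s * w) hs; rewrite dl_mul // negbK => /(_ h).
by rewrite gens_mulK.
Qed.

Lemma lenV w : len w^-1 = len w.
Proof.
rewrite /len; pose f (p : 'I_n * 'I_n) := (w p.2, w p.1).
have fI : injective f by move=> [a b] [c d] [/perm_inj -> /perm_inj ->].
rewrite -[RHS](card_imset _ fI); apply: eq_card => -[a b].
rewrite !inE /=; apply/andP/imsetP => [[ab h]|[[c d]]].
  by exists (w^-1 b, w^-1 a); rewrite ?inE /f /= ?permKV ?h.
by rewrite inE /f => /andP /= [h1 h2] [-> ->]; rewrite !permK.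
Qed.

Lemma dr_dl s w : s \in gens n -> dr s w = dl s w^-1.
Proof. by move=> hs; rewrite /dr /dl lenV -[len (w * s)]lenV invMg (gens_inv hs). Qed.

Lemma dl_dr s w : s \in gens n -> dl s w = dr s w^-1.
Proof. by move=> hs; rewrite dr_dl // invgK. Qed.

Lemma dr_mul s w : s \in gens n -> dr s (w * s) = ~~ dr s w.
Proof. by move=> hs; rewrite !dr_dl // invMg (gens_inv hs) dl_mul. Qed.

Lemma len_gensr s w : s \in gens n -> dr s w -> len w = (len (w * s)).+1.
Proof.
by move=> hs; rewrite dr_dl // => /(len_gens hs); rewrite lenV => ->; rewrite -lenV invMg (gens_inv hs) invgK.
Qed.
Lemma len_gensNr s w : s \in gens n -> ~~ dr s w -> len (w * s) = (len w).+1.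
Proof. by move=> hs; rewrite dr_dl // => /(len_gensN hs); rewrite lenV => <-; rewrite -lenV invMg (gens_inv hs). Qed.

(** The order of $w(i)$ and $w(j)$ is affected by exchanging the adjacent values $k,l$ only if
    $\{w(i),w(j)\}=\{k,l\}$, which means $sw=wt$. *)
Lemma dl_mulr s t w : s \in gens n -> t \in gens n -> s * w <> w * t -> dl s (w * t) = dl s w.
Proof.
case/gensP=> i [j [hij ->]]; case/gensP=> k [l [hkl ->]] ne; rewrite !dlE // !permM.
have wne : w i != w j by apply/eqP => /perm_inj e; move: hij; rewrite e /=; lia.
have ne' : tperm (w i) (w j) != tperm k l by apply/eqP => e; apply: ne; rewrite -e -tpermJ -conjgC.
have {}ne : ~~ ((w i == k) && (w j == l) || (w i == l) && (w j == k)).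
  by apply: contra ne' => /orP [] /andP [/eqP -> /eqP ->]; rewrite // tpermC.
move: ne wne; rewrite -!val_eqE /=; move: (w i) (w j) => a b.
case: tpermP => [->|->|/eqP + /eqP +]; case: tpermP => [->|->|/eqP + /eqP +];
    rewrite -?val_eqE /=; move: hkl => /=; lia.
Qed.

Lemma len1 : len (1 : W) = 0%N.
Proof.
by apply/eqP; rewrite cards_eq0; apply/eqP/setP => -[a b]; rewrite !inE !perm1 /=; lia.
Qed.

Lemma incr_id w : (forall a b : 'I_n, val b = (val a).+1 -> (w a < w b)%N) -> w = 1.
Proof.
move=> h; have mono (a b : 'I_n) : (a < b)%N -> (w a < w b)%N.
  move: b => [b hb] /=; elim: b hb => // b IH hb; rewrite ltnS leq_eqVlt => /orP [/eqP e|ab].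
    by apply: h => /=; rewrite e.
  have hb' : (b < n)%N by apply: ltnW.
  by apply: ltn_trans (IH hb' ab) _; apply: h.
have ge (u : W) : (forall a b : 'I_n, (a < b)%N -> (u a < u b)%N) -> forall i : 'I_n, (i <= u i)%N.
  move=> um [i hi] /=; elim: i hi => // i IH hi.
  have hi' : (i < n)%N by apply: ltnW.
  by apply: leq_ltn_trans (IH hi') _; apply: um => /=.
have geV := ge w^-1 _; have {}ge := ge w mono.
apply/permP => i; rewrite perm1; apply: val_inj; apply/eqP; rewrite eqn_leq ge andbT /=.
rewrite -{2}[i](permK w); apply: geV => a b ab.
rewrite ltnNge leq_eqVlt; apply/negP => /orP [/eqP /val_inj /perm_inj e|/mono].
  by move: ab; rewrite e ltnn.
by rewrite !permKV ltnNge ltnW.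
Qed.

Lemma descent_ex w : w != 1 -> exists2 s, s \in gens n & dl s w.
Proof.
move=> w1; case: (pickP [pred s in gens n | dl s w]) => [s /andP [h1 h2]|h]; first by exists s.
case/eqP: w1; apply: incr_id => a b hab; rewrite ltnNge leq_eqVlt; apply/negP.
case/orP=> [/eqP /val_inj /perm_inj e|hd]; first by move: hab; rewrite e /=; lia.
have := h (tperm a b); rewrite /= dlE // hd andbT => /negP; apply.
by apply/gensP; exists a, b.
Qed.

Lemma len_eq0 w : (len w == 0)%N = (w == 1).
Proof.
apply/idP/eqP => [/eqP h|->]; last by rewrite len1.
by apply/eqP; apply: contraT => /descent_ex [s _]; rewrite /dl h.
Qed.

Lemma descP w : w != 1 -> exists s, [/\ desc w = Some s, s \in gens n & dl s w].
Proof.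
move=> /descent_ex [s0 h1 h2]; rewrite /desc; case: pickP => [s /andP [h h']|/(_ s0)].
  by exists s.
by rewrite h1 /= -/(dl s0 w) h2.
Qed.

Lemma len_ind (Q : W -> Prop) : Q 1 ->
  (forall s w, s \in gens n -> dl s w -> Q (s * w) -> Q w) -> forall w, Q w.
Proof.
move=> Q1 QS w; have [k] := ubnP (len w); elim: k w => // k IH w lw.
have [->//|/descent_ex [s hs hd]] := eqVneq w 1.
by apply: (QS s) => //; apply: IH; rewrite -ltnS (leq_trans _ lw) // ltnS.
Qed.

End Perm.

(** * The Hecke algebra as a ring *)

(* Everything built on the fraction field K is locked: conversion problems that unfold it do not terminate
   in practice. *)
HB.lock Definition hk_add (R : realType) (n : nat) (h k : HK R n) : HK R n := [ffun x => h x + k x].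
HB.lock Definition hk_opp (R : realType) (n : nat) (h : HK R n) : HK R n := [ffun x => - h x].
HB.lock Definition hk_zero (R : realType) (n : nat) : HK R n := [ffun x => 0].
HB.lock Definition hk_scale (R : realType) (n : nat) (a : K R) (h : HK R n) : HK R n := [ffun x => a * h x].
HB.lock Definition hk_mul (R : realType) (n : nat) (h k : HK R n) : HK R n := hmul h k.
HB.lock Definition hk_one (R : realType) (n : nat) : HK R n := T R 1%g.

Definition hecke (R : realType) (n : nat) := HK R n.
HB.instance Definition _ R n := Choice.copy (hecke R n) (HK R n).

Section HeckeZmod.
Variables (R : realType) (n : nat).
Local Notation H := (hecke R n).
Implicit Types h : H.
Lemma hk_addA : associative (@hk_add R n).
Proof. by move=> a b c; apply/ffunP => x; rewrite hk_add.unlock !ffunE addrA. Qed.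
Lemma hk_addC : commutative (@hk_add R n).
Proof. by move=> a b; apply/ffunP => x; rewrite hk_add.unlock !ffunE addrC. Qed.
Lemma hk_add0 : left_id (@hk_zero R n) (@hk_add R n).
Proof. by move=> a; apply/ffunP => x; rewrite hk_add.unlock hk_zero.unlock !ffunE add0r. Qed.
Lemma hk_addN : left_inverse (@hk_zero R n) (@hk_opp R n) (@hk_add R n).
Proof.
by move=> a; apply/ffunP => x; rewrite hk_add.unlock hk_zero.unlock hk_opp.unlock !ffunE addNr.
Qed.
HB.instance Definition _ := GRing.isZmodule.Build H hk_addA hk_addC hk_add0 hk_addN.
Lemma hk_addE h k : h + k = hk_add h k. Proof. by []. Qed.
Lemma hk_oppE h : - h = hk_opp h. Proof. by []. Qed.
Lemma hk_zeroE : (0 : H) = hk_zero R n. Proof. by []. Qed.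

Lemma hk_scaleA (a b : K R) h : hk_scale a (hk_scale b h) = hk_scale (a * b) h.
Proof. by apply/ffunP => x; rewrite hk_scale.unlock !ffunE mulrA. Qed.
Lemma hk_scale1 : left_id 1 (@hk_scale R n).
Proof. by move=> h; apply/ffunP => x; rewrite hk_scale.unlock !ffunE mul1r. Qed.
Lemma hk_scaleDr (a : K R) : {morph (@hk_scale R n a : H -> H) : h k / h + k}.
Proof.
by move=> h k; apply/ffunP => x; rewrite !hk_addE hk_scale.unlock hk_add.unlock !ffunE mulrDr.
Qed.
Lemma hk_scaleDl h (a b : K R) : hk_scale (a + b) h = (hk_scale a h : H) + (hk_scale b h : H) :> H.
Proof.
by apply/ffunP => x; rewrite hk_addE hk_scale.unlock hk_add.unlock !ffunE mulrDl.
Qed.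
HB.instance Definition _ := GRing.Zmodule_isLmodule.Build (K R) H hk_scaleA hk_scale1 hk_scaleDr hk_scaleDl.
Lemma hk_scaleE (a : K R) h : a *: h = hk_scale a h. Proof. by []. Qed.
End HeckeZmod.

Section Hecke.
Variables (R : realType) (n : nat).
Local Notation K := (K R).
Local Notation v := (vK R).
Local Notation q := (v - v^-1).
Local Notation W := (W n).
Local Notation H := (hecke R n).
Local Notation gens := (gens n).
Local Notation T := (@T R n : W -> H).
Implicit Types (s t w x y z : W) (h k : H).

Lemma TE w x : T w x = (x == w)%:R :> K.
Proof. by rewrite ffunE. Qed.

Lemma hD h k x : (h + k) x = h x + k x :> K.
Proof. by rewrite hk_addE hk_add.unlock ffunE. Qed.
Lemma hN h x : (- h) x = - h x :> K.
Proof. by rewrite hk_oppE hk_opp.unlock ffunE. Qed.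
Lemma hZ (a : K) h x : (a *: h) x = a * h x :> K.
Proof. by rewrite hk_scaleE hk_scale.unlock ffunE. Qed.
Lemma h0 x : (0 : H) x = 0 :> K.
Proof. by rewrite hk_zeroE hk_zero.unlock ffunE. Qed.
Lemma hsum (I : Type) (r : seq I) (P : pred I) (F : I -> H) x :
  (\sum_(i <- r | P i) F i) x = \sum_(i <- r | P i) F i x :> K.
Proof. by apply: (big_morph (fun h : H => h x : K)) => [h k|]; rewrite ?hD ?h0. Qed.

Lemma sum_delta (F : W -> K) x : \sum_w F w * (x == w)%:R = F x.
Proof.
rewrite (bigD1 x) //= eqxx mulr1 big1 ?addr0 // => w /negPf ne.
by rewrite eq_sym ne mulr0.
Qed.

Lemma hexp h : h = \sum_w (h w : K) *: T w.
Proof.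
apply/ffunP => x; rewrite hsum -[LHS](sum_delta (fun w => h w)).
by apply: eq_bigr => w _; rewrite hZ TE.
Qed.

Definition linP (A : H -> H) := forall (a : K) h k, A (a *: h + k) = a *: A h + A k.

Lemma lin0 A : linP A -> A 0 = 0.
Proof.
move=> /(_ (-1) 0 0); rewrite scaleN1r oppr0 addr0 scaleN1r => e.
by rewrite {1}e addNr.
Qed.
Lemma linD A h k : linP A -> A (h + k) = A h + A k.
Proof. by move=> /(_ 1 h k); rewrite !scale1r. Qed.
Lemma linZ A a h : linP A -> A (a *: h) = a *: A h.
Proof. by move=> l; have := l a h 0; rewrite !addr0 (lin0 l) addr0. Qed.
Lemma linsum A (I : Type) (r : seq I) (P : pred I) (F : I -> H) :
  linP A -> A (\sum_(i <- r | P i) F i) = \sum_(i <- r | P i) A (F i).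
Proof. by move=> l; apply: (big_morph A) => [h k|]; [exact: linD|exact: lin0]. Qed.

(** [Lop] and [Rop] are left and right multiplication by $T_s$ on coefficient functions. They are
    studied before the product is known to be associative, because associativity is deduced from
    their commuting. *)
Definition Lop s h : H := [ffun x => h (s * x)%g + (dl s x)%:R * q * h x : K].
Definition Rop t h : H := [ffun x => h (x * t)%g + (dr t x)%:R * q * h x : K].

Lemma Lop_lin s : linP (Lop s).
Proof. by move=> a h k; apply/ffunP => x; rewrite !(hD, hZ, ffunE) /=; ring. Qed.
Lemma Rop_lin s : linP (Rop s).
Proof. by move=> a h k; apply/ffunP => x; rewrite !(hD, hZ, ffunE) /=; ring. Qed.

Lemma ltn_dl s w : s \in gens -> (len w < len (s * w)%g)%N = ~~ dl s w.
Proof.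
move=> hs; case: (boolP (dl s w)) => h /=; last by rewrite len_gensN // ltnSn.
by apply/negbTE; rewrite -leqNgt ltnW.
Qed.

Lemma eq_mulgl s x w : s \in gens -> (x == s * w)%g = (s * x == w)%g.
Proof. by move=> hs; rewrite -(inj_eq (mulgI s)) gens_mulK. Qed.
Lemma eq_mulgr s x w : s \in gens -> (x == w * s)%g = (x * s == w)%g.
Proof. by move=> hs; rewrite -(inj_eq (mulIg s)) gens_mulKr. Qed.

Lemma TsE s h : s \in gens -> Ts s h = Lop s h.
Proof.
move=> hs; apply/ffunP => x; rewrite [LHS]ffunE [RHS]ffunE.
rewrite -[h (s * x)%g](sum_delta (fun w => h w)) -[_ * h x](sum_delta (fun w => (dl s w)%:R * q * h w)).
rewrite -big_split; apply: eq_bigr => w _ /=.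
rewrite ltn_dl // !TE eq_mulgl //; case: (dl s w) => /=; ring.
Qed.

(** The two operators interact only where $sx=xt$. There the two descent conditions coincide and are
    both reversed by passing to $xt$; elsewhere [dl_mulr] makes them independent. *)
Lemma Lop_Rop s t h : s \in gens -> t \in gens -> Lop s (Rop t h) = Rop t (Lop s h).
Proof.
move=> hs ht; apply/ffunP => x; rewrite !ffunE !mulgA.
have [e|ne] := eqVneq (s * x)%g (x * t)%g; last first.
  have -> : dl s (x * t)%g = dl s x by apply: dl_mulr => //; apply/eqP.
  have -> : dr t (s * x)%g = dr t x.
    rewrite !dr_dl // invMg (gens_inv hs); apply: dl_mulr => // e'; case/eqP: ne.
    by move: e' => /(congr1 invg); rewrite !invMg !invgK (gens_inv ht) (gens_inv hs).
  ring.
rewrite e; have -> : dl s (x * t)%g = ~~ dl s x by rewrite -e dl_mul.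
have -> : dr t (x * t)%g = ~~ dr t x by rewrite dr_mul.
have -> : dr t x = dl s x by rewrite /dr /dl e.
case: (dl s x) => /=; ring.
Qed.

Lemma Lop_T s w : s \in gens -> Lop s (T w) = T (s * w)%g + ((dl s w)%:R * q) *: T w.
Proof.
move=> hs; apply/ffunP => x; rewrite !(hD, hZ, ffunE) eq_mulgl //.
by have [->|ne] := eqVneq x w; rewrite ?mulr0.
Qed.
Lemma Rop_T s w : s \in gens -> Rop s (T w) = T (w * s)%g + ((dr s w)%:R * q) *: T w.
Proof.
move=> hs; apply/ffunP => x; rewrite !(hD, hZ, ffunE) eq_mulgr //.
by have [->|ne] := eqVneq x w; rewrite ?mulr0.
Qed.

Definition rcomm (A : H -> H) := forall t h, t \in gens -> A (Rop t h) = Rop t (A h).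

(** Every $T_w$ is reached from $T_1$ by right multiplications along a reduced expression.
    Associativity follows: both bracketings, as functions of the last factor, commute with all [Rop]
    and agree at $T_1$. *)
Lemma rcomm_ext A B : linP A -> linP B -> rcomm A -> rcomm B -> A (T 1%g) = B (T 1%g) -> A =1 B.
Proof.
move=> la lb ra rb e; have eT w : A (T w) = B (T w).
  rewrite -[w]invgK; elim/len_ind: {w}(w^-1%g) => [|s w hs hd IH]; first by rewrite invg1.
  have -> : T w^-1%g = Rop s (T (s * w)^-1%g).
    rewrite Rop_T // dr_dl // invgK dl_mul // hd /= mul0r scale0r addr0.
    by rewrite invMg (gens_inv hs) gens_mulKr.
  by rewrite ra // rb // IH.
by move=> h; rewrite [h]hexp !linsum //; apply: eq_bigr => w _; rewrite !linZ // eT.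
Qed.

Lemma Tact_lin (k : nat) x : linP (Tact k x).
Proof.
elim: k x => [|k IH] x; first by [].
move=> a h h' /=; rewrite /desc; case: pickP => // s /andP [hs _].
by rewrite !TsE // IH Lop_lin.
Qed.
Lemma Tact_rcomm (k : nat) x : rcomm (Tact k x).
Proof.
elim: k x => [|k IH] x; first by [].
move=> t h ht /=; rewrite /desc; case: pickP => // s /andP [hs _].
by rewrite !TsE // IH // Lop_Rop.
Qed.
Lemma Tact_T1 (k : nat) x : len x = k -> Tact k x (T 1%g) = T x.
Proof.
elim: k x => [|k IH] x /= e.
  by have /eqP := e; rewrite len_eq0 => /eqP ->.
have [x1|/descP [s [-> hs hd]]] := eqVneq x 1%g; first by move: e; rewrite x1 len1.
rewrite TsE // IH; last by move: e; rewrite (len_gens hs hd) => -[].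
by rewrite Lop_T // dl_mul // hd /= mul0r scale0r addr0 gens_mulK.
Qed.

Local Notation hm := (@hk_mul R n : H -> H -> H).
Lemma hmE h k : hm h k = \sum_x (h x : K) *: (Tact (len x) x k : H).
Proof. by apply/ffunP => x; rewrite hk_mul.unlock hsum !ffunE; apply: eq_bigr => w _; rewrite hZ. Qed.

Lemma hm_linr h : linP (hm h).
Proof.
move=> a k k'; rewrite !hmE scaler_sumr -big_split; apply: eq_bigr => x _ /=.
by rewrite Tact_lin scalerDr !scalerA mulrC.
Qed.
Lemma hm_linl k : linP (hm^~ k).
Proof.
move=> a h h'; rewrite !hmE scaler_sumr -big_split; apply: eq_bigr => x _ /=.
by rewrite hD hZ scalerDl scalerA.
Qed.
Lemma hm_rcomm h : rcomm (hm h).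
Proof.
move=> t k ht; rewrite !hmE (linsum _ _ _ (@Rop_lin t)); apply: eq_bigr => x _.
by rewrite Tact_rcomm // (linZ _ _ (@Rop_lin t)).
Qed.
Lemma hm1 : right_id (T 1%g) hm.
Proof. by move=> h; rewrite hmE [RHS]hexp; apply: eq_bigr => x _; rewrite Tact_T1. Qed.
Lemma hmA : associative hm.
Proof.
move=> a b c; have := @rcomm_ext (fun c => hm a (hm b c)) (hm (hm a b)).
apply => [e k k'||t k ht|t k ht|]; first by rewrite !hm_linr.
- exact: hm_linr.
- by rewrite !hm_rcomm.
- exact: hm_rcomm.
- by rewrite !hm1.
Qed.
Lemma hm_Ts s h : s \in gens -> hm (T s) h = Lop s h.
Proof.
move=> hs; move: h; apply: rcomm_ext; [exact: hm_linr|exact: Lop_lin|exact: hm_rcomm| |].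
  by move=> t h ht; rewrite Lop_Rop.
rewrite hm1 Lop_T // mulg1 [dl s 1%g]/dl len1 ltn0.
by rewrite /= mul0r scale0r addr0.
Qed.
Lemma hm1l : left_id (T 1%g) hm.
Proof.
apply: (@rcomm_ext (hm (T 1%g)) id); [exact: hm_linr|by []|exact: hm_rcomm|by []|exact: hm1].
Qed.
Lemma hmDl : left_distributive hm +%R.
Proof. by move=> a b c; rewrite (linD _ _ (@hm_linl c)). Qed.
Lemma hmDr : right_distributive hm +%R.
Proof. by move=> a b c; rewrite (linD _ _ (@hm_linr a)). Qed.
Lemma hm1' : right_id (@hk_one R n : H) hm.
Proof. by move=> h; rewrite hk_one.unlock; exact: hm1. Qed.
Lemma hm1l' : left_id (@hk_one R n : H) hm.
Proof. by move=> h; rewrite hk_one.unlock; exact: hm1l. Qed.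
Lemma hk_one_neq0 : (@hk_one R n : H) != 0.
Proof.
rewrite hk_one.unlock.
apply/eqP => /ffunP /(_ 1%g); rewrite TE h0 eqxx => /eqP.
by rewrite oner_eq0.
Qed.
End Hecke.

HB.instance Definition _ R n := GRing.Zmodule_isNzRing.Build (hecke R n)
  (@hmA R n) (@hm1l' R n) (@hm1' R n) (@hmDl R n) (@hmDr R n) (@hk_one_neq0 R n).
Section Hecke2.
Variables (R : realType) (n : nat).
Local Notation K := (K R).
Local Notation v := (vK R).
Local Notation q := (v - v^-1).
Local Notation W := (W n).
Local Notation H := (hecke R n).
Local Notation gens := (gens n).
Local Notation T := (@T R n : W -> H).
Implicit Types (s t w x y z : W) (h k : H).

Local Notation hm := (@hk_mul R n : H -> H -> H).
Lemma hmulE h k : hmul h k = h * k :> H.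
Proof. by rewrite -[h * k]/(hk_mul h k) hk_mul.unlock. Qed.
Lemma T1E : T 1%g = 1.
Proof. by rewrite -[1]/(hk_one R n : H) hk_one.unlock. Qed.

Lemma ZMl (a : K) h k : (a *: h) * k = a *: (h * k).
Proof. exact: (linZ a h (@hm_linl R n k)). Qed.
Lemma ZMr (a : K) h k : h * (a *: k) = a *: (h * k).
Proof. exact: (linZ a k (@hm_linr R n h)). Qed.

Lemma TsM s h x : s \in gens -> (T s * h) x = h (s * x)%g + (dl s x)%:R * q * h x :> K.
Proof. by move=> hs; rewrite -[T s * h]/(hm (T s) h) hm_Ts // ffunE. Qed.

Lemma T_TsM s w : s \in gens -> T s * T w = T (s * w)%g + ((dl s w)%:R * q) *: T w.
Proof. by move=> hs; rewrite -[T s * T w]/(hm (T s) (T w)) hm_Ts // Lop_T. Qed.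

Lemma hM_Ts s h : s \in gens -> h * T s = Rop s h.
Proof.
move=> hs; rewrite -[h in RHS](hm1 h) -hm_rcomm // Rop_T // mul1g [dr s 1%g]/dr len1 ltn0.
by rewrite /= mul0r scale0r addr0.
Qed.

Lemma MTs s h x : s \in gens -> (h * T s) x = h (x * s)%g + (dr s x)%:R * q * h x :> K.
Proof. by move=> hs; rewrite hM_Ts // ffunE. Qed.

Lemma T_up s w : s \in gens -> ~~ dl s w -> T s * T w = T (s * w)%g.
Proof. by move=> hs /negPf h; rewrite T_TsM // h /= mul0r scale0r addr0. Qed.

Lemma T_down s w : s \in gens -> dl s w -> T w = T s * T (s * w)%g.
Proof. by move=> hs hd; rewrite T_up ?gens_mulK // dl_mul // hd. Qed.

Lemma Ts2 s : s \in gens -> T s * T s = 1 + q *: T s.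
Proof.
move=> hs; have hd : dl s s by rewrite -[X in dl s X](mulg1 s) dl_mul // /dl len1 ltn0.
by rewrite (T_TsM s hs) hd mul1r (gens_sqr hs) T1E.
Qed.

Lemma gens_ind (Q : H -> Prop) : Q 1 -> (forall h k, Q h -> Q k -> Q (h + k)) ->
  (forall (a : K) h, Q h -> Q (a *: h)) -> (forall s h, s \in gens -> Q h -> Q (T s * h)) -> forall h, Q h.
Proof.
move=> Q1 QD QZ QM h; rewrite [h]hexp; apply: big_ind => //.
  by rewrite -[0](scale0r (1 : H)); apply: QZ.
move=> w _; apply: QZ; elim/len_ind: w => [|s w hs hd IH]; first by rewrite T1E.
by rewrite (T_down hs hd); apply: QM.
Qed.
End Hecke2.

(** * The antiautomorphism $T_w\mapsto T_{w^{-1}}$ and the bar involution *)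

HB.lock Definition flat R n (h : hecke R n) : hecke R n := [ffun x => h x^-1%g].
HB.lock Definition TsI R n (s : W n) : hecke R n :=
  (T R s : hecke R n) - (vK R - (vK R)^-1) *: (1 : hecke R n).
HB.lock Definition Cs R n (s : W n) : hecke R n := (T R s : hecke R n) - vK R *: (1 : hecke R n).
HB.lock Definition br R n (h : hecke R n) : hecke R n := bar h.
HB.lock Definition Ti R n (x : W n) : hecke R n := Tinv R (len x) x.

Section KL.
Variables (R : realType) (n : nat).
Local Notation K := (K R).
Local Notation v := (vK R).
Local Notation q := (v - v^-1).
Local Notation W := (W n).
Local Notation H := (hecke R n).
Local Notation gens := (gens n).
Local Notation T := (@T R n : W -> H).
Implicit Types (s t w x y z : W) (h k : H).

Lemma flatE h x : flat h x = h x^-1%g. Proof. by rewrite flat.unlock ffunE. Qed.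
Lemma flatK h : flat (flat h) = h.
Proof. by apply/ffunP => x; rewrite !flatE invgK. Qed.
Lemma flatD h k : flat (h + k) = flat h + flat k.
Proof. by apply/ffunP => x; rewrite !(flatE, hD). Qed.
Lemma flatZ (a : K) h : flat (a *: h) = a *: flat h.
Proof. by apply/ffunP => x; rewrite !(flatE, hZ). Qed.
Lemma flatT w : flat (T w) = T w^-1%g.
Proof. by apply/ffunP => x; rewrite flatE !TE -eq_invg_sym. Qed.

Lemma flatM h k : flat (h * k) = flat k * flat h.
Proof.
elim/gens_ind: h k => [k|h h' IH IH' k|a h IH k|s h hs IH k].
- by rewrite mul1r -T1E flatT invg1 T1E mulr1.
- by rewrite mulrDl !flatD IH IH' mulrDr.
- by rewrite ZMl !flatZ IH ZMr.
have flatTs h' : flat (T s * h') = flat h' * T s.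
  apply/ffunP => x; rewrite flatE MTs // TsM // !flatE invMg (gens_inv hs).
  by rewrite dr_dl.
by rewrite -mulrA !flatTs IH mulrA.
Qed.

Local Notation Ti := (@Ti R n).
Local Notation TsI := (@TsI R n).
Local Notation Cs := (@Cs R n).
Local Notation br := (@br R n).
Local Notation flat := (@flat R n).
Lemma TsIE s : TsI s = T s - q *: (1 : H). Proof. by rewrite TsI.unlock. Qed.
Lemma CsE s : Cs s = T s - v *: (1 : H). Proof. by rewrite Cs.unlock. Qed.

Lemma TsInvE s : TsInv R s = TsI s.
Proof. by apply/ffunP => x; rewrite [LHS]ffunE TsIE hD hN hZ -T1E. Qed.

Lemma TsTsI s : s \in gens -> T s * TsI s = 1.
Proof. by move=> hs; rewrite TsIE mulrBr Ts2 // ZMr mulr1 addrK. Qed.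
Lemma TsITs s : s \in gens -> TsI s * T s = 1.
Proof. by move=> hs; rewrite TsIE mulrBl Ts2 // ZMl mul1r addrK. Qed.

Lemma TTi x : T x * Ti x = 1 /\ Ti x * T x = 1.
Proof.
rewrite Ti.unlock; move e: (len x) => m; elim: m x e => [|m IH] x e.
  by have /eqP := e; rewrite len_eq0 => /eqP -> /=; rewrite T1E !mul1r.
have [x1|/descP [s [ds hs hd]]] := eqVneq x 1%g; first by move: e; rewrite x1 len1.
have e' : len (s * x)%g = m by move: e; rewrite (len_gens hs hd) => -[].
rewrite /= ds TsInvE hmulE; have [IH1 IH2] := IH _ e'.
rewrite (T_down R hs hd); split.
  by rewrite mulrA -[T s * _ * _]mulrA IH1 mulr1 TsTsI.
by rewrite mulrA -[_ * TsI s * _]mulrA TsITs // mulr1 IH2.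
Qed.

Lemma inv_uniq (A : nzRingType) (a b c : A) : b * a = 1 -> a * c = 1 -> b = c.
Proof. by move=> h1 h2; rewrite -[b]mulr1 -h2 mulrA h1 mul1r. Qed.

Lemma brE h : br h = \sum_w (barK (h w) : K) *: Ti w^-1%g.
Proof. by apply/ffunP => x; rewrite br.unlock Ti.unlock hsum !ffunE; apply: eq_bigr => w _; rewrite hZ. Qed.

Lemma brD h k : br (h + k) = br h + br k.
Proof.
rewrite !brE -big_split; apply: eq_bigr => w _ /=.
by rewrite hD rmorphD scalerDl.
Qed.
Lemma brZ (a : K) h : br (a *: h) = barK a *: br h.
Proof. by rewrite !brE scaler_sumr; apply: eq_bigr => w _; rewrite hZ rmorphM scalerA. Qed.
Lemma brN h : br (- h) = - br h.
Proof. by rewrite -scaleN1r brZ rmorphN1 scaleN1r. Qed.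
Lemma br0 : br 0 = 0.
Proof. by rewrite -[0](scale0r (1 : H)) brZ rmorph0 !scale0r. Qed.
Lemma br_sum (I : Type) (r : seq I) (P : pred I) (F : I -> H) :
  br (\sum_(i <- r | P i) F i) = \sum_(i <- r | P i) br (F i).
Proof. exact: (big_morph br brD br0). Qed.

Lemma brT w : br (T w) = Ti w^-1%g.
Proof.
rewrite brE (bigD1 w) //= TE eqxx rmorph1 scale1r big1 ?addr0 // => x /negPf ne.
by rewrite TE ne rmorph0 scale0r.
Qed.

(** [Tinv] follows the descents picked by [desc]; uniqueness of inverses gives the recursion for an
    arbitrary descent [s]. *)
Lemma brT_down s w : s \in gens -> dl s w -> br (T w) = TsI s * br (T (s * w)%g).
Proof.
move=> hs hd; rewrite !brT invMg (gens_inv hs); apply: esym.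
set a := Ti _; apply: (@inv_uniq _ (T w^-1%g)); last by case: (TTi w^-1%g).
have -> : T w^-1%g = T (w^-1 * s)%g * T s.
  rewrite hM_Ts // Rop_T // gens_mulKr // dr_dl // invMg invgK (gens_inv hs) dl_mul // hd.
  by rewrite mul0r scale0r addr0.
rewrite mulrA -[TsI s * a * _]mulrA; have [_ ->] := TTi (w^-1 * s)%g.
by rewrite mulr1 TsITs.
Qed.

Lemma brTsM s h : s \in gens -> br (T s * h) = TsI s * br h.
Proof.
move=> hs; rewrite [h]hexp mulr_sumr !br_sum mulr_sumr; apply: eq_bigr => w _.
rewrite ZMr !brZ ZMr; congr (_ *: _).
case: (boolP (dl s w)) => hd; last first.
  by rewrite T_up // (@brT_down s (s * w)%g) ?dl_mul ?hd // gens_mulK.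
have e : TsI s * TsI s = 1 - q *: TsI s by rewrite {2}TsIE mulrBr TsITs // ZMr mulr1.
rewrite T_TsM // hd mul1r brD brZ (brT_down hs hd) rmorphB fmorphV /= barK_v invrK.
rewrite mulrA e mulrBl mul1r ZMl -scaleNr; congr (_ + _ *: _).
by rewrite opprB.
Qed.

Lemma br1 : br 1 = 1.
Proof.
rewrite -T1E brT invg1; have [+ _] := TTi (1%g : W).
by rewrite T1E mul1r.
Qed.

Lemma brTs s : s \in gens -> br (T s) = TsI s.
Proof. by move=> hs; have := brTsM 1 hs; rewrite mulr1 br1 mulr1. Qed.

Lemma brM h k : br (h * k) = br h * br k.
Proof.
elim/gens_ind: h k => [k|h h' IH IH' k|a h IH k|s h hs IH k].
- by rewrite br1 !mul1r.
- by rewrite mulrDl !brD IH IH' mulrDl.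
- by rewrite ZMl !brZ IH ZMl.
by rewrite -mulrA !brTsM // IH mulrA.
Qed.

Lemma br_flat h : br (flat h) = flat (br h).
Proof.
elim/gens_ind: h => [|h k IH IH'|a h IH|s h hs IH].
- by rewrite br1 -T1E flatT invg1 T1E br1.
- by rewrite !(flatD, brD) IH IH'.
- by rewrite !(flatZ, brZ) IH.
have fTs : flat (T s) = T s by rewrite flatT (gens_inv hs).
have fI : flat (TsI s) = TsI s.
  by rewrite TsIE flatD fTs -scaleN1r !flatZ -T1E flatT invg1 T1E.
by rewrite flatM brM IH fTs brTs // brTsM // flatM fI.
Qed.

(** Unitriangularity of bar with respect to length: the term $-(v-v^{-1})$ of $T_s^{-1}$ multiplies
    the bar of $T_{sw}$, which has no coefficient in lengths from $l(w)$ on. *)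
Lemma brT_tri w x : (len w <= len x)%N -> br (T w) x = T w x :> K.
Proof.
elim/len_ind: w x => [|s w hs hd IH] x; first by rewrite T1E br1.
rewrite (brT_down hs hd) (T_down R hs hd) (len_gens hs hd) => lx.
rewrite TsIE mulrBl ZMl mul1r hD hN hZ !TsM //.
have lsx : (len (s * w)%g <= len (s * x)%g)%N.
  case: (boolP (dl s x)) => h; first by move: lx; rewrite (len_gens hs h).
  by rewrite (len_gensN hs h); apply/leqW/ltnW.
have lx' := ltnW lx; rewrite !IH //.
rewrite [T (s * w)%g x]TE; case: eqP lx => [->|_ _]; first by rewrite ltnn.
by rewrite !mulr0 subr0.
Qed.

(** By unitriangularity the coefficient at a longest element of the support is itself bar-invariant,
    hence 0 by [in_vZv_bar0]. *)
Lemma br_eq0 h : br h = h -> (forall y, in_vZv (h y : K)) -> h = 0.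
Proof.
move=> hb hv; apply/ffunP => x0; rewrite h0; apply/eqP; apply: contraT => nz.
case: (@arg_maxnP _ x0 (fun x => h x != 0) (@len n) nz) => x hx mx.
suff e : barK (h x : K) = h x by case/eqP: hx; apply: in_vZv_bar0.
rewrite -[in RHS]hb brE hsum (bigD1 x) //= hZ -brT brT_tri // TE eqxx mulr1 big1 ?addr0 // => w ne.
have [->|hw] := eqVneq (h w) 0; first by rewrite rmorph0 scale0r h0.
by rewrite hZ -brT brT_tri ?TE 1?eq_sym ?(negPf ne) ?mulr0 //; apply: mx.
Qed.

Lemma brCs s : s \in gens -> br (Cs s) = Cs s.
Proof.
move=> hs; rewrite CsE brD brN brZ br1 brTs // barK_v TsIE -addrA -opprD -scalerDl.
by rewrite subrK.
Qed.

Lemma CsM s h x : s \in gens ->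
  (Cs s * h) x = h (s * x)%g - (if dl s x then v^-1 else v) * h x :> K.
Proof.
move=> hs; rewrite CsE mulrBl ZMl mul1r hD hN hZ TsM //.
by case: (dl s x) => /=; ring.
Qed.

End KL.

HB.lock Definition KC R n (w : W n) : hecke R n := KLC R w.
HB.lock Definition cc R n (h : hecke R n) : W n -> K R := fun y => @Ccoord R n h y.

(** * The Kazhdan-Lusztig basis *)

Section KLbasis.
Variables (R : realType) (n : nat).
Local Notation K := (K R).
Local Notation v := (vK R).
Local Notation W := (W n).
Local Notation H := (hecke R n).
Local Notation gens := (gens n).
Local Notation T := (@T R n : W -> H).
Local Notation br := (@br R n).
Local Notation flat := (@flat R n).
Local Notation Cs := (@Cs R n).
Local Notation C := (@KC R n).
Local Notation cc := (@cc R n).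
Implicit Types (s t w x y z : W) (h k : H).

Definition isKL w h := br h = h /\ forall y, in_vZv (h y - T w y : K).

Lemma isKL_uniq w h k : isKL w h -> isKL w k -> h = k.
Proof.
move=> [b1 l1] [b2 l2]; apply/eqP; rewrite -subr_eq0; apply/eqP; apply: br_eq0.
  by rewrite brD brN b1 b2.
move=> y; have := in_vZvB (l1 y) (l2 y); rewrite hD hN.
by rewrite opprB addrA subrK.
Qed.

Lemma TZ w y : in_Zv (T w y : K).
Proof. by rewrite TE; case: eqP => _; [exact: (in_Zv_int R 1)|exact: (in_Zv_int R 0)]. Qed.

Lemma isKL_Zv w h y : isKL w h -> in_Zv (h y : K).
Proof. by case=> _ /(_ y) /in_vZv_Zv /in_ZvD /(_ (TZ w y)); rewrite subrK. Qed.

Lemma isKL_vZv w h y : isKL w h -> y != w -> in_vZv (h y : K).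
Proof. by case=> _ /(_ y) + /negPf ne; rewrite TE ne subr0. Qed.

(** The inductive construction: $C_sC_{sw}$ is bar-invariant with coefficients in $\mathbb Z[v]$,
    and the values of its lower coefficients at $v=0$ are removed by subtracting integer multiples
    of shorter elements. *)
Lemma isKL_ex w : exists h, isKL w h /\ forall y, (len w <= len y)%N -> h y = T w y :> K.
Proof.
have [m] := ubnP (len w); elim: m w => // m IH w; rewrite ltnS => lw.
have [->|/descent_ex [s hs hd]] := eqVneq w 1%g.
  exists 1; split; last by rewrite -T1E.
  by split=> [|y]; rewrite ?br1 // -T1E subrr; exact: in_vZv0.
have lsw := len_gens hs hd.
have [k [hk tk]] := IH (s * w)%g (leq_trans (eq_leq (esym lsw)) lw).
pose g := Cs s * k.
have gE z : g z = k (s * z)%g - (if dl s z then v^-1 else v) * k z :> K by rewrite CsM.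
have gtop z : (len w <= len z)%N -> g z = T w z :> K.
  move=> lz; have lsz : (len (s * w)%g <= len (s * z)%g)%N.
    case: (boolP (dl s z)) => h; first by move: lz; rewrite lsw (len_gens hs h).
    by rewrite (len_gensN hs h); apply: leqW; apply: leq_trans lz; rewrite lsw.
  rewrite gE (tk _ lsz) tk; last by apply: leq_trans lz; rewrite lsw.
  rewrite !TE (inj_eq (mulgI s)); case: (z =P s * w)%g lz => [->|_ _]; last by rewrite mulr0 subr0.
  by rewrite lsw ltnn.
(* The factor $v^{-1}$ occurs only for $sz<z$; then $z\ne sw$, because [s] is no descent of $sw$,
   and [k z] is divisible by $v$. *)
have gZ z : in_Zv (g z : K).
  rewrite gE; apply: in_ZvB; first exact: isKL_Zv hk.
  case: (boolP (dl s z)) => h.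
    apply: in_vZv_div; apply: isKL_vZv hk _; apply: contraL h => /eqP ->.
    by rewrite dl_mul // hd.
  by apply: in_ZvM; [exact: in_Zv_v|exact: isKL_Zv hk].
have brg : br g = g by rewrite brM brCs // (proj1 hk).
have [f Hf] : exists f : W -> int * H, forall z,
    in_vZv (g z - (f z).1%:~R : K) /\ ((len z < len w)%N ->
     isKL z (f z).2 /\ forall y, (len z <= len y)%N -> (f z).2 y = T z y :> K).
  suff F z : exists p : int * H, in_vZv (g z - p.1%:~R : K) /\ ((len z < len w)%N ->
     isKL z p.2 /\ forall y, (len z <= len y)%N -> p.2 y = T z y :> K).
    exists (fun z => projT1 (constructive_indefinite_description _ (F z))) => z.
    exact: (projT2 (constructive_indefinite_description _ (F z))).
  have [a Ha] := in_Zv_residue (gZ z).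
  case: (ltnP (len z) (len w)) => lz; last by exists (a, 0).
  by have [k' Hk'] := IH z (leq_trans lz lw); exists (a, k').
(* All residues can be removed at once: off [z] the element [(f z).2] lies in $v\mathbb Z[v]$, so
   one correction does not disturb the others, and integers are bar-invariant. *)
pose L := \sum_(z | (len z < len w)%N) ((f z).1%:~R : K) *: (f z).2.
have Ltop y : (len w <= len y)%N -> L y = 0 :> K.
  move=> ly; rewrite hsum big1 // => z lz; case: (Hf z) => _ /(_ lz) [_ t].
  rewrite hZ t; last by apply: ltnW; apply: leq_trans ly.
  by rewrite TE; case: eqP ly => [->|]; rewrite ?mulr0 // leqNgt lz.
exists (g - L); split; last by move=> y ly; rewrite hD hN gtop // Ltop // subr0.
split.
  rewrite brD brN brg br_sum; congr (_ - _); apply: eq_bigr => z lz.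
  by case: (Hf z) => _ /(_ lz) [[b _] _]; rewrite brZ rmorph_int b.
move=> y; rewrite hD hN; case: (leqP (len w) (len y)) => ly.
  by rewrite gtop // Ltop // subr0 subrr; exact: in_vZv0.
have -> : T w y = 0 :> K by rewrite TE; case: eqP ly => // ->; rewrite ltnn.
rewrite subr0 hsum (bigD1 y) //= opprD addrA.
case: (Hf y) => r /(_ ly) [_ t]; apply: in_vZvB.
  by rewrite hZ t // TE eqxx mulr1.
apply: in_vZv_sum => z /andP [lz ne]; rewrite hZ; apply: in_vZvMl; first exact: in_Zv_int.
by case: (Hf z) => _ /(_ lz) [+ _] => kz; apply: (isKL_vZv kz); rewrite eq_sym.
Qed.

Lemma C_isKL w : isKL w (C w).
Proof.
rewrite KC.unlock /KLC; set P := fun _ => _.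
have : exists h, P h.
  have [h [[b l] _]] := isKL_ex w; exists h; split=> //.
  by move: b; rewrite br.unlock.
move=> /(epsilon_spec (inhabits (Defs.T R 1%g))) [b l]; split=> //.
by rewrite br.unlock.
Qed.

Lemma brC w : br (C w) = C w. Proof. exact: (proj1 (C_isKL w)). Qed.
Lemma C_top w y : (len w <= len y)%N -> C w y = T w y :> K.
Proof. by have [h [hk]] := isKL_ex w; rewrite (isKL_uniq hk (C_isKL w)); apply. Qed.
Lemma C_vZv w y : y != w -> in_vZv (C w y : K).
Proof. exact: isKL_vZv (C_isKL w). Qed.
Lemma C_Zv w y : in_Zv (C w y : K).
Proof. exact: isKL_Zv (C_isKL w). Qed.
Lemma C_diag w : C w w = 1 :> K.
Proof. by rewrite C_top // TE eqxx. Qed.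

Lemma comb0 (a : W -> K) : \sum_w a w *: C w = 0 -> forall w, a w = 0.
Proof.
move=> e w0; apply/eqP; apply: contraT => nz.
case: (@arg_maxnP _ w0 (fun w => a w != 0) (@len n) nz) => w hw mw.
case/negP: hw; apply/eqP; move: e => /(congr1 (fun h : H => h w : K)).
rewrite h0 hsum (bigD1 w) //= hZ C_diag mulr1 big1 ?addr0 // => z ne.
have [->|az] := eqVneq (a z) 0; first by rewrite scale0r h0.
by rewrite hZ C_top ?TE 1?eq_sym ?(negPf ne) ?mulr0 //; apply: mw.
Qed.

(** The transition matrix is unitriangular and congruent to the identity modulo $v$, and so is its
    inverse. The congruence is what later makes limits at $v=0$ the same in both bases. *)
Lemma T_comb w : exists a : W -> K, T w = \sum_y a y *: C y /\ forall y, in_vZv (a y - T w y).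
Proof.
have [m] := ubnP (len w); elim: m w => // m IH w; rewrite ltnS => lw.
have [f Hf] : exists f : W -> W -> K, forall z, (len z < len w)%N ->
    T z = \sum_y f z y *: C y /\ forall y, in_vZv (f z y - T z y).
  suff F z : exists a : W -> K, (len z < len w)%N -> T z = \sum_y a y *: C y /\
      forall y, in_vZv (a y - T z y).
    exists (fun z => projT1 (constructive_indefinite_description _ (F z))) => z.
    exact: (projT2 (constructive_indefinite_description _ (F z))).
  case: (ltnP (len z) (len w)) => lz; last by exists (fun=> 0).
  by have [a Ha] := IH z (leq_trans lz lw); exists a.
have e : C w = T w + \sum_(z | (len z < len w)%N) (C w z : K) *: T z.
  rewrite [LHS]hexp (bigID (fun z => (len z < len w)%N)) /= addrC; congr (_ + _).
  rewrite (bigD1 w) ?ltnn //= C_diag scale1r big1 ?addr0 // => z /andP [].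
  rewrite -leqNgt => lz ne; rewrite C_top // TE (negPf ne); exact: scale0r.
exists (fun y => (y == w)%:R - \sum_(z | (len z < len w)%N) (C w z : K) * f z y); split; last first.
  move=> y; rewrite TE addrAC subrr add0r; apply: in_vZvN; apply: in_vZv_sum => z lz.
  rewrite mulrC; apply: in_vZvMl; last by apply: C_vZv; apply: contraTneq lz => ->; rewrite ltnn.
  have [_ /(_ y) /in_vZv_Zv /in_ZvD /(_ (TZ z y))] := Hf z lz; by rewrite subrK.
have -> : T w = C w - \sum_(z | (len z < len w)%N) (C w z : K) *: T z by rewrite {1}e addrK.
under [RHS]eq_bigr => y _ do rewrite scalerBl.
rewrite big_split /= sumrN; congr (_ - _).
  rewrite (bigD1 w) //= eqxx scale1r big1 ?addr0 // => y /negPf ->.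
  by rewrite scale0r.
under [RHS]eq_bigr => y _ do rewrite scaler_suml.
rewrite exchange_big /=; apply: eq_bigr => z lz.
rewrite (proj1 (Hf z lz)) scaler_sumr; apply: eq_bigr => y _.
by rewrite scalerA.
Qed.

Lemma hlinE (a : W -> K) : hlin a (@KLC R n) = \sum_y a y *: C y.
Proof.
by apply/ffunP => x; rewrite hsum ffunE; apply: eq_bigr => y _; rewrite hZ KC.unlock.
Qed.

Lemma ccE h : h = \sum_y cc h y *: C y.
Proof.
rewrite -hlinE cc.unlock /Ccoord.
suff /(epsilon_spec (inhabits h)) : exists a : HK R n, h = hlin a (@KLC R n) by [].
have [f Hf] : exists f : W -> W -> K, forall w, T w = \sum_y f w y *: C y.
  suff F w : exists a : W -> K, T w = \sum_y a y *: C y.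
    exists (fun z => projT1 (constructive_indefinite_description _ (F z))) => z.
    exact: (projT2 (constructive_indefinite_description _ (F z))).
  by have [a [Ha _]] := T_comb w; exists a.
exists [ffun y => \sum_w (h w : K) * f w y]; rewrite hlinE {1}[h]hexp.
under [RHS]eq_bigr => y _ do rewrite ffunE scaler_suml.
rewrite exchange_big /=; apply: eq_bigr => w _; rewrite Hf scaler_sumr.
by apply: eq_bigr => y _; rewrite scalerA.
Qed.

Lemma cc_uniq h (a : W -> K) : h = \sum_y a y *: C y -> forall y, cc h y = a y.
Proof.
move=> e y; apply/eqP; rewrite -subr_eq0; apply/eqP.
apply: (@comb0 (fun y => cc h y - a y)); under eq_bigr => z _ do rewrite scalerBl.
by rewrite big_split /= sumrN -e -ccE subrr.
Qed.

Lemma ccD h k y : cc (h + k) y = cc h y + cc k y.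
Proof.
apply: (@cc_uniq _ (fun y => cc h y + cc k y)).
under eq_bigr => z _ do rewrite scalerDl.
by rewrite big_split /= -!ccE.
Qed.
Lemma ccZ (a : K) h y : cc (a *: h) y = a * cc h y.
Proof.
apply: (@cc_uniq _ (fun y => a * cc h y)).
under eq_bigr => z _ do rewrite -scalerA.
by rewrite -scaler_sumr -ccE.
Qed.
Lemma cc0 y : cc 0 y = 0.
Proof. by rewrite -(scale0r (1 : H)) ccZ mul0r. Qed.
Lemma cc_sum (I : Type) (r : seq I) (P : pred I) (F : I -> H) y :
  cc (\sum_(i <- r | P i) F i) y = \sum_(i <- r | P i) cc (F i) y.
Proof. by apply: (big_morph (cc^~ y)) => [h k|]; rewrite ?ccD ?cc0. Qed.
Lemma ccC w y : cc (C w) y = (y == w)%:R.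
Proof.
apply: (@cc_uniq _ (fun y => (y == w)%:R)).
rewrite (bigD1 w) //= eqxx scale1r big1 ?addr0 // => z /negPf ->.
by rewrite scale0r.
Qed.
Lemma ccT w y : in_vZv (cc (T w) y - T w y).
Proof. by have [a [e l]] := T_comb w; rewrite (cc_uniq e). Qed.
Lemma cc_br h y : br h = h -> barK (cc h y) = cc h y.
Proof.
move=> bh; apply: esym; apply: (@cc_uniq _ (fun y => barK (cc h y))).
rewrite -{1}bh {1}[h]ccE br_sum; apply: eq_bigr => z _.
by rewrite brZ brC.
Qed.
Lemma cc_expand h y : cc h y = \sum_w (h w : K) * cc (T w) y.
Proof. by rewrite {1}[h]hexp cc_sum; apply: eq_bigr => w _; rewrite ccZ. Qed.
Lemma cc_Zv h y : (forall x, in_Zv (h x : K)) -> in_vZv (cc h y - h y).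
Proof.
move=> hZv; rewrite cc_expand (_ : h y = \sum_w (h w : K) * T w y :> K); last first.
  by rewrite {1}[h]hexp hsum; apply: eq_bigr => w _; rewrite hZ.
by rewrite -sumrB; apply: in_vZv_sum => w _; rewrite -mulrBr; apply: in_vZvMl => //; apply: ccT.
Qed.

End KLbasis.

(* The involution T_w |-> eps_w T_w, v |-> v^{-1}; it exchanges C_w and eps_w C'_w. *)
HB.lock Definition jm R n (h : hecke R n) : hecke R n := [ffun x => barK (h x) * @sgnK R n x].

Section Cells.
Variables (R : realType) (n : nat).
Local Notation K := (K R).
Local Notation v := (vK R).
Local Notation W := (W n).
Local Notation H := (hecke R n).
Local Notation gens := (gens n).
Local Notation T := (@T R n : W -> H).
Local Notation br := (@br R n).
Local Notation flat := (@flat R n).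
Local Notation Cs := (@Cs R n).
Local Notation C := (@KC R n).
Local Notation cc := (@cc R n).
Local Notation jm := (@jm R n).
Implicit Types (s t w x y z : W) (h k : H).

Lemma C_gen s : s \in gens -> C s = Cs s.
Proof.
move=> hs; apply: (isKL_uniq (C_isKL R s)); split; first exact: brCs.
move=> y; rewrite CsE hD hN hZ addrAC subrr add0r -T1E; apply: in_vZvN.
by rewrite mulrC; apply: in_vZvMl; [exact: TZ|exact: in_vZv_v].
Qed.

(** The $C$-coordinates of a bar-invariant element are bar-invariant; with coefficients in $\mathbb
    Z[v]$ they agree modulo $v$ with the $T$-coefficients. So they are integers that can be read off
    at $v=0$. *)
Lemma cc_eq_int (g : H) (m : int) z : br g = g -> (forall x, in_Zv (g x : K)) ->
  in_vZv (g z - m%:~R : K) -> cc g z = m%:~R.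
Proof.
move=> bg gZ gz; apply/eqP; rewrite -subr_eq0; apply/eqP; apply: in_vZv_bar0.
  by have := in_vZvD (cc_Zv z gZ) gz; rewrite addrA subrK.
by rewrite rmorphB rmorph_int /= cc_br.
Qed.

Lemma CsC_Zv s w z : s \in gens -> ~~ dl s w -> in_Zv ((Cs s * C w) z : K).
Proof.
move=> hs hd; rewrite CsM //; apply: in_ZvB; first exact: C_Zv.
case: (boolP (dl s z)) => h; last by apply: in_ZvM; [exact: in_Zv_v|exact: C_Zv].
by apply: in_vZv_div; apply: C_vZv; apply: contraNneq hd => <-.
Qed.

Lemma CsC_br s w : s \in gens -> br (Cs s * C w) = Cs s * C w.
Proof. by move=> hs; rewrite brM brCs // brC. Qed.

(** The coefficient of $T_z$ in $C_sC_w$ is $-v$ times that of $T_{sz}$, so it vanishes at $v=0$ and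
    [cc_eq_int] applies with the integer 0. *)
Lemma CsC_supp0 s w z : s \in gens -> ~~ dl s w -> ~~ dl s z -> cc (Cs s * C w) z = 0.
Proof.
move=> hs hd hz; apply: (@cc_eq_int _ 0) => [||]; first exact: CsC_br.
  by move=> x; apply: CsC_Zv.
rewrite subr0; have -> : (Cs s * C w) z = (- v) * (Cs s * C w) (s * z)%g :> K.
  rewrite !CsM // gens_mulK // dl_mul // hz (negPf hz) /= mulrBr mulNr mulrA mulNr mulfV ?v_neq0 //.
  by rewrite mulN1r opprK addrC.
by rewrite mulNr; apply: in_vZvN; rewrite mulrC; apply: in_vZvMl; [exact: CsC_Zv|exact: in_vZv_v].
Qed.

Lemma CsC_top s w z : s \in gens -> ~~ dl s w -> (len (s * w)%g <= len z)%N ->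
  cc (Cs s * C w) z = (z == s * w)%g%:R.
Proof.
move=> hs hd lz; have -> : ((z == s * w)%g%:R : K) = ((z == s * w)%g : int)%:~R by case: eqP.
apply: cc_eq_int; [exact: CsC_br|by move=> x; apply: CsC_Zv|].
have lw : (len w < len z)%N by apply: leq_trans lz; rewrite len_gensN.
have lsz : (len w <= len (s * z)%g)%N.
  case: (boolP (dl s z)) => h; first by move: lw; rewrite (len_gens hs h).
  by rewrite (len_gensN hs h); apply: leqW; apply: ltnW.
rewrite CsM // (C_top R lsz) (C_top R (ltnW lw)) !TE eq_mulgl //.
have -> : (z == w) = false by apply/eqP => e; move: lw; rewrite e ltnn.
by rewrite mulr0 subr0; case: eqP => _; rewrite subrr; exact: in_vZv0.
Qed.

Lemma TsCs s : s \in gens -> T s * Cs s = (- v^-1) *: Cs s.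
Proof.
move=> hs; apply/ffunP => x; rewrite hZ CsE mulrBr Ts2 // ZMr mulr1 !(hD, hN, hZ).
have e : v^-1 * v = 1 by rewrite mulVf // v_neq0.
move: (T s x : K) ((1 : H) x : K) => a b.
have -> : - v^-1 * (a - v * b) = - v^-1 * a + (v^-1 * v) * b by ring.
by rewrite e; ring.
Qed.

Lemma CsCs s : s \in gens -> Cs s * Cs s = (- (v + v^-1)) *: Cs s.
Proof.
by move=> hs; rewrite {1}CsE mulrBl TsCs // ZMl mul1r -scaleNr -scalerDl opprD addrC.
Qed.

Lemma CsP s h : s \in gens -> T s * h = (- v^-1) *: h -> Cs s * h = (- (v + v^-1)) *: h.
Proof. by move=> hs e; rewrite CsE mulrBl e ZMl mul1r -scaleNr -scalerDl opprD addrC. Qed.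

Lemma CsPV s h : s \in gens -> Cs s * h = (- (v + v^-1)) *: h -> T s * h = (- v^-1) *: h.
Proof.
move=> hs; rewrite CsE mulrBl ZMl mul1r => /eqP; rewrite subr_eq => /eqP ->.
by rewrite -scalerDl opprD addrC addrA subrr add0r.
Qed.

(** $C_w$ is $C_sC_{sw}$ minus multiples of shorter $C_z$ with $sz<z$. The product is an eigenvector
    since $C_s^2=-(v+v^{-1})C_s$, the others by induction. *)
Lemma CsC_down s w : s \in gens -> dl s w -> Cs s * C w = (- (v + v^-1)) *: C w.
Proof.
have [m] := ubnP (len w); elim: m w => // m IH w; rewrite ltnS => lw hs hd.
have nd : ~~ dl s (s * w)%g by rewrite dl_mul // hd.
pose g := Cs s * C (s * w)%g.
have eg : Cs s * g = (- (v + v^-1)) *: g by rewrite /g mulrA CsCs // ZMl.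
have e : C w = g - \sum_(z | (len z < len w)%N) cc g z *: C z.
  rewrite {1}[g]ccE (bigID (fun z => (len z < len w)%N)) /= addrAC subrr add0r.
  rewrite (bigD1 w) ?ltnn //= CsC_top ?gens_mulK // eqxx scale1r big1 ?addr0 // => z /andP [].
  by rewrite -leqNgt => lz ne; rewrite CsC_top ?gens_mulK // (negPf ne) scale0r.
rewrite e mulrBr eg scalerBr; congr (_ - _); rewrite mulr_sumr scaler_sumr.
apply: eq_bigr => z lz; rewrite ZMr; case: (boolP (dl s z)) => hz.
  by rewrite IH ?(leq_trans lz) // !scalerA mulrC.
by rewrite CsC_supp0 // !scale0r scaler0.
Qed.

Lemma TsC_down s w : s \in gens -> dl s w -> T s * C w = (- v^-1) *: C w.
Proof. by move=> hs hd; apply: CsPV => //; apply: CsC_down. Qed.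

Lemma cc_Cs_supp s h z : s \in gens -> cc (Cs s * h) z != 0 -> dl s z.
Proof.
move=> hs; apply: contraR => nz; rewrite [h]ccE mulr_sumr cc_sum big1 // => w _.
rewrite ZMr ccZ; case: (boolP (dl s w)) => hw; last by rewrite CsC_supp0 // mulr0.
rewrite CsC_down // ccZ ccC; case: eqP nz => [->|_ _]; first by rewrite hw.
by rewrite !mulr0.
Qed.

Lemma vDVv_neq0 : v + v^-1 != 0 :> K.
Proof.
apply/eqP => /(congr1 (fun a : K => a * v)); rewrite mulrDl mulVf ?v_neq0 // mul0r => e.
have := reg0D (reg0M (@reg0_v R) (@reg0_v R)) (reg0_1 R); rewrite e mulr0 add0r => h.
by have /eqP := reg0_uniq h (reg0_0 R); rewrite oner_eq0.
Qed.

(** As $v+v^{-1}\ne0$, such an [h] is a scalar multiple of $C_sh$, to which [cc_Cs_supp] applies. *)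
Lemma cc_supp s h z : s \in gens -> T s * h = (- v^-1) *: h -> cc h z != 0 -> dl s z.
Proof.
move=> hs e nz; apply: (cc_Cs_supp (h := h) hs); rewrite (CsP hs e) ccZ.
apply: mulf_neq0 nz; rewrite oppr_eq0; exact: vDVv_neq0.
Qed.

Lemma flatC w : flat (C w) = C w^-1%g.
Proof.
apply: (isKL_uniq _ (C_isKL R w^-1%g)); split; first by rewrite br_flat brC.
move=> y; rewrite flatE; have [_ /(_ y^-1%g)] := C_isKL R w.
by rewrite !TE -eq_invg_sym.
Qed.

Lemma cc_flat h z : cc (flat h) z = cc h z^-1%g.
Proof.
apply: (@cc_uniq _ _ _ (fun z => cc h z^-1%g)).
have flat_sum (F : W -> H) : flat (\sum_y F y) = \sum_y flat (F y).
  by apply: (big_morph flat) => [a b|]; rewrite ?flatD // -(scale0r (0 : H)) flatZ !scale0r.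
rewrite {1}[h]ccE flat_sum (reindex_inj invg_inj) /=; apply: eq_bigr => y _.
by rewrite flatZ flatC invgK.
Qed.

Lemma flatTs s : s \in gens -> flat (T s) = T s.
Proof. by move=> hs; rewrite flatT (gens_inv hs). Qed.
Lemma flatCs s : s \in gens -> flat (Cs s) = Cs s.
Proof. by move=> hs; rewrite -C_gen // flatC (gens_inv hs). Qed.

Lemma CTs_down s w : s \in gens -> dr s w -> C w * T s = (- v^-1) *: C w.
Proof.
move=> hs; rewrite dr_dl // => hd; rewrite -[C w * _]flatK flatM flatTs // flatC TsC_down //.
by rewrite flatZ flatC invgK.
Qed.

Lemma cc_suppr s h z : s \in gens -> h * T s = (- v^-1) *: h -> cc h z != 0 -> dr s z.
Proof.
move=> hs e; rewrite dr_dl // -[h]flatK cc_flat; apply: cc_supp => //.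
by rewrite -[T s]flatTs // -flatM e flatZ.
Qed.

(* For z with t but not s in its descent set, the coefficient of T_z in C_t C_x is
   [p_{tz}+p_{sz}], because [p_z = -v p_{sz}]; so only [z = tx] or [z = sx] survives. *)
Lemma CsC_star s t x z : s \in gens -> t \in gens ->
  dl s x -> ~~ dl t x -> dl t z -> ~~ dl s z ->
  cc (Cs t * C x) z = ((t * z == x)%g + (s * z == x)%g)%:R.
Proof.
move=> hs ht sx tx tz sz.
have -> : (((t * z == x)%g + (s * z == x)%g)%:R : K) =
          (((t * z == x)%g + (s * z == x)%g)%N : int)%:~R by [].
apply: cc_eq_int; [exact: CsC_br|by move=> y; apply: CsC_Zv|].
have e : C x z = - v * C x (s * z)%g :> K.
  have := TsC_down hs sx => /(congr1 (fun h : H => h z : K)).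
  rewrite TsM // hZ (negPf sz) !mul0r addr0 => ->.
  by rewrite mulrA mulNr mulrN opprK mulfV ?v_neq0 // mul1r.
rewrite CsM // tz e mulrA mulrN mulVf ?v_neq0 // mulN1r opprK.
have h y : in_vZv (C x y - (y == x)%:R : K).
  by have [_ /(_ y)] := C_isKL R x; rewrite TE.
have := in_vZvD (h (t * z)%g) (h (s * z)%g).
by rewrite addrACA -opprD -natrD -pmulrn.
Qed.

Lemma CCs_star s t x z : s \in gens -> t \in gens ->
  dr s x -> ~~ dr t x -> dr t z -> ~~ dr s z ->
  cc (C x * Cs t) z = ((z * t == x)%g + (z * s == x)%g)%:R.
Proof.
move=> hs ht; rewrite !dr_dl // => sx tx tz sz.
rewrite -[C x * _]flatK cc_flat flatM flatCs // flatC (CsC_star hs ht sx tx tz sz).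
by rewrite -{1}(gens_inv ht) -{1}(gens_inv hs) -!invMg !(inj_eq invg_inj).
Qed.
End Cells.

(** * Left cell modules *)

Section Cells2.
Variables (R : realType) (n : nat).
Local Notation K := (K R).
Local Notation v := (vK R).
Local Notation W := (W n).
Local Notation H := (hecke R n).
Local Notation gens := (gens n).
Local Notation T := (@T R n : W -> H).
Local Notation br := (@br R n).
Local Notation flat := (@flat R n).
Local Notation Cs := (@Cs R n).
Local Notation C := (@KC R n).
Local Notation cc := (@cc R n).
Local Notation jm := (@jm R n).
Local Notation sgn := (@sgnK R n).
Implicit Types (s t w x y z : W) (h k : H).

Lemma sgn_sqr w : sgn w * sgn w = 1.
Proof. by rewrite /sgnK -exprMn mulrNN mulr1 expr1n. Qed.
Lemma sgn1 : sgn 1%g = 1.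
Proof. by rewrite /sgnK len1. Qed.
Lemma sgn_gens s w : s \in gens -> sgn (s * w)%g = - sgn w.
Proof.
move=> hs; rewrite /sgnK; case: (boolP (dl s w)) => hd.
  by rewrite (len_gens hs hd) exprS mulN1r opprK.
by rewrite (len_gensN hs hd) exprS mulN1r.
Qed.
Lemma barK_sgn w : barK (sgn w) = sgn w.
Proof. by rewrite /sgnK rmorphXn /= rmorphN1. Qed.

Lemma jmE h x : jm h x = barK (h x) * sgn x. Proof. by rewrite jm.unlock ffunE. Qed.
Lemma jmK h : jm (jm h) = h.
Proof. by apply/ffunP => x; rewrite !jmE rmorphM /= barKK barK_sgn -mulrA sgn_sqr mulr1. Qed.
Lemma jmD h k : jm (h + k) = jm h + jm k.
Proof. by apply/ffunP => x; rewrite !(hD, jmE) rmorphD mulrDl. Qed.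
Lemma jmZ (a : K) h : jm (a *: h) = barK a *: jm h.
Proof. by apply/ffunP => x; rewrite !(hZ, jmE) rmorphM mulrA. Qed.
Lemma jm0 : jm 0 = 0.
Proof. by apply/ffunP => x; rewrite jmE !h0 rmorph0 mul0r. Qed.
Lemma jm_sum (I : Type) (r : seq I) (P : pred I) (F : I -> H) :
  jm (\sum_(i <- r | P i) F i) = \sum_(i <- r | P i) jm (F i).
Proof. exact: (big_morph jm jmD jm0). Qed.
Lemma jmT w : jm (T w) = sgn w *: T w.
Proof.
apply/ffunP => x; rewrite hZ jmE !TE; case: eqP => [->|_]; first by rewrite rmorph1 mulrC.
by rewrite rmorph0 mul0r mulr0.
Qed.
Lemma jm1 : jm 1 = 1.
Proof. by rewrite -T1E jmT sgn1 scale1r. Qed.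
Lemma jmTs s h : s \in gens -> jm (T s * h) = - (T s * jm h).
Proof.
move=> hs; apply/ffunP => x; rewrite hN jmE !TsM // !jmE sgn_gens // rmorphD !rmorphM rmorph_nat.
rewrite rmorphB fmorphV /= barK_v invrK; move: (sgn x) (barK _) (barK _) => a b c.
by case: (dl s x) => /=; ring.
Qed.
Lemma jmM h k : jm (h * k) = jm h * jm k.
Proof.
elim/gens_ind: h k => [k|h h' IH IH' k|a h IH k|s h hs IH k].
- by rewrite jm1 !mul1r.
- by rewrite mulrDl !jmD IH IH' mulrDl.
- by rewrite ZMl !jmZ IH ZMl.
by rewrite -mulrA !jmTs // IH mulrA mulNr.
Qed.
Lemma jm_br h : jm (br h) = br (jm h).
Proof.
elim/gens_ind: h => [|h k IH IH'|a h IH|s h hs IH].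
- by rewrite br1 jm1 br1.
- by rewrite !(jmD, brD) IH IH'.
- by rewrite !(jmZ, brZ) IH.
have sgs : sgn s = -1 by rewrite -[s in sgn s](mulg1 s) sgn_gens // sgn1.
have jI : jm (TsI R s) = - TsI R s.
  rewrite TsIE -scaleNr jmD jmZ jm1 jmT sgs rmorphN rmorphB fmorphV /= barK_v invrK opprB.
  by rewrite opprD scaleNr opprK scaleN1r.
by rewrite brTsM // jmM jmTs // brN brTsM // IH jI mulNr.
Qed.

Lemma viZvi_vZv (a : K) : in_viZvi a <-> in_vZv (barK a).
Proof.
split=> -[p [p0 e]]; exists p; split=> //; first by rewrite e barK_evalZ fmorphV /= barK_v invrK.
by rewrite -[a]barKK e barK_evalZ barK_v.
Qed.

Lemma in_vZv_sgn w (a : K) : in_vZv a -> in_vZv (sgn w * a).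
Proof.
move=> h; rewrite /sgnK -signr_odd; case: odd; rewrite ?expr0 ?mul1r // expr1 mulN1r.
exact: in_vZvN.
Qed.

Lemma isKL_jm w h : br h = h -> (forall y, in_viZvi (h y - T w y : K)) -> isKL w (sgn w *: jm h).
Proof.
move=> bh l; split; first by rewrite brZ -jm_br bh barK_sgn.
move=> y; have := in_vZv_sgn w (in_vZv_sgn y (proj1 (viZvi_vZv _) (l y))).
rewrite rmorphB hZ jmE /= mulrBr mulrBr [sgn y * _]mulrC [sgn y * barK (T w y)]mulrC.
rewrite TE; case: eqP => [->|_]; first by rewrite rmorph1 mul1r sgn_sqr.
by rewrite rmorph0 mul0r mulr0.
Qed.

Lemma KLC'E w : KLC' R w = sgn w *: jm (C w) :> H.
Proof.
rewrite /KLC'; set P := fun _ => _.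
have : exists h, P h.
  exists (sgn w *: jm (C w)); split.
    rewrite -[bar _]/(@bar R n (sgn w *: jm (C w) : H)).
    by have : br (sgn w *: jm (C w)) = sgn w *: jm (C w); [rewrite brZ -jm_br brC barK_sgn|rewrite br.unlock].
  move=> y; apply/viZvi_vZv; rewrite rmorphB /= hZ jmE !rmorphM /= !barK_sgn barKK.
  have -> : barK (T w y : K) = sgn w * (T w y * sgn y).
    by rewrite TE; case: eqP => [->|_]; rewrite ?rmorph1 ?mul1r ?sgn_sqr // rmorph0 mul0r mulr0.
  rewrite -mulrBr -mulrBl mulrC [_ * sgn y]mulrC -mulrA; apply: in_vZv_sgn; rewrite mulrC; apply: in_vZv_sgn.
  by have [_] := C_isKL R w.
move=> /(epsilon_spec (inhabits (Defs.T R 1%g))); set h := epsilon _ _; case=> b l.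
have := isKL_jm (h := h) (w := w) _ l; rewrite br.unlock => /(_ b) kl.
by rewrite (isKL_uniq (C_isKL R w) kl) jmZ jmK barK_sgn scalerA sgn_sqr scale1r.
Qed.

(** Row [z], column [y] of left multiplication by [h] in the $C$-basis. On a cell it is conjugate,
    by the diagonal matrix of the $\varepsilon_x$, to the matrix in the basis $b_x$. *)
Definition Nm h z y : K := cc (h * C y) z.

Lemma NmE h z y : Nm h z y = cc (h * C y) z. Proof. by []. Qed.
Lemma NmD h k z y : Nm (h + k) z y = Nm h z y + Nm k z y.
Proof. by rewrite /Nm mulrDl ccD. Qed.
Lemma NmZ (a : K) h z y : Nm (a *: h) z y = a * Nm h z y.
Proof. by rewrite /Nm ZMl ccZ. Qed.
Lemma Nm_sum (I : Type) (r : seq I) (P : pred I) (F : I -> H) z y :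
  Nm (\sum_(i <- r | P i) F i) z y = \sum_(i <- r | P i) Nm (F i) z y.
Proof. by rewrite /Nm mulr_suml cc_sum. Qed.
Lemma Nm1 z y : Nm 1 z y = (z == y)%:R.
Proof. by rewrite /Nm mul1r ccC. Qed.
Lemma NmM h k z y : Nm (h * k) z y = \sum_u Nm h z u * Nm k u y.
Proof.
rewrite /Nm -mulrA {1}[k * C y]ccE mulr_sumr cc_sum; apply: eq_bigr => u _.
by rewrite ZMr ccZ mulrC.
Qed.

(** The product formula is transported by [jm], with $C'_w=\varepsilon_w\,$[jm]$(C_w)$. Being
    semilinear, [jm] puts a bar on the coordinates, and this disappears because $C_xC_y$ is
    bar-invariant. *)
Lemma hcoefE x y z : hcoef R x y z = sgn x * sgn y * sgn z * cc (C x * C y) z.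
Proof.
have hl (a : HK R n) : hlin a (@KLC' R n) = jm (\sum_u (barK (a u) * sgn u) *: C u).
  apply/ffunP => u; rewrite jm_sum hsum ffunE; apply: eq_bigr => w _.
  by rewrite KLC'E jmZ !hZ rmorphM /= barKK barK_sgn mulrA.
have hp : hmul (KLC' R x) (KLC' R y) = jm ((sgn x * sgn y) *: (C x * C y)).
  by rewrite hmulE !KLC'E ZMl ZMr -jmM scalerA jmZ rmorphM /= !barK_sgn.
have uniq (a : HK R n) : hmul (KLC' R x) (KLC' R y) = hlin a (@KLC' R n) ->
    forall u, a u = sgn x * sgn y * sgn u * cc (C x * C y) u.
  rewrite hl hp => /(congr1 jm); rewrite !jmK => e u.
  have := cc_uniq e u; rewrite ccZ => /(congr1 (fun b : K => barK b * sgn u)).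
  rewrite !rmorphM /= !barK_sgn barKK -(mulrA (a u : K)) sgn_sqr mulr1 => <-.
  rewrite cc_br; first by rewrite mulrAC.
  by rewrite brM !brC.
rewrite /hcoef.
have : exists a : HK R n, hmul (KLC' R x) (KLC' R y) = hlin a (@KLC' R n).
  exists [ffun u => sgn x * sgn y * sgn u * cc (C x * C y) u].
  rewrite hl hp; congr jm; apply: esym; rewrite [in RHS](ccE (C x * C y)) scaler_sumr.
  apply: eq_bigr => u _; rewrite ffunE !rmorphM /= !barK_sgn cc_br ?brM ?brC // scalerA.
  by congr (_ *: _); rewrite mulrAC -[_ * sgn u * sgn u]mulrA sgn_sqr mulr1.
by move=> /(epsilon_spec (inhabits (Defs.T R 1%g))) /uniq.
Qed.

Lemma sgn_neq0 w : sgn w != 0.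
Proof. by rewrite /sgnK signr_eq0. Qed.

Lemma edgeLP x y : reflect (exists2 s, s \in gens & Nm (Cs s) x y != 0) (@edgeL R n x y).
Proof.
have e s : (s \in gens) -> (hcoef R s y x != 0) = (Nm (Cs s) x y != 0).
  have nz := mulf_neq0 (mulf_neq0 (sgn_neq0 s) (sgn_neq0 y)) (sgn_neq0 x).
  by move=> hs; rewrite hcoefE /Nm (C_gen R hs) mulf_eq0 (negPf nz).
apply: (iffP existsP) => [[s /andP [hs h]]|[s hs h]]; first by exists s; rewrite -?e.
by exists s; rewrite hs e.
Qed.

Lemma chiCellE (Cl : {set W}) h : chiCell Cl h = \sum_(x in Cl) Nm h x x.
Proof.
rewrite /chiCell; transitivity (\sum_y cc h y * \sum_(x in Cl) Nm (C y) x x).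
  apply: eq_bigr => y _; rewrite cc.unlock; congr (_ * _); rewrite mulr_sumr.
  apply: eq_bigr => x _; rewrite hcoefE /Nm -!mulrA mulrCA !mulrA.
  by rewrite -[_ * sgn x * sgn x]mulrA sgn_sqr mulr1 sgn_sqr mul1r.
under eq_bigr => y _ do rewrite mulr_sumr.
rewrite exchange_big /=; apply: eq_bigr => x _.
by rewrite [in RHS](ccE h) Nm_sum; apply: eq_bigr => y _; rewrite NmZ.
Qed.

Lemma Nm_leL h z y : Nm h z y != 0 -> @leL R n z y.
Proof.
move=> nz; apply: contraT => nle; case/negP: nz; apply/eqP.
elim/gens_ind: h z y nle => [|h k IH IH'|a h IH|s h hs IH] z y nle.
- by rewrite Nm1; case: eqP nle => // ->; rewrite /leL connect0.
- by rewrite NmD IH ?IH' ?addr0.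
- by rewrite NmZ IH ?mulr0.
rewrite NmM big1 // => u _.
have [h1|h1] := boolP (@leL R n u y); last by rewrite (IH _ _ h1) mulr0.
have nzu : ~~ @leL R n z u by apply: contra nle => h2; apply: connect_trans h1.
suff -> : Nm (T s) z u = 0 by rewrite mul0r.
have -> : T s = Cs s + v *: (1 : H) by rewrite CsE subrK.
rewrite NmD NmZ Nm1 (_ : (z == u) = false) ?mulr0 ?addr0; last first.
  by apply/negP => /eqP e; case/negP: nzu; rewrite e /leL connect0.
apply/eqP; apply: contraT => nz; case/negP: nzu; apply: connect1; apply/edgeLP.
by exists s.
Qed.

(** Left multiplication preserves the eigenspace of right multiplication by $T_s$ for $-v^{-1}$.
    Consequently right descents can only grow going down in $\le_{\mathcal L}$ and are constant on a
    left cell. *)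
Lemma Nm_dr h z y s : s \in gens -> Nm h z y != 0 -> dr s y -> dr s z.
Proof.
move=> hs nz hd; apply: (@cc_suppr _ _ s (h * C y)) => //.
by rewrite -mulrA CTs_down // ZMr.
Qed.

Lemma leL_dr z y s : s \in gens -> @leL R n z y -> dr s y -> dr s z.
Proof.
move=> hs /connectP [p hp ->] {y}; elim: p z hp => //= u p IH z /andP [/edgeLP [t ht nz] hp] /IH.
by move=> /(_ hp); apply: Nm_dr nz.
Qed.

Lemma simL_dr z y s : s \in gens -> @simL R n z y -> dr s y = dr s z.
Proof.
by move=> hs /andP [h1 h2]; apply/idP/idP; [exact: leL_dr h1|exact: leL_dr h2].
Qed.

End Cells2.

(** * Star operations *)

Section StarPerm.
Variable n : nat.
Local Notation W := (W n).
Implicit Types (s t w x y z : W).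
Local Open Scope group_scope.

Definition adjg s t := exists i j k : 'I_n, [/\ val j = (val i).+1, val k = (val j).+1 &
  (s = tperm i j /\ t = tperm j k) \/ (s = tperm j k /\ t = tperm i j)].

Lemma adjg_sym s t : adjg s t -> adjg t s.
Proof.
by case=> i [j [k [h1 h2 h3]]]; exists i, j, k; split=> //; case: h3 => -[-> ->]; [right|left].
Qed.
Lemma adjg_gens s t : adjg s t -> s \in gens n /\ t \in gens n.
Proof.
case=> i [j [k [h1 h2]]] [] [-> ->]; split; apply/gensP; by [exists i, j|exists j, k].
Qed.

(* The right star operation for the pair s, t: the string {x, xs, xt} contains exactly one element whose right
   descents contain t and not s. *)
Definition Qd s t x := dr s x && ~~ dr t x.
Definition star s t x := if Qd t s (x * t) then x * t else x * s.

Lemma drE (i j : 'I_n) w : val j = (val i).+1 -> dr (tperm i j) w = (w^-1 j < w^-1 i)%N.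
Proof. by move=> h; rewrite dr_dl ?dlE //; apply/gensP; exists i, j. Qed.

(** Everything depends on the relative order of the positions of three consecutive values, which
    leaves finitely many cases. *)
Lemma Qd_star s t x : adjg s t -> Qd s t x ->
  (Qd t s (x * t) && ~~ Qd t s (x * s)) || (Qd t s (x * s) && ~~ Qd t s (x * t)).
Proof.
case=> i [j [k [/= hj hk h]]].
have ne (a b : 'I_n) : val a <> val b -> (x^-1 a == x^-1 b :> nat) = false.
  by move=> ab; apply/eqP => /val_inj /perm_inj e; case: ab; rewrite e.
have tik : tperm j k i = i by rewrite tpermD //; apply/eqP => /(congr1 val) /=; lia.
have tki : tperm i j k = k by rewrite tpermD //; apply/eqP => /(congr1 val) /=; lia.
have nij : (x^-1 i == x^-1 j :> nat) = false by apply: ne => /=; lia.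
have nik : (x^-1 i == x^-1 k :> nat) = false by apply: ne => /=; lia.
have njk : (x^-1 j == x^-1 k :> nat) = false by apply: ne => /=; lia.
case: h => -[-> ->]; rewrite /Qd !drE // !invMg !tpermV !permM !tpermL !tpermR ?tik ?tki;
  move: nij nik njk; move: (x^-1 i : nat) (x^-1 j : nat) (x^-1 k : nat) => a b c; lia.
Qed.

Lemma starQ s t x : adjg s t -> Qd s t x -> Qd t s (star s t x).
Proof.
move=> st hx; rewrite /star; case: ifP => // nq.
by case/orP: (Qd_star st hx) => /andP [] //; rewrite nq.
Qed.

(** The left side is the coefficient of $C_z$ in $C_xC_t$ given by [CCs_star]. *)
Lemma star_uniq s t x z : adjg s t -> Qd s t x -> Qd t s z ->
  ((z * t == x)%g + (z * s == x)%g)%N = (z == star s t x).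
Proof.
move=> st hx hz; have [hs ht] := adjg_gens st.
rewrite -!(eq_mulgr z x) // /star; have := Qd_star st hx.
case: (eqVneq z (x * t)) => [zt|nzt]; case: (eqVneq z (x * s)) => [zs|nzs].
- by rewrite -zt -zs hz.
- by rewrite -zt hz eqxx.
- by rewrite -zs hz andbF /= => /negbTE ->; rewrite eqxx.
- by case: ifP => _ _; rewrite ?(negPf nzt) ?(negPf nzs).
Qed.

Lemma starK s t x : adjg s t -> Qd s t x -> star t s (star s t x) = x.
Proof.
move=> st hx; have [hs ht] := adjg_gens st; have hy := starQ st hx.
have := star_uniq st hx hy; rewrite eqxx => h1.
have := star_uniq (adjg_sym st) hy hx; rewrite (eq_sym (x * s)) (eq_sym (x * t)).
by rewrite (eq_mulgr _ x hs) (eq_mulgr _ x ht) addnC h1; case: eqP.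
Qed.

End StarPerm.

(** * Star operations on the $C$-basis and on left cells *)

Section StarCells.
Variables (R : realType) (n : nat).
Local Notation K := (K R).
Local Notation v := (vK R).
Local Notation W := (W n).
Local Notation H := (hecke R n).
Local Notation gens := (gens n).
Local Notation T := (@T R n : W -> H).
Local Notation Cs := (@Cs R n).
Local Notation C := (@KC R n).
Local Notation cc := (@cc R n).
Local Notation Nm := (@Nm R n).
Local Notation simL := (@simL R n).
Local Notation leL := (@leL R n).
Implicit Types (s t w x y z : W) (h k : H).

Lemma natK_eq0 (m : nat) : (m%:R == 0 :> K) = (m == 0)%N.
Proof.
apply/eqP/eqP => [e|-> //]; have := reg0_nat R m; rewrite e => h.
by have /esym/eqP := reg0_uniq (reg0_0 R) h; rewrite pnatr_eq0 => /eqP.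
Qed.

Lemma cc_CCs_dr t x z : t \in gens -> cc (C x * Cs t) z != 0 -> dr t z.
Proof.
move=> ht; rewrite -[C x * _]flatK cc_flat flatM flatCs // dr_dl //.
exact: cc_Cs_supp.
Qed.

Lemma CCs_down t x : t \in gens -> dr t x -> C x * Cs t = (- (v + v^-1)) *: C x.
Proof.
move=> ht; rewrite dr_dl // => hx; rewrite -[C x * _]flatK flatM flatCs // flatC CsC_down //.
by rewrite flatZ flatC invgK.
Qed.

(* Right multiplication by C_t is left H-linear; modulo the C_z with s and t in R(z)
   it sends C_x to C_{x*}. *)
Lemma Nm_star s t x y h : adjg s t -> Qd s t x -> Qd s t y ->
  Nm h (star s t y) (star s t x) = Nm h y x.
Proof.
move=> st hx hy; have [hs ht] := adjg_gens st.
have hx' := starQ st hx; have hy' := starQ st hy.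
(* The coefficient of the basis element of [star s t y] in $hC_xC_t$ is computed twice, expanding
   $C_xC_t$ here and $hC_x$ below. Here a stray [z] with right descent [s] contributes nothing,
   since [s] would persist by [Nm_dr] but is no right descent of [star s t y]. *)
have e1 : cc (h * C x * Cs t) (star s t y) = Nm h (star s t y) (star s t x).
  rewrite -mulrA {1}[C x * _]ccE mulr_sumr cc_sum (bigD1 (star s t x)) //= ZMr ccZ.
  have /andP [sx tx] := hx; have /andP [tx' sx'] := hx'.
  rewrite (CCs_star _ hs ht sx tx tx' sx') (star_uniq st hx hx') eqxx mul1r.
  rewrite big1 ?addr0 // => z ne; rewrite ZMr ccZ.
  have [->|nz] := eqVneq (cc (C x * Cs t) z) 0; first by rewrite mul0r.
  have tz := cc_CCs_dr ht nz; have [sz|sz] := boolP (dr s z).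
    have [->|nz'] := eqVneq (cc (h * C z) (star s t y)) 0; first by rewrite mulr0.
    by have := Nm_dr hs nz' sz; case/andP: hy' => _ /negbTE ->.
  rewrite (CCs_star _ hs ht sx tx tz sz) (star_uniq st hx) ?(negPf ne) ?mul0r //.
  by rewrite /Qd tz.
rewrite -e1 {1}[h * C x]ccE mulr_suml cc_sum (bigD1 y) //= ZMl ccZ.
have /andP [sy ty] := hy; have /andP [ty' sy'] := hy'.
rewrite (CCs_star _ hs ht sy ty ty' sy') (star_uniq st hy hy') eqxx mulr1.
rewrite big1 ?addr0 // => z ne; rewrite ZMl ccZ.
have [->|nz] := eqVneq (cc (h * C x) z) 0; first by rewrite mul0r.
have sz : dr s z by apply: (Nm_dr hs nz); case/andP: hx.
have [tz|tz] := boolP (dr t z).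
  rewrite CCs_down // ccZ ccC (_ : (star s t y == z) = false) ?mulr0 //.
  by apply/negP => /eqP e; rewrite -e (negPf sy') in sz.
rewrite (CCs_star _ hs ht sz tz ty' sy') (star_uniq st) ?/Qd ?sz ?ty' //.
rewrite (_ : (star s t y == star s t z) = false) ?mulr0 //.
apply/negP => /eqP e; case/eqP: ne; rewrite -(starK st hy) e starK //.
by rewrite /Qd sz.
Qed.

Definition cell x : {set W} := [set w | simL w x].

Lemma leL_refl x : leL x x. Proof. exact: connect0. Qed.
Lemma leL_trans x y z : leL x y -> leL y z -> leL x z.
Proof. exact: connect_trans. Qed.
Lemma simL_refl x : simL x x. Proof. by rewrite /Defs.simL leL_refl. Qed.
Lemma simL_sym x y : simL x y = simL y x. Proof. by rewrite /Defs.simL andbC. Qed.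
Lemma simL_trans y x z : simL x y -> simL y z -> simL x z.
Proof.
by move=> /andP [a b] /andP [c d]; rewrite /Defs.simL (leL_trans a c) (leL_trans d b).
Qed.
Lemma cell_eq x y : simL x y -> cell x = cell y.
Proof.
move=> h; apply/setP=> z; rewrite !inE; apply/idP/idP => h'; first exact: simL_trans h.
by apply: simL_trans h' _; rewrite simL_sym.
Qed.
Lemma mem_cell x : x \in cell x. Proof. by rewrite inE simL_refl. Qed.
Lemma leftCellP (Cl : {set W}) : reflect (exists x, Cl = cell x) (@leftCell R n Cl).
Proof. by apply: (iffP existsP) => [[x /eqP ->]|[x ->]]; exists x. Qed.

Lemma simL_Qd s t x y : adjg s t -> simL x y -> Qd s t y = Qd s t x.
Proof. by move=> st h; have [hs ht] := adjg_gens st; rewrite /Qd !(simL_dr _ h). Qed.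

(** A path that closes up stays inside the cell, so [Qd s t] holds along it and [Nm_star] carries
    over each edge. *)
Lemma leL_star s t x y : adjg s t -> Qd s t x -> leL x y -> leL y x ->
  leL (star s t x) (star s t y).
Proof.
move=> st hx /connectP [p hp ->] {y}; elim: p x hx hp => [|u p IH] x hx /=; first by move=> *; exact: leL_refl.
move=> /andP [e hp] le.
have lu : leL u x by apply: leL_trans le; apply/connectP; exists p.
have xu : leL x u by apply: connect1.
have hu : Qd s t u by rewrite (simL_Qd st (x := x)) // /Defs.simL lu xu.
apply: (@leL_trans _ (star s t u)); last first.
  by apply: IH => //; apply: leL_trans xu.
apply: connect1; apply/edgeLP; case/edgeLP: e => r hr nz; exists r; first exact: hr.
by rewrite (Nm_star _ st hu hx); exact: nz.
Qed.

Lemma simL_star s t x y : adjg s t -> Qd s t x -> simL x y -> simL (star s t x) (star s t y).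
Proof.
move=> st hx sxy; have hy : Qd s t y by rewrite (simL_Qd st sxy).
by case/andP: (sxy) => h1 h2; rewrite /Defs.simL !leL_star.
Qed.

Definition cell_iso (f : W -> W) x y :=
  [/\ f x = y, {in cell x &, injective f}, f @: cell x = cell y &
      forall h, {in cell x &, forall a b, Nm h (f a) (f b) = Nm h a b}].

Lemma cell_iso_id x : cell_iso id x x.
Proof. by split=> //; rewrite imset_id. Qed.

Lemma cell_iso_comp f g x y z : cell_iso f x y -> cell_iso g y z -> cell_iso (g \o f) x z.
Proof.
move=> [f1 f2 f3 f4] [g1 g2 g3 g4].
have fc a : a \in cell x -> f a \in cell y by move=> ha; rewrite -f3 imset_f.
split; first by rewrite /= f1.
- move=> a b ha hb /= e; apply: f2 => //; apply: g2 => //; exact: fc.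
- by rewrite imset_comp f3.
by move=> h a b ha hb /=; rewrite g4 ?f4 ?fc.
Qed.

Lemma cell_iso_star s t x : adjg s t -> Qd s t x -> cell_iso (star s t) x (star s t x).
Proof.
move=> st hx; have hc a : a \in cell x -> Qd s t a by rewrite inE => h; rewrite -(simL_Qd st h).
split=> //.
- by move=> a b /hc ha /hc hb e; rewrite -(starK st ha) e starK.
- apply/setP => y; apply/imsetP/idP => [[a ha ->]|].
    have ha' : simL a x by move: ha; rewrite inE.
    by rewrite inE; exact: (simL_star st (hc a ha) ha').
  move=> hy; have st' := adjg_sym st; have hx' := starQ st hx.
  rewrite inE in hy; have hyQ : Qd t s y by rewrite -(simL_Qd st' hy).
  exists (star t s y); last by rewrite (starK st' hyQ).
  by rewrite inE -(starK st hx); apply: simL_star.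
by move=> h a b /hc ha /hc hb; apply: Nm_star.
Qed.

Definition rstep x y := exists s t, [/\ adjg s t, Qd s t x & y = star s t x].
Definition lstep x y := rstep x^-1%g y^-1%g.

(** By [CsC_star], $C_y$ has coefficient 1 in $C_tC_x$ and $C_x$ has coefficient 1 in $C_sC_y$. *)
Lemma lstep_simL x y : lstep x y -> simL x y.
Proof.
case=> s [t [st hx e]]; have [hs ht] := adjg_gens st.
have hy := starQ st hx; rewrite -e in hy.
move: (hx) (hy); rewrite /Qd -!dl_dr // => /andP [sx tx] /andP [ty sy].
have aux : ((t * y == x)%g + (s * y == x)%g)%N = 1%N.
  have E r : r \in gens -> (y^-1 * r == x^-1)%g = (r * y == x)%g.
    by move=> hr; rewrite -(inj_eq invg_inj) invMg !invgK (gens_inv hr).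
  by have := star_uniq st hx (z := y^-1%g) hy; rewrite -e eqxx !E.
have h1 : leL y x.
  by apply: connect1; apply/edgeLP; exists t; [exact: ht|rewrite NmE (CsC_star _ hs ht sx tx ty sy) aux natK_eq0].
have h2 : leL x y.
  apply: connect1; apply/edgeLP; exists s; [exact: hs|rewrite NmE (CsC_star _ ht hs ty sy sx tx) natK_eq0].
  by rewrite -!eq_mulgl // ![x == _]eq_sym addnC aux.
by rewrite /Defs.simL h1 h2.
Qed.

End StarCells.

(** * Column insertion and Knuth moves *)

Section Insertion.
Local Open Scope nat_scope.
Implicit Types (x y z : nat) (p q t u c d : seq nat) (S : seq (seq nat)).

Inductive knuth : seq nat -> seq nat -> Prop :=
| KnuthRefl u : knuth u u
| KnuthYXZ p q x y z : x < y < z -> knuth (p ++ [:: y, x, z & q]) (p ++ [:: y, z, x & q])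
| KnuthXZY p q x y z : x < y < z -> knuth (p ++ [:: x, z, y & q]) (p ++ [:: z, x, y & q])
| KnuthSym u t : knuth u t -> knuth t u
| KnuthTrans t u q : knuth u t -> knuth t q -> knuth u q.

Lemma knuth_cat p u t q : knuth u t -> knuth (p ++ u ++ q) (p ++ t ++ q).
Proof.
elim=> {u t} [u|p' q' x y z h|p' q' x y z h|u t _ IH|t u q' _ IH1 _ IH2].
- exact: KnuthRefl.
- by rewrite -!catA !catA -(catA (p ++ p')) -[X in knuth _ X]catA /=; apply: KnuthYXZ.
- by rewrite -!catA !catA -(catA (p ++ p')) -[X in knuth _ X]catA /=; apply: KnuthXZY.
- exact: KnuthSym.
- exact: KnuthTrans IH1 IH2.
Qed.

Lemma knuth_cons x u t : knuth u t -> knuth (x :: u) (x :: t).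
Proof. by move=> h; have := knuth_cat [:: x] [::] h; rewrite !cats0. Qed.
Lemma knuth_catr q u t : knuth u t -> knuth (u ++ q) (t ++ q).
Proof. exact: (@knuth_cat [::]). Qed.
Lemma knuth_catl p u t : knuth u t -> knuth (p ++ u) (p ++ t).
Proof. by move=> h; have := knuth_cat p [::] h; rewrite !cats0. Qed.

(** [x] passes the letters [a] of the decreasing run one at a time by $x\,a\,b\to a\,x\,b$, where
    $b$ is the letter after $a$ and $x<b<a$. *)
Lemma knuth_shift_right x y u t : x < y -> sorted gtn (rcons u y) ->
  knuth (x :: u ++ y :: t) (u ++ x :: y :: t).
Proof.
move=> xy; elim: u => [|a u IH] su /=; first exact: KnuthRefl.
have {}IH := IH (path_sorted su).
apply: KnuthTrans (knuth_cons a IH).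
have all_gt : all (ltn x) (rcons u y).
  have : sorted gtn (rcons u y) := path_sorted su.
  rewrite -rev_sorted rev_rcons /= => h; rewrite -all_rev rev_rcons /= xy /=.
  apply/allP => b hb; apply: ltn_trans xy _.
  by move: h; rewrite (path_sortedE (fun _ _ _ a b => ltn_trans a b)) => /andP [/allP /(_ b hb)].
case: u su all_gt {IH} => [|b u] /=.
  by rewrite !andbT => ya _; apply: (@KnuthXZY [::]); rewrite xy.
case/andP=> ab _ /andP [xb _]; apply: (@KnuthXZY [::]); by rewrite xb.
Qed.

(** [y] passes the letters [b] of the decreasing run by $a\,y\,b\to a\,b\,y$, where $a$ is the
    letter before $y$ and $b<a<y$. *)
Lemma knuth_shift_left x y t q : path gtn x t -> x < y -> knuth (x :: y :: t ++ q) (x :: t ++ y :: q).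
Proof.
elim: t x => [|b t IH] x /=; first by move=> _ _; exact: KnuthRefl.
case/andP=> bx hp xy; apply: KnuthTrans (knuth_cons x (IH b hp (ltn_trans bx xy))).
by apply: KnuthSym; apply: (@KnuthYXZ [::]); rewrite bx.
Qed.

(* Column insertion; a tableau is the list of its columns, each increasing from top to bottom, and its word
   reads every column from bottom to top. *)
Fixpoint cins x c := if c is y :: c' then
    if x < y then (x :: c', Some y) else let r := cins x c' in (y :: r.1, r.2)
  else ([:: x], None).

Lemma cinsP x c : sorted ltn c -> x \notin c ->
  (cins x c = (rcons c x, None) /\ all (gtn x) c) \/
  (exists p y q, [/\ c = p ++ y :: q, all (gtn x) p, x < y & cins x c = (p ++ x :: q, Some y)]).
Proof.
elim: c => [|a c IH] //=; first by left.
rewrite inE negb_or => sc /andP [xa xc]; case: ifP => h; first by right; exists [::], a, c.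
have ax : a < x by lia.
case: (IH (path_sorted sc) xc) => [[-> h1]|[p [y [q [-> h1 h2 ->]]]]]; first by left; rewrite /= ax.
by right; exists (a :: p), y, q; rewrite /= ax.
Qed.

Fixpoint tins x S := if S is c :: S' then
    let r := cins x c in r.1 :: (if r.2 is Some y then tins y S' else S')
  else [:: [:: x]].

Definition word S := flatten (map rev S).

Definition leqcol c d := (size d <= size c) && all (fun r => nth 0 c r < nth 0 d r) (iota 0 (size d)).

Lemma leqcolP c d : reflect (size d <= size c /\ forall r, r < size d -> nth 0 c r < nth 0 d r) (leqcol c d).
Proof.
apply: (iffP andP) => -[h1 h2]; split=> //.
  by move=> r hr; apply: (allP h2); rewrite mem_iota.
by apply/allP => r; rewrite mem_iota; apply: h2.
Qed.

Lemma cins_sorted x c : sorted ltn c -> x \notin c -> sorted ltn (cins x c).1.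
Proof.
move=> sc xc; case: (cinsP sc xc) => [[-> h]|[p [y [q [ec h1 h2 ->]]]]] /=.
  move: sc; rewrite !(sorted_pairwise ltn_trans) -cats1 pairwise_cat /= => ->.
  by rewrite allrel1r !andbT; apply: sub_all h.
move: sc; rewrite ec !(sorted_pairwise ltn_trans) !pairwise_cat /= !allrel_consr.
case/and3P=> /andP [_ ->] -> /andP [hy ->]; rewrite !andbT /=; apply/andP; split.
  by apply: sub_all h1.
by apply: sub_all hy => b; apply: ltn_trans.
Qed.

(** For a column $p\,y\,q$ from which $x$ bumps $y$, let bars denote reversal: in $x\,\bar
    q\,y\,\bar p$ first $x$ moves right up to $y$, then $y$ moves right past $\bar p$, which gives
    $\bar q\,x\,\bar p\,y$. *)
Lemma knuth_cins x c : sorted ltn c -> x \notin c ->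
  knuth (x :: rev c) (rev (cins x c).1 ++ (if (cins x c).2 is Some y then [:: y] else [::])).
Proof.
move=> sc xc; case: (cinsP sc xc) => [[-> h]|[p [y [q [ec h1 h2 ->]]]]] /=.
  by rewrite rev_rcons cats0; exact: KnuthRefl.
move: sc; rewrite ec (sorted_pairwise ltn_trans) pairwise_cat allrel_consr /=.
case/and3P=> /andP [py pq] pp /andP [yq qq].
rewrite !rev_cat !rev_cons !cat_rcons.
apply: KnuthTrans (knuth_shift_right (rev p) h2 _) _.
  rewrite -rev_cons rev_sorted /= (path_sortedE ltn_trans) yq (sorted_pairwise ltn_trans).
  exact: qq.
rewrite -catA; apply: knuth_catl; rewrite -[rev p in X in knuth X]cats0; apply: knuth_shift_left => //.
rewrite (path_sortedE (fun _ _ _ a b => ltn_trans b a)) all_rev rev_sorted (sorted_pairwise ltn_trans) pp.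
by rewrite andbT; apply: sub_all h1.
Qed.

Lemma cins_perm x c : perm_eq ((cins x c).1 ++ (if (cins x c).2 is Some y then [:: y] else [::])) (x :: c).
Proof.
elim: c => [|a c IH] //=; case: ifP => h /=.
  by rewrite perm_cons perm_catC.
apply: (@perm_trans _ (a :: x :: c)); first by rewrite perm_cons.
exact: (permEl (perm_catCA [:: a] [:: x] c)).
Qed.

Lemma tins_perm x S : perm_eq (flatten (tins x S)) (x :: flatten S).
Proof.
elim: S x => [|c S IH] x //=; have := cins_perm x c.
case: (cins x c) => c' [y|] /= h.
  apply: (@perm_trans _ (c' ++ y :: flatten S)); first by rewrite perm_cat2l.
  by rewrite -cat_rcons -cats1 -cat_cons perm_cat2r.
by rewrite -cat_cons perm_cat2r; rewrite cats0 in h.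
Qed.

Lemma knuth_tins x S : all (sorted ltn) S -> uniq (x :: flatten S) ->
  knuth (x :: word S) (word (tins x S)).
Proof.
elim: S x => [|c S IH] x /=; first by move=> _ _; exact: KnuthRefl.
case/andP=> sc sS; rewrite mem_cat negb_or cat_uniq => /andP [/andP [xc xS] /and3P [uc cS uS]].
have k1 := knuth_cins sc xc; have p1 := cins_perm x c.
rewrite -cat_cons; apply: KnuthTrans (knuth_catr _ k1) _.
case: (cins x c) p1 {k1} => c' [y|] /= p1; last first.
  by rewrite cats0; exact: KnuthRefl.
rewrite -catA; apply: knuth_catl; apply: IH => //=; rewrite uS andbT.
have : y \in x :: c by rewrite -(perm_mem p1) mem_cat mem_head orbT.
rewrite inE => /orP [/eqP -> //|yc]; apply: contra cS => yS.
by apply/hasP; exists y.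
Qed.

Definition tableau S := [&& all (sorted ltn) S, all (fun c => c != [::]) S & sorted leqcol S].

Lemma cins_neq0 x c : (cins x c).1 != [::].
Proof. by case: c => //= a c; case: ifP. Qed.

Lemma nth_set_cat p (a b : nat) q k : nth 0 (p ++ a :: q) k = if k == size p then a else nth 0 (p ++ b :: q) k.
Proof.
rewrite !nth_cat; case: ltngtP => // [h|->]; last by rewrite subnn.
by have -> : k - size p = (k - size p).-1.+1 by lia.
Qed.

(** The bumped entry [y] never moves down: in the row it leaves, [d] has an entry larger than [y] or
    none, so [y] enters [d] in that row or above, where the entries of the new column [c'] are below
    [y]. *)
Lemma leqcol_cins c c' d x y : sorted ltn c -> sorted ltn d -> x \notin c -> y \notin d ->
  leqcol c d -> cins x c = (c', Some y) -> leqcol c' (cins y d).1.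
Proof.
move=> sc sd xc yd /leqcolP [hs hr]; case: (cinsP sc xc) => [[-> _] //|[p [y' [q [ec h1 h2 ->]]]]] [<- ey].
rewrite {y'}ey in ec h2.
have ltc k l : k < l -> l < size c -> nth 0 c k < nth 0 c l.
  by move=> kl lc; apply: (sorted_ltn_nth ltn_trans) => //; rewrite inE // (ltn_trans kl).
have cp : nth 0 c (size p) = y by rewrite ec nth_cat ltnn subnn.
have spc : size p < size c by rewrite ec size_cat /=; lia.
have c'E k : nth 0 (p ++ x :: q) k = if k == size p then x else nth 0 c k.
  by rewrite ec; exact: nth_set_cat.
have sc' : size (p ++ x :: q) = size c by rewrite ec !size_cat.
have c'le k : nth 0 (p ++ x :: q) k <= nth 0 c k.
  by rewrite c'E; case: eqP => // ->; rewrite cp; apply: ltnW.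
have c'lt k : k <= size p -> nth 0 (p ++ x :: q) k < y.
  rewrite c'E; case: eqP => // ne kp; rewrite -cp; apply: ltc => //; lia.
case: (cinsP sd yd) => [[-> /allP hd]|[p2 [z [q2 [ed /allP k1 k2 ->]]]]] /=.
  have sdp : size d <= size p.
    rewrite leqNgt; apply/negP => h; have := hd _ (mem_nth 0 h); have := hr _ h.
    by rewrite cp /=; lia.
  apply/leqcolP; rewrite size_rcons sc'; split; first by apply: leq_ltn_trans spc.
  move=> r; rewrite ltnS leq_eqVlt nth_rcons => /orP [/eqP ->|h].
    by rewrite ltnn eqxx; apply: c'lt.
  by rewrite h; apply: leq_ltn_trans (c'le r) (hr r h).
have sp2 : size p2 <= size p.
  rewrite leqNgt; apply/negP => h; have hd : size p < size d by rewrite ed size_cat /=; lia.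
  have := hr _ hd; rewrite cp ed nth_cat h => h'.
  by have := k1 _ (mem_nth 0 h) => /=; lia.
apply/leqcolP; rewrite sc' -[size (p2 ++ _)]/(size (p2 ++ y :: q2)).
have -> : size (p2 ++ y :: q2) = size d by rewrite ed !size_cat.
split=> // r hrd; rewrite (nth_set_cat p2 y z q2) -ed; case: eqP => [->|_]; first exact: c'lt.
exact: leq_ltn_trans (c'le r) (hr r hrd).
Qed.

Lemma path_tins c c' x y S : path leqcol c S -> all (sorted ltn) (c :: S) -> x \notin c ->
  uniq (flatten (c :: S)) -> cins x c = (c', Some y) -> path leqcol c' (tins y S).
Proof.
elim: S c c' x y => [|d S IH] c c' x y /=.
  move=> _; rewrite andbT => sc xc _; case: (cinsP sc xc) => [[-> _] //|[p [y' [q [ec h1 h2 ->]]]]] [<- ey].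
  rewrite andbT; apply/leqcolP; split; first by rewrite size_cat /=; lia.
  move=> [|//] _; rewrite -ey; case: p h1 {ec} => [|a p] //= /andP [h _]; exact: ltn_trans h h2.
case/andP=> cd hp /and3P [sc sd sS] xc U e.
have yc : y \in c.
  case: (cinsP sc xc) e => [[-> _] //|[p [y' [q [ec h1 h2 ->]]]]] [_ <-].
  by rewrite ec mem_cat mem_head orbT.
move: (U); rewrite cat_uniq => /and3P [_ /hasPn h Ud].
have yd : y \notin d by apply: contraL yc => yd; apply: h; rewrite mem_cat yd.
rewrite (leqcol_cins sc sd xc yd cd e) /=.
case e2: (cins y d) => [d' [z|]] /=.
  by apply: (IH d d' y z) => //=; rewrite sd.
case: (cinsP sd yd) e2 => [[-> _] [<-]|[p [y' [q [ec h1 h2 ->]]]] //].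
case: S hp {IH sS U Ud h} => //= b S /andP [/leqcolP [h1 h2] ->]; rewrite andbT.
apply/leqcolP; rewrite size_rcons; split; first exact: leqW.
by move=> r hr; rewrite nth_rcons (leq_trans hr h1); apply: h2.
Qed.

Lemma tins_sorted x S : all (sorted ltn) S -> uniq (x :: flatten S) -> all (sorted ltn) (tins x S).
Proof.
elim: S x => [|c S IH] x //= /andP [sc sS].
rewrite mem_cat negb_or cat_uniq => /andP [/andP [xc xS] /and3P [uc cS uS]].
rewrite cins_sorted //=; have p1 := cins_perm x c.
case: (cins x c) p1 => c' [y|] //= p1; apply: IH => //=; rewrite uS andbT.
have : y \in x :: c by rewrite -(perm_mem p1) mem_cat mem_head orbT.
rewrite inE => /orP [/eqP -> //|yc]; apply: contra cS => yS.
by apply/hasP; exists y.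
Qed.

Lemma tins_neq0 x S : all (fun c => c != [::]) S -> all (fun c => c != [::]) (tins x S).
Proof.
elim: S x => [|c S IH] x //= /andP [_ h]; rewrite cins_neq0 /=.
by case: (cins x c) => c' [y|] /=; [exact: IH|].
Qed.

Lemma tins_tableau x S : tableau S -> uniq (x :: flatten S) -> tableau (tins x S).
Proof.
case/and3P=> h1 h2 h3 U; rewrite /tableau tins_sorted // tins_neq0 //=.
case: S h1 h2 h3 U => //= c S /andP [sc sS] _ hp.
rewrite mem_cat negb_or => /andP [/andP [xc xS] U].
case e: (cins x c) => [c' [y|]] /=.
  by apply: (path_tins hp _ xc U e) => /=; rewrite sc.
case: (cinsP sc xc) e => [[-> _] [<-]|[p [y' [q [ec h1 h2 ->]]]] //].
case: S hp {sS U xS} => //= b S /andP [/leqcolP [h1 h2] ->]; rewrite andbT.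
apply/leqcolP; rewrite size_rcons; split; first exact: leqW.
by move=> r hr; rewrite nth_rcons (leq_trans hr h1); apply: h2.
Qed.

Lemma knuth_tableau u : uniq u -> exists S, [/\ tableau S, perm_eq (flatten S) u & knuth u (word S)].
Proof.
elim: u => [|x u IH]; first by exists [::]; split=> //; exact: KnuthRefl.
case/andP=> xu uu; have [S [tS pS kS]] := IH uu.
have U : uniq (x :: flatten S).
  by have := @perm_uniq _ (x :: flatten S) (x :: u); rewrite perm_cons => /(_ pS) ->; rewrite /= xu.
exists (tins x S); split; first exact: tins_tableau.
  by apply: perm_trans (tins_perm x S) _; rewrite perm_cons.
apply: KnuthTrans (knuth_cons x kS) _; apply: knuth_tins => //.
by case/and3P: tS.
Qed.

End Insertion.

(** * Star operations connect every permutation to a longest element *)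

Section Blocks.
Local Open Scope nat_scope.
Variable n : nat.
Local Notation W := (W n).
Implicit Types (l m : Lam n) (s t w x y z : W).

Lemma psum0 l : psum l 0 = 0.
Proof. by rewrite /psum big_pred0. Qed.

Lemma psumS l (i : 'I_n) : psum l i.+1 = psum l i + val l i.
Proof.
rewrite /psum (bigD1 i) ?ltnSn //= addnC; congr (_ + _); apply: eq_bigl => j.
by rewrite ltnS -val_eqE /=; lia.
Qed.

Lemma psumn l k : n <= k -> psum l k = n.
Proof.
move=> nk; have /andP [_ /eqP e] := valP l; rewrite -[RHS]e /psum; apply: eq_bigl => i.
by rewrite (leq_trans (ltn_ord i)).
Qed.

Lemma psum_mono l k k' : k <= k' -> psum l k <= psum l k'.
Proof.
move=> h; rewrite /psum big_mkcond [X in _ <= X]big_mkcond; apply: leq_sum => i _.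
by case: ltnP => // ik; rewrite (leq_trans ik).
Qed.

Lemma psum_le l k : psum l k <= n.
Proof. by case: (leqP k n) => h; [rewrite -[X in _ <= X](psumn l (leqnn n)) psum_mono|rewrite psumn // ltnW]. Qed.

(* The index of the block of the composition l that contains the position j. *)
Definition blk l (j : nat) := find (fun k => j < psum l k.+1) (iota 0 n).

Lemma blk_bounds l j : j < n -> [/\ blk l j < n, psum l (blk l j) <= j & j < psum l (blk l j).+1].
Proof.
move=> jn; pose a k := j < psum l k.+1.
have ha : has a (iota 0 n).
  apply/hasP; exists n.-1; first by rewrite mem_iota; lia.
  by rewrite /a psumn //; lia.
have hs : blk l j < n by have := ha; rewrite has_find size_iota.
split=> //; last by have := nth_find 0 ha; rewrite /a nth_iota.
case e: (blk l j) => [|c]; first by rewrite psum0.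
have := @before_find _ 0 a (iota 0 n) c; rewrite -/(blk l j) e ltnSn nth_iota; last by rewrite -e in hs *; lia.
by move=> /(_ isT) /negbT; rewrite /a add0n -leqNgt.
Qed.

Lemma blk_lt l j k : j < n -> (blk l j < k) = (j < psum l k).
Proof.
move=> jn; have [_ h1 h2] := blk_bounds l jn; apply/idP/idP => h.
  by apply: leq_trans h2 _; apply: psum_mono.
by rewrite ltnNge; apply/negP => /(psum_mono l); lia.
Qed.

Lemma blk_mono l i j : i <= j -> j < n -> blk l i <= blk l j.
Proof.
move=> ij jn; rewrite -ltnS blk_lt; last exact: leq_ltn_trans ij jn.
by apply: leq_ltn_trans ij _; rewrite -blk_lt.
Qed.

Lemma blk_eq l j c : j < n -> psum l c <= j -> j < psum l c.+1 -> blk l j = c.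
Proof. by move=> jn h1 h2; apply/eqP; rewrite eqn_leq -ltnS blk_lt // h2 leqNgt blk_lt // -leqNgt. Qed.

Lemma youngGensP l s : reflect
  (exists i j : 'I_n, [/\ val j = (val i).+1, blk l i = blk l j & s = tperm i j])
  (s \in youngGens l).
Proof.
have key (i j : 'I_n) : val j = (val i).+1 ->
    ~~ [exists k : 'I_n.+1, (0 < k) && (psum l k == val j)] = (blk l i == blk l j).
  move=> hij; apply/idP/idP.
    rewrite negb_exists => /forallP h; rewrite eqn_leq blk_mono //=; last by rewrite hij.
    rewrite leqNgt; apply/negP => lt; have [b1 b2 b3] := blk_bounds l (ltn_ord j).
    have bn : blk l j < n.+1 by apply: ltnW.
    have := h (Ordinal bn); rewrite /= (leq_ltn_trans _ lt) //=.
    by rewrite blk_lt // in lt; case/eqP; move: b2 lt hij => /=; lia.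
  move/eqP => e; apply/existsP => -[k /andP [k0 /eqP pk]].
  have := blk_lt l k (ltn_ord i); have := blk_lt l k (ltn_ord j).
  by rewrite e pk ltnn hij ltnSn => ->.
rewrite inE; apply: (iffP existsP) => [[i /existsP [j /and3P [/eqP h1 h2 /eqP h3]]]|[i [j [h1 h2 h3]]]].
  by exists i, j; rewrite (key i j h1) in h2; rewrite (eqP h2).
by exists i; apply/existsP; exists j; rewrite (key i j h1) h2 h3 h1 !eqxx.
Qed.

Lemma youngGens_gens l s : s \in youngGens l -> s \in gens n.
Proof. by case/youngGensP => i [j [h _ e]]; apply/gensP; exists i, j. Qed.

Lemma blk_chain l (r : rel nat) (f : 'I_n -> nat) : transitive r ->
  (forall i j : 'I_n, val j = (val i).+1 -> blk l i = blk l j -> r (f i) (f j)) ->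
  forall i j : 'I_n, i < j -> blk l i = blk l j -> r (f i) (f j).
Proof.
move=> rt h i [j hj] /=; elim: j hj => // j IH hj; rewrite ltnS leq_eqVlt => /orP [/eqP ij|ij] e.
  by apply: h => //=; rewrite ij.
have hj' : j < n by apply: ltnW.
have e' : blk l i = blk l j.
  apply/eqP; rewrite eqn_leq blk_mono //=; last exact: ltnW.
  by rewrite e blk_mono.
apply: rt (IH hj' ij e') _; apply: (h (Ordinal hj') (Ordinal hj)) => //=.
by rewrite -e'.
Qed.

Definition decblk l w := forall i j : 'I_n, i < j -> blk l i = blk l j -> w j < w i.

Lemma decblkP l w : decblk l w <-> (forall s, s \in youngGens l -> dl s w).
Proof.
split=> [h s /youngGensP [i [j [hij e ->]]]|h]; first by rewrite dlE //; apply: h => //; rewrite -[X in _ < X]/(val j) hij.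
apply: (@blk_chain l (fun a b => b < a) (fun i => w i)) => [b a c h1 h2|i j hij e].
  exact: ltn_trans h2 h1.
by rewrite -(dlE w hij); apply: h; apply/youngGensP; exists i, j.
Qed.

Lemma decblkV l w : decblk l w^-1%g <-> (forall s, s \in youngGens l -> dr s w).
Proof.
rewrite decblkP; split=> h s hs; have := h s hs; by rewrite dr_dl // (youngGens_gens hs).
Qed.

(** The reflection $i\mapsto a+b-1-i$ of the block $[a,b)$; the resulting permutation [wrev l] is
    the $w_l$ of the overview. *)
Definition rev_in_blk l (i : 'I_n) : nat := psum l (blk l i) + psum l (blk l i).+1 - i.+1.
Lemma rev_in_blk_lt l i : rev_in_blk l i < n.
Proof.
have [_ h1 h2] := blk_bounds l (ltn_ord i); have := psum_le l (blk l i).+1.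
rewrite /rev_in_blk; lia.
Qed.
Definition rev_ord_blk l (i : 'I_n) : 'I_n := Ordinal (rev_in_blk_lt l i).
Lemma blk_rev l i : blk l (rev_ord_blk l i) = blk l i.
Proof.
have [_ h1 h2] := blk_bounds l (ltn_ord i).
apply: blk_eq; rewrite /= ?rev_in_blk_lt // /rev_in_blk; lia.
Qed.
Lemma rev_ord_blkK l : involutive (rev_ord_blk l).
Proof.
move=> i; apply: val_inj; rewrite /= {1}/rev_in_blk blk_rev /= /rev_in_blk.
have [_ h1 h2] := blk_bounds l (ltn_ord i); lia.
Qed.
Definition wrev l : W := perm (inv_inj (@rev_ord_blkK l)).
Lemma wrevE l i : wrev l i = rev_ord_blk l i. Proof. by rewrite permE. Qed.
Lemma wrevV l : (wrev l)^-1%g = wrev l.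
Proof.
apply/permP => i; apply: (@perm_inj _ (wrev l)); rewrite permKV !wrevE.
by rewrite rev_ord_blkK.
Qed.
Lemma wrev_dec l : decblk l (wrev l).
Proof.
move=> i j ij e; rewrite !wrevE /= /rev_in_blk -e.
have [_ h1 h2] := blk_bounds l (ltn_ord i); have [_ h3 h4] := blk_bounds l (ltn_ord j).
by rewrite -e in h4; lia.
Qed.

(* Satisfied by the column word of a standard tableau with column lengths l. *)
Definition tab l y := decblk l y /\ forall i : 'I_n, 0 < blk l i ->
  exists i' : 'I_n, (blk l i').+1 = blk l i /\ y i' < y i.

(** Induction on the column. An entry exceeds some entry one column to the left; if both values lay
    in one block of [m], the larger would have to occur at an earlier position, which its column
    excludes. *)
Lemma tab_blk l m y : tab l y -> decblk m y^-1%g -> forall i : 'I_n, blk l i <= blk m (y i).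
Proof.
move=> [_ ty] dy i; move e: (blk l i) => c; elim: c i e => // c IH i e.
have [|i' [e' lt]] := ty i; first by rewrite e.
have ei' : blk l i' = c by move: e'; rewrite e => -[].
have h1 := IH i' ei'; have h2 := @blk_mono m (y i') (y i) (ltnW lt) (ltn_ord _).
rewrite ltn_neqAle (leq_trans h1 h2) andbT; apply/eqP => ec.
have e2 : blk m (y i') = blk m (y i) by apply/eqP; rewrite eqn_leq h2 -ec h1.
have := dy _ _ lt e2; rewrite !permK => ii'.
by have := @blk_mono l i i' (ltnW ii') (ltn_ord _); rewrite e ei' ltnn.
Qed.

Lemma card_ord_lt k : k <= n -> #|[set i : 'I_n | i < k]| = k.
Proof.
move=> kn; rewrite -sum1_card (eq_bigl (fun i : 'I_n => i < k)); last by move=> i; rewrite inE.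
by rewrite (big_ord_narrow kn) sum1_card card_ord.
Qed.

(** By [tab_blk] the values in the first [k] blocks of [m] stand in the first [k] columns; counting
    them gives the inequality of partial sums. *)
Lemma tab_domle l m y : tab l y -> decblk m y^-1%g -> domle m l.
Proof.
move=> ty dy; apply/forallP => k; have kn : k <= n by rewrite -ltnS.
rewrite -(card_ord_lt (psum_le m k)) -(card_ord_lt (psum_le l k)).
rewrite -(card_imset _ (@perm_inj _ y^-1%g)); apply: subset_leq_card; apply/subsetP => i.
case/imsetP=> j; rewrite !inE -!blk_lt // => hj ->.
by apply: leq_ltn_trans hj; have := tab_blk ty dy (y^-1%g j); rewrite permKV.
Qed.

Lemma domle_antisym l m : domle l m -> domle m l -> l = m.
Proof.
move=> /forallP h1 /forallP h2; have e k : psum l k = psum m k.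
  case: (leqP n k) => h; first by rewrite !psumn.
  have kn : k < n.+1 by apply: ltnW.
  by apply/eqP; rewrite eqn_leq; apply/andP; split; [exact: (h1 (Ordinal kn))|exact: (h2 (Ordinal kn))].
apply: val_inj; apply/ffunP => i; apply: val_inj => /=.
by have := psumS l i; have := psumS m i; rewrite !e => -> /addnI.
Qed.

Lemma domle_refl l : domle l l. Proof. by apply/forallP. Qed.
Lemma domle_trans m l k : domle l m -> domle m k -> domle l k.
Proof. by move=> /forallP h1 /forallP h2; apply/forallP => i; apply: leq_trans (h1 i) (h2 i). Qed.

Lemma decblk_uniq l x y : (forall i, blk l (x i) = blk l i) -> (forall i, blk l (y i) = blk l i) ->
  decblk l x^-1%g -> decblk l y -> x = y.
Proof.
move=> bx bY dx dy; have bxV i : blk l (x^-1%g i) = blk l i by rewrite -[in RHS](permKV x i) bx.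
apply/eqP; rewrite eq_sym -(inj_eq (mulgI x^-1%g)) mulVg; apply/eqP; apply: incr_id => a b hab.
rewrite !permM; have ab : a < b by rewrite -[X in _ < X]/(val b) hab.
have := @blk_mono l a b (ltnW ab) (ltn_ord b); rewrite leq_eqVlt => /orP [/eqP e|lt].
  by apply: dy; [exact: dx|rewrite !bxV].
rewrite ltnNge; apply/negP => h.
by have := @blk_mono l _ _ h (ltn_ord _); rewrite !bY !bxV leqNgt lt.
Qed.

(** The inequalities of [tab_blk] have equal sums on both sides, as [y] permutes the positions. So
    they are equalities, and [y] preserves every block. *)
Lemma tab_wrev l y : tab l y -> decblk l y^-1%g -> y = wrev l.
Proof.
move=> ty dy; have h := tab_blk ty dy.
have e (i : 'I_n) : blk l i = blk l (y i).
  have [_] := @leqif_sum _ (fun=> true) (fun i : 'I_n => blk l i == blk l (y i)) (fun i : 'I_n => blk l i)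
                (fun i : 'I_n => blk l (y i)) (fun i _ => leqif_eq (h i)).
  rewrite [X in _ == X](reindex_inj (@perm_inj _ y^-1%g)) /=.
  under [X in _ == X]eq_bigr => j _ do rewrite permKV.
  by rewrite eqxx => /esym/forallP /(_ i) /eqP.
apply: (@decblk_uniq l) => //; last exact: wrev_dec.
by move=> i; rewrite wrevE blk_rev.
Qed.

Definition wdn w := [seq val (w i) | i <- enum 'I_n].
Lemma size_wdn w : size (wdn w) = n. Proof. by rewrite size_map size_enum_ord. Qed.
Lemma nth_wdn w (i : 'I_n) : nth 0 (wdn w) i = w i.
Proof. by rewrite (nth_map i) ?size_enum_ord // nth_ord_enum. Qed.
Lemma wdn_inj : injective wdn.
Proof. by move=> w w' e; apply/permP => i; apply: val_inj; rewrite /= -!nth_wdn e. Qed.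
Lemma wdn_uniq w : uniq (wdn w).
Proof. by rewrite map_inj_uniq ?enum_uniq // => i j /val_inj /perm_inj. Qed.

Lemma wdn_swap w p (a b : nat) q : wdn w = p ++ [:: a, b & q] -> exists i j : 'I_n,
  [/\ val i = size p, val j = (size p).+1 & wdn (tperm i j * w)%g = p ++ [:: b, a & q]].
Proof.
move=> e; have sz := size_wdn w; rewrite e size_cat /= in sz.
have hi : size p < n by lia.
have hj : (size p).+1 < n by lia.
exists (Ordinal hi), (Ordinal hj); split=> //.
have wi : w (Ordinal hi) = a :> nat by rewrite -nth_wdn e nth_cat ltnn subnn.
have wj : w (Ordinal hj) = b :> nat by rewrite -nth_wdn e nth_cat /= ltnNge leqnSn subSn // subnn.
apply: (@eq_from_nth _ 0); first by rewrite size_wdn size_cat /=.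
move=> k; rewrite size_wdn => hk; rewrite -[k]/(val (Ordinal hk)) nth_wdn permM.
case: tpermP => [->|->|n1 n2].
- by rewrite wj /= nth_cat ltnn subnn.
- by rewrite wi /= nth_cat /= ltnNge leqnSn subSn // subnn.
rewrite -nth_wdn e !nth_cat /=; case: ltngtP => // [h|h].
  have h2 : k != (size p).+1 by apply/eqP => e'; case: n2; apply: val_inj.
  by have -> : k - size p = (k - size p).-2.+2 by lia.
by case: n1; apply: val_inj.
Qed.

Lemma lstep_mul s t w : adjg s t -> dl s w -> ~~ dl t w -> ~~ dl s (t * w)%g -> lstep w (t * w)%g.
Proof.
move=> st h1 h2 h3; have [hs ht] := adjg_gens st; exists s, t.
rewrite invMg (gens_inv ht) /Qd -!dl_dr // h1 h2; split=> //.
by rewrite /star /Qd dr_mul // -dl_dr // h2 dr_dl // invMg (gens_inv ht) invgK h3.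
Qed.

Lemma rstep_sym x y : rstep x y -> rstep y x.
Proof.
move=> [s [t [st hx ->]]]; exists t, s; split; [exact: adjg_sym|exact: starQ|].
by rewrite starK.
Qed.
Lemma lstep_sym x y : lstep x y -> lstep y x. Proof. exact: rstep_sym. Qed.

Inductive lconn : W -> W -> Prop :=
| LconnRefl x : lconn x x
| LconnStep x y z : lstep x y -> lconn y z -> lconn x z.

Lemma lconn_trans y x z : lconn x y -> lconn y z -> lconn x z.
Proof. by elim=> // a b c ab _ IH /IH; exact: LconnStep. Qed.
Lemma lconn1 x y : lstep x y -> lconn x y.
Proof. by move=> h; apply: LconnStep h (LconnRefl y). Qed.

Lemma dl_word w (i j : 'I_n) (a b : nat) : val j = (val i).+1 -> w i = a :> nat -> w j = b :> nat ->
  dl (tperm i j) w = (b < a).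
Proof. by move=> h <- <-; exact: dlE. Qed.

(** At the three positions, $yxz$ and $yzx$ have one descent each, in different places; the exchange
    of positions is a left multiplication, so it is a left star operation. *)
Lemma lstep_yxz w p q (x y z : nat) : x < y < z -> wdn w = p ++ [:: y, x, z & q] ->
  exists w', wdn w' = p ++ [:: y, z, x & q] /\ lstep w w'.
Proof.
move=> xyz e; have e' : wdn w = rcons p y ++ [:: x, z & q] by rewrite cat_rcons.
have [j [k [hj hk e2]]] := wdn_swap e'; rewrite size_rcons cat_rcons in hj hk e2.
have [i [_ [hi _ _]]] := wdn_swap e.
exists (tperm j k * w)%g; split=> //.
have wi : w i = y :> nat by rewrite -nth_wdn e [X in nth _ _ X]hi nth_cat ltnn subnn.
have wj : w j = x :> nat by rewrite -nth_wdn e [X in nth _ _ X]hj nth_cat /= ltnNge leqnSn subSn // subnn.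
have wk : w k = z :> nat by rewrite -nth_wdn e [X in nth _ _ X]hk nth_cat /= ltnNge; rewrite (_ : size p <= _) ?subSn ?subnn //; lia.
have wi' : (tperm j k * w)%g i = y :> nat.
  by rewrite permM tpermD // -val_eqE /= -?[nat_of_ord _]/(val _) ?hi ?hj ?hk; lia.
have wj' : (tperm j k * w)%g j = z :> nat by rewrite permM tpermL.
have ij : val j = (val i).+1 by rewrite hi hj.
have jk : val k = (val j).+1 by rewrite hk hj.
apply: (@lstep_mul (tperm i j)).
- by exists i, j, k; split=> //; left.
- by rewrite (dl_word ij wi wj); lia.
- by rewrite (dl_word jk wj wk); lia.
by rewrite (dl_word ij wi' wj'); lia.
Qed.

Lemma lstep_xzy w p q (x y z : nat) : x < y < z -> wdn w = p ++ [:: x, z, y & q] ->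
  exists w', wdn w' = p ++ [:: z, x, y & q] /\ lstep w w'.
Proof.
move=> xyz e; have e' : wdn w = rcons p x ++ [:: z, y & q] by rewrite cat_rcons.
have [_ [k [_ hk _]]] := wdn_swap e'; rewrite size_rcons in hk.
have [i [j [hi hj e2]]] := wdn_swap e.
exists (tperm i j * w)%g; split=> //.
have wi : w i = x :> nat by rewrite -nth_wdn e [X in nth _ _ X]hi nth_cat ltnn subnn.
have wj : w j = z :> nat by rewrite -nth_wdn e [X in nth _ _ X]hj nth_cat /= ltnNge leqnSn subSn // subnn.
have wk : w k = y :> nat by rewrite -nth_wdn e [X in nth _ _ X]hk nth_cat /= ltnNge; rewrite (_ : size p <= _) ?subSn ?subnn //; lia.
have wk' : (tperm i j * w)%g k = y :> nat.
  by rewrite permM tpermD // -val_eqE /= -?[nat_of_ord _]/(val _) ?hi ?hj ?hk; lia.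
have wj' : (tperm i j * w)%g j = x :> nat by rewrite permM tpermR.
have ij : val j = (val i).+1 by rewrite hi hj.
have jk : val k = (val j).+1 by rewrite hk hj.
apply: (@lstep_mul (tperm j k)).
- by exists i, j, k; split=> //; right.
- by rewrite (dl_word jk wj wk); lia.
- by rewrite (dl_word ij wi wj); lia.
by rewrite (dl_word jk wj' wk'); lia.
Qed.

(** Both directions are proved together because of [KnuthSym]. For the backward one, the preimage is
    made by a swap and identified through [wdn_inj]. *)
Lemma knuth_lconn (u t : seq nat) : knuth u t ->
  (forall w, wdn w = u -> exists w', wdn w' = t /\ lconn w w') /\
  (forall w, wdn w = t -> exists w', wdn w' = u /\ lconn w w').
Proof.
elim=> {u t} [u|p q x y z h|p q x y z h|u t _ [h1 h2]|t u q _ [h1 h2] _ [h3 h4]].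
- by split=> w e; exists w; split=> //; exact: LconnRefl.
- split=> w e; first by have [w' [e' s]] := lstep_yxz h e; exists w'; split=> //; exact: lconn1.
  have e1 : wdn w = rcons p y ++ [:: z, x & q] by rewrite cat_rcons.
  have [i [j [_ _ e2]]] := wdn_swap e1; rewrite cat_rcons in e2.
  exists (tperm i j * w)%g; split=> //; apply: lconn1; apply: lstep_sym.
  by have [w' [e' s]] := lstep_yxz h e2; move: e' s; rewrite -e => /wdn_inj ->.
- split=> w e; first by have [w' [e' s]] := lstep_xzy h e; exists w'; split=> //; exact: lconn1.
  have [i [j [_ _ e2]]] := wdn_swap e.
  exists (tperm i j * w)%g; split=> //; apply: lconn1; apply: lstep_sym.
  by have [w' [e' s]] := lstep_xzy h e2; move: e' s; rewrite -e => /wdn_inj ->.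
- by [].
split=> w e.
  have [w1 [e1 c1]] := h1 w e; have [w2 [e2 c2]] := h3 w1 e1; exists w2; split=> //.
  exact: lconn_trans c1 c2.
have [w1 [e1 c1]] := h4 w e; have [w2 [e2 c2]] := h2 w1 e1; exists w2; split=> //.
exact: lconn_trans c1 c2.
Qed.

Lemma sumn_take_nth (sh : seq nat) k : sumn (take k.+1 sh) = sumn (take k sh) + nth 0 sh k.
Proof.
elim: sh k => [|a sh IH] [|k] //=; first by rewrite take0 addn0.
by rewrite IH addnA.
Qed.

Lemma nth_word S c r : r < size (nth [::] S c) ->
  nth 0 (word S) (sumn (take c (map size S)) + r) = nth 0 (rev (nth [::] S c)) r.
Proof.
rewrite /word; elim: S c => [|d S IH] [|c] //= hr.
  by rewrite add0n nth_cat size_rev hr.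
rewrite -addnA nth_cat size_rev ltnNge leq_addr /= addKn.
exact: IH.
Qed.

Lemma tableau_tab S w : tableau S -> wdn w = word S -> exists l, tab l w.
Proof.
case/and3P=> sS nS lS e; pose sh := map size S.
have shE c : nth 0 sh c = size (nth [::] S c).
  by case: (ltnP c (size S)) => h; [rewrite (nth_map [::])|rewrite !nth_default // size_map].
have sum_sh : sumn sh = n.
  by rewrite -(size_wdn w) e /word size_flatten /shape -map_comp; congr sumn; apply: eq_map => c /=; rewrite size_rev.
have adj c : c.+1 < size S -> leqcol (nth [::] S c) (nth [::] S c.+1).
  by move=> h; move: lS; case: (S) h => // d S' h /pathP; apply.
have mono c : nth 0 sh c.+1 <= nth 0 sh c.
  rewrite !shE; case: (ltnP c.+1 (size S)) => h; last by rewrite nth_default.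
  by have /leqcolP [] := adj c h.
have mono' i j : i <= j -> nth 0 sh j <= nth 0 sh i.
  by move=> /subnK <-; elim: (j - i) => // k IH; apply: leq_trans (mono _) IH.
have take_le k : sumn (take k sh) <= n.
  by rewrite -sum_sh -{2}(cat_take_drop k sh) sumn_cat leq_addr.
have size_sh : size S <= n.
  rewrite -sum_sh /sh; elim: (S) nS => //= c S' IH /andP [h /IH h'].
  by rewrite -add1n leq_add // lt0n size_eq0.
have sh_le c : nth 0 sh c <= n.
  by apply: leq_trans (take_le c.+1); rewrite sumn_take_nth leq_addl.
pose f : {ffun 'I_n -> 'I_n.+1} := [ffun i : 'I_n => inord (nth 0 sh i)].
have fE i : f i = nth 0 sh i :> nat by rewrite ffunE inordK // ltnS.
have sumE k : k <= n -> \sum_(i < n | i < k) (f i : nat) = sumn (take k sh).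
  elim: k => [|k IH] hk; first by rewrite big_pred0 ?take0.
  rewrite (bigD1 (Ordinal hk)) ?ltnSn //= fE sumn_take_nth addnC; congr (_ + _).
  rewrite -IH; last exact: ltnW.
  by apply: eq_bigl => j; rewrite ltnS -val_eqE /=; lia.
have fp : is_part f.
  apply/andP; split.
    by apply/forallP => i; apply/forallP => j; apply/implyP => ij; rewrite !fE mono'.
  have := sumE n (leqnn n); rewrite take_oversize ?size_map // sum_sh => E; apply/eqP; apply: etrans E.
  by apply: eq_bigl => i; rewrite ltn_ord.
exists (exist _ f fp : Lam n); set l : Lam n := exist _ f fp.
have psE k : k <= n -> psum l k = sumn (take k sh) by exact: sumE.
have psS k : k < n -> psum l k.+1 = psum l k + nth 0 sh k.
  by move=> h; rewrite !psE ?sumn_take_nth // ltnW.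
(* Columns are read from bottom to top, so the [r]-th position of a block holds row (length $-1-r$)
   of its column. *)
have pos (i : 'I_n) : exists r, [/\ r < nth 0 sh (blk l i), val i = psum l (blk l i) + r &
    w i = nth 0 (nth [::] S (blk l i)) ((nth 0 sh (blk l i)).-1 - r) :> nat].
  have [b1 b2 b3] := blk_bounds l (ltn_ord i); rewrite psS // in b3.
  have hr : i - psum l (blk l i) < nth 0 sh (blk l i) by lia.
  exists (i - psum l (blk l i)); split=> //; first by rewrite /= subnKC.
  rewrite -nth_wdn e -{1}(subnKC b2) {1}psE; last exact: ltnW.
  rewrite nth_word -?shE // nth_rev -shE //; congr nth; lia.
have sc c : sorted ltn (nth [::] S c).
  by case: (ltnP c (size S)) => h; [apply: (allP sS); exact: mem_nth|rewrite nth_default].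
split=> [i j ij eb|i hb].
  have [r [h1 h2 h3]] := pos i; have [r' [h1' h2' h3']] := pos j.
  rewrite -eb in h1' h2' h3'; rewrite h3 h3'.
  have rr : r < r' by move: ij h2 h2' => /=; lia.
  by apply: (sorted_ltn_nth ltn_trans) => //; rewrite ?inE -?shE; lia.
have [r [h1 h2 h3]] := pos i; have [b1 b2 b3] := blk_bounds l (ltn_ord i).
case ec: (blk l i) hb h1 h2 h3 b1 b2 b3 => [//|c] _ h1 h2 h3 b1 b2 b3.
(* [rho] is the row of the entry, and [k] below is the position of the entry of the same row in the
   previous column. *)
set rho := (nth 0 sh c.+1).-1 - r in h3.
have mc := mono c; have hc : c < n by apply: ltnW.
pose k := psum l c + ((nth 0 sh c).-1 - rho).
have kc : k < psum l c.+1 by rewrite psS // /k; lia.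
have kn : k < n by apply: leq_trans kc (psum_le l _).
have bk : blk l (Ordinal kn) = c by apply: blk_eq => //=; rewrite /k leq_addr.
exists (Ordinal kn); rewrite bk; split=> //.
have [r' [h1' h2' h3']] := pos (Ordinal kn); rewrite bk /= in h1' h2' h3'.
have -> : w (Ordinal kn) = nth 0 (nth [::] S c) rho :> nat.
  by rewrite h3'; congr nth; rewrite /k in h2'; rewrite /rho in h2' *; lia.
rewrite h3; have cS : c.+1 < size S.
  by rewrite ltnNge; apply/negP => h; rewrite shE nth_default in h1.
have /leqcolP [_] := adj c cS; apply; rewrite -shE /rho; lia.
Qed.

Lemma lconn_tab w : exists w' l, lconn w w' /\ tab l w'.
Proof.
have [S [tS _ kS]] := knuth_tableau (wdn_uniq w).
have [w' [e c]] := (proj1 (knuth_lconn kS)) w erefl.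
by have [l hl] := tableau_tab tS e; exists w', l.
Qed.

Definition rconn x y := lconn x^-1%g y^-1%g.

Inductive conn : W -> W -> Prop :=
| ConnL x y : lconn x y -> conn x y
| ConnR x y : rconn x y -> conn x y
| ConnTrans y x z : conn x y -> conn y z -> conn x z.

Lemma connV x y : conn x y -> conn x^-1%g y^-1%g.
Proof.
elim=> {x y} [x y h|x y h|y x z _ h1 _ h2].
- by apply: ConnR; rewrite /rconn !invgK.
- exact: ConnL.
- exact: ConnTrans h1 h2.
Qed.

End Blocks.

Section Connected.
Local Open Scope nat_scope.
Variables (R : realType) (n : nat).
Local Notation W := (W n).
Implicit Types (l m : Lam n) (s t w x y z : W).

Lemma lconn_simL x y : lconn x y -> @simL R n x y.
Proof.
elim=> {x y} [x|x y z h _ IH]; first exact: simL_refl.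
by apply: simL_trans IH; apply: lstep_simL.
Qed.

Lemma simL_decblkV l x y : @simL R n x y -> decblk l x^-1%g -> decblk l y^-1%g.
Proof.
move=> h /decblkV hx; apply/decblkV => s hs.
by rewrite (simL_dr (youngGens_gens hs) h); apply: hx.
Qed.

(** A strictly increasing rank for dominance: the induction measure of [conn_wrev_aux] and the
    quantity counted in [chi_E]. *)
Definition psum_sum l := \sum_(k < n.+1) psum l k.

Lemma psum_sum_lt l m : domle l m -> l <> m -> psum_sum l < psum_sum m.
Proof.
move=> lm ne; have /forallP h := lm.
rewrite ltn_neqAle /psum_sum leq_sum ?andbT //.
apply/negP; have [_ ->] := @leqif_sum _ (fun=> true) (fun k : 'I_n.+1 => psum l k == psum m k)
   (fun k : 'I_n.+1 => psum l k) (fun k : 'I_n.+1 => psum m k) (fun k _ => leqif_eq (h k)).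
move/forallP => e; apply: ne; apply: domle_antisym => //.
by apply/forallP => k; rewrite (eqP (e k)).
Qed.

(* If the right descents of y contain S_l, then y is connected to the word z of a tableau with column lengths
   m >= l. If m = l then z = w_l; otherwise the left descents of z contain S_m, and one goes on with the inverse
   of z and m. *)
Lemma conn_wrev_aux (N : nat) l y : (n.+1 * n - psum_sum l < N)%N ->
  (decblk l y^-1%g -> lconn y (wrev l) \/ exists m, [/\ domle l m, l <> m & conn y (wrev m)]) /\
  (decblk l y -> rconn y (wrev l) \/ exists m, [/\ domle l m, l <> m & conn y (wrev m)]).
Proof.
elim: N l y => // N IH l y; rewrite ltnS => hN.
have first l' z : l' = l -> decblk l' z^-1%g ->
    lconn z (wrev l') \/ exists m, [/\ domle l' m, l' <> m & conn z (wrev m)].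
  move=> -> {l'} dz; have [z1 [m [zz1 tz1]]] := lconn_tab z.
  have dz1 := simL_decblkV (lconn_simL zz1) dz; have lm := tab_domle tz1 dz1.
  have [e|ne] := eqVneq l m.
    by left; rewrite -(tab_wrev (l := l) (y := z1)) // e.
  right; have lt := psum_sum_lt lm (elimN eqP ne).
  (* With this bound, passing to the strictly larger [m] lowers the natural number
     [n.+1 * n - psum_sum]. *)
  have bd : psum_sum m <= n.+1 * n.
    rewrite -[n.+1]card_ord -sum_nat_const; apply: leq_sum => k _; exact: psum_le.
  have [_ /(_ (proj1 tz1))] := IH m z1 (ltac:(lia)); case=> [c|[m' [h1 h2 h3]]].
    exists m; split=> //; first exact/eqP.
    exact: ConnTrans (ConnL zz1) (ConnR c).
  exists m'; split; first exact: domle_trans lm h1.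
    move=> e; rewrite -e in h1; case/eqP: ne; exact: domle_antisym.
  exact: ConnTrans (ConnL zz1) h3.
split; first exact: first.
rewrite -{1}[y]invgK => dy; case: (first l y^-1%g erefl dy) => [c|[m [h1 h2 h3]]].
  by left; rewrite /rconn wrevV.
by right; exists m; split=> //; have := connV h3; rewrite invgK wrevV.
Qed.

Lemma lconn_wrev l y : decblk l y^-1%g ->
  lconn y (wrev l) \/ exists m, [/\ domle l m, l <> m & conn y (wrev m)].
Proof. exact: (proj1 (conn_wrev_aux _ (ltnSn _))). Qed.
Lemma rconn_wrev l y : decblk l y ->
  rconn y (wrev l) \/ exists m, [/\ domle l m, l <> m & conn y (wrev m)].
Proof. exact: (proj2 (conn_wrev_aux _ (ltnSn _))). Qed.

Lemma conn_wrev y : exists l, conn y (wrev l).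
Proof.
have [y1 [l [yy1 [t1 _]]]] := lconn_tab y.
case: (rconn_wrev t1) => [c|[m [_ _ c]]]; [exists l|exists m].
  exact: ConnTrans (ConnL yy1) (ConnR c).
exact: ConnTrans (ConnL yy1) c.
Qed.

End Connected.

(** * The character induced from the sign representation *)

Section Parabolic.
Variable n : nat.
Local Notation W := (W n).
Implicit Types (l m : Lam n) (s t w x y z u d : W).

Lemma len_mul_le x y : (len (x * y)%g <= len x + len y)%N.
Proof.
elim/len_ind: x y => [|s w hs hd IH] y; first by rewrite mul1g len1.
rewrite (len_gens hs hd) addSn.
have -> : (w * y = s * (s * w * y))%g by rewrite !mulgA gens_sqr // mul1g.
case: (boolP (dl s (s * w * y)%g)) => h.
  by apply: leqW; apply: leq_trans (IH y); apply: ltnW.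
by rewrite (len_gensN hs h) ltnS.
Qed.

Lemma youngG_blk l u : u \in youngG l -> forall i, blk l (u i) = blk l i.
Proof.
move=> hu; have: u \in [set w : W | [forall i, blk l (w i) == blk l i]].
  have gS : group_set [set w : W | [forall i, blk l (w i) == blk l i]].
    apply/group_setP; split; first by rewrite inE; apply/forallP => i; rewrite perm1.
    move=> x y; rewrite !inE => /forallP hx /forallP hy; apply/forallP => i.
    by rewrite permM (eqP (hy _)) (eqP (hx _)).
  move: u hu; apply/subsetP; rewrite (gen_subG _ (Group gS)); apply/subsetP => s.
  case/youngGensP => i [j [_ e ->]]; rewrite inE; apply/forallP => k.
  by case: tpermP => [->|->|_ _]; rewrite ?e.
by rewrite inE => /forallP h i; apply/eqP.
Qed.

Lemma youngGensG l s : s \in youngGens l -> s \in youngG l.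
Proof. exact: mem_gen. Qed.

Lemma youngG_desc l u : u \in youngG l -> u != 1%g -> exists2 s, s \in youngGens l & dl s u.
Proof.
move=> hu u1; case: (pickP [pred s in youngGens l | dl s u]) => [s /andP [h1 h2]|h]; first by exists s.
case/eqP: u1; apply: incr_id => a b hab; have bu := youngG_blk hu.
have := @blk_mono n l a b _ (ltn_ord b); rewrite [(a <= b)%N](_ : _ = true); last by move: hab => /=; lia.
move=> /(_ isT); rewrite leq_eqVlt => /orP [/eqP e|lt].
  have := h (tperm a b); rewrite /= dlE // (_ : tperm a b \in _) ?andTb; last by apply/youngGensP; exists a, b.
  move/negbT; rewrite -leqNgt leq_eqVlt => /orP [/eqP /val_inj /perm_inj e'|//].
  by move: hab; rewrite e' /=; lia.
rewrite ltnNge; apply/negP => hle.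
by have := @blk_mono n l _ _ hle (ltn_ord _); rewrite !bu leqNgt lt.
Qed.

Lemma minReps_incr l d : d \in minReps l -> forall a b : 'I_n, (a < b)%N -> blk l a = blk l b ->
  (d^-1%g a < d^-1%g b)%N.
Proof.
rewrite inE => /forall_inP h a b.
apply: (@blk_chain n l ltn (fun i => d^-1%g i)) => [y x z|i j hij e]; first exact: ltn_trans.
have hs : tperm i j \in youngGens l by apply/youngGensP; exists i, j.
have := h _ hs; have hg := youngGens_gens hs; rewrite ltnNge => h'.
have nd : ~~ dr (tperm i j) d by apply: contra h' => h'; apply: ltnW.
rewrite drE // -leqNgt leq_eqVlt in nd; case/orP: nd => // /eqP /val_inj /perm_inj e'.
by move: hij; rewrite e' /=; lia.
Qed.

(** Carried over by [d], the inversions of $du$ form [X], the disjoint union of [A] (from [d]) and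
    [B] (from [u]): on a pair within one block $d^{-1}$ is increasing, and on a pair from different
    blocks [u] keeps the order. *)
Lemma len_min_mul l d u : d \in minReps l -> u \in youngG l -> len (d * u)%g = (len d + len u)%N.
Proof.
move=> hd hu; have inc := minReps_incr hd; have bu := youngG_blk hu.
pose f (p : 'I_n * 'I_n) := (d p.1, d p.2).
have fI : injective f by move=> [a b] [a' b'] [/perm_inj -> /perm_inj ->].
pose A := [set p : 'I_n * 'I_n | (d^-1%g p.1 < d^-1%g p.2)%N && (p.2 < p.1)%N].
pose B := [set p : 'I_n * 'I_n | (p.1 < p.2)%N && (u p.2 < u p.1)%N].
pose X := [set p : 'I_n * 'I_n | (d^-1%g p.1 < d^-1%g p.2)%N && (u p.2 < u p.1)%N].
have cX : len (d * u)%g = #|X|.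
  rewrite /len -[LHS](card_imset _ fI); apply: eq_card => -[a b]; rewrite !inE /=.
  apply/imsetP/andP => [[[a' b']]|[h1 h2]].
    by rewrite inE /f /= !permM => /andP [h1 h2] [-> ->]; rewrite !permK.
  by exists (d^-1%g a, d^-1%g b); rewrite /f /= ?permKV // inE /= !permM !permKV h1.
have cA : len d = #|A|.
  rewrite /len -[LHS](card_imset _ fI); apply: eq_card => -[a b]; rewrite !inE /=.
  apply/imsetP/andP => [[[a' b']]|[h1 h2]].
    by rewrite inE /f /= => /andP [h1 h2] [-> ->]; rewrite !permK.
  by exists (d^-1%g a, d^-1%g b); rewrite /f /= ?permKV // inE /= !permKV h1.
have blt (a b : 'I_n) : (a < b)%N -> blk l a <> blk l b -> (blk l a < blk l b)%N.
  by move=> ab ne; rewrite ltn_neqAle blk_mono ?ltn_ord ?(ltnW ab) // andbT; apply/eqP.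
have bltV (a b : 'I_n) : (blk l a < blk l b)%N -> (a < b)%N.
  by move=> h; rewrite ltnNge; apply/negP => h'; have := @blk_mono n l _ _ h' (ltn_ord _); rewrite leqNgt h.
have ABX : X = A :|: B /\ A :&: B = set0.
  split; apply/setP => -[a b]; rewrite !inE /=; last first.
    by apply/negP => /andP [/andP [_ h1] /andP [h2 _]]; move: h1 h2; lia.
  have [e|ne] := eqVneq (blk l a) (blk l b).
    have uab : (u b < u a)%N -> a <> b by move=> h e'; move: h; rewrite e' ltnn.
    case: (ltngtP a b) => [ab|ba|/val_inj ab].
    - by rewrite (inc a b ab e).
    - have i1 := inc b a ba (esym e).
      have nu : (d^-1%g a < d^-1%g b)%N = false by apply/negbTE; rewrite -leqNgt ltnW.
      by rewrite nu.
    - by rewrite ab !ltnn.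
  have ne' : blk l a <> blk l b by apply/eqP.
  case: (ltngtP a b) => [ab|ba|/val_inj ab]; last by rewrite ab eqxx in ne.
    have h := blt a b ab ne'.
    have h' : (u a < u b)%N by apply: bltV; rewrite !bu.
    by rewrite (_ : (u b < u a)%N = false) ?andbF //; apply/negbTE; rewrite -leqNgt ltnW.
  have h := blt b a ba (fun e => ne' (esym e)).
  have h' : (u b < u a)%N by apply: bltV; rewrite !bu.
  by rewrite h' orbF.
rewrite cX cA /len -/B; case: ABX => -> e0.
by rewrite cardsU e0 cards0 subn0.
Qed.

Lemma min_decomp l w : exists d u, [/\ d \in minReps l, u \in youngG l & w = (d * u)%g].
Proof.
have [m] := ubnP (len w); elim: m w => // m IH w; rewrite ltnS => lw.
case: (boolP (w \in minReps l)) => hw; first by exists w, 1%g; rewrite group1 mulg1.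
move: hw; rewrite inE negb_forall_in => /exists_inP [s hs].
have hg := youngGens_gens hs; rewrite -leqNgt => le.
have hd : dr s w.
  by apply: contraLR le => nd; rewrite len_gensNr // -ltnNge ltnSn.
have lt : (len (w * s)%g < m)%N by apply: leq_trans lw; rewrite (len_gensr hg hd).
have [d [u [h1 h2 e]]] := IH _ lt; exists d, (u * s)%g; split=> //.
  by rewrite groupM // youngGensG.
by rewrite mulgA -e gens_mulKr.
Qed.

(** With $z=u'u^{-1}$ the lengths add in both $d=d'z$ and $d'=dz^{-1}$, so $l(z)=0$. *)
Lemma min_decomp_uniq l d d' u u' : d \in minReps l -> d' \in minReps l ->
  u \in youngG l -> u' \in youngG l -> (d * u = d' * u')%g -> d = d' /\ u = u'.
Proof.
move=> hd hd' hu hu' e; pose z := (u' * u^-1)%g.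
have hz : z \in youngG l by rewrite groupM ?groupV.
have ed : d = (d' * z)%g by rewrite /z mulgA -e mulgK.
have ed' : d' = (d * z^-1)%g by rewrite ed mulgK.
have l1 := len_min_mul hd' hz; rewrite -ed in l1.
have := len_min_mul hd (groupVr hz); rewrite -ed' lenV => l2.
have z1 : z = 1%g by apply/eqP; rewrite -len_eq0; lia.
rewrite z1 mulg1 in ed; split=> //; apply: (@mulgI _ d'); by rewrite -{1}ed.
Qed.

Lemma sum_decomp (V : nmodType) l (F : W -> V) :
  \sum_w F w = \sum_(d in minReps l) \sum_(u in youngG l) F (d * u)%g.
Proof.
rewrite pair_big_dep /=.
pose A := [set p : W * W | (p.1 \in minReps l) && (p.2 \in youngG l)].
transitivity (\sum_(p in A) F (p.1 * p.2)%g); last by apply: eq_bigl => p; rewrite inE.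
rewrite -(big_imset (h := fun p : W * W => (p.1 * p.2)%g)) /=; last first.
  move=> [d u] [d' u']; rewrite [(d, u) \in A]inE [(d', u') \in A]inE /= => /andP [h1 h2] /andP [h3 h4] e.
  by have [-> ->] := min_decomp_uniq h1 h3 h2 h4 e.
apply: eq_bigl => w; apply/esym/imsetP; have [d [u [h1 h2 ->]]] := min_decomp l w.
by exists (d, u); rewrite // [(d, u) \in A]inE /= h1.
Qed.

End Parabolic.

(** The coefficient is $\varepsilon_uv^{-l(u)}$, the value of the sign character at $T_u$. Thus
    $T_s$ acts on $e_l$ by $-v^{-1}$, as it does on $C_y$ when $sy<y$. *)
HB.lock Definition esgn (R : realType) n (l : Lam n) : hecke R n :=
  \sum_(u in youngG l) (- (vK R)^-1) ^+ len u *: (T R u : hecke R n).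

Section Esgn.
Variables (R : realType) (n : nat).
Local Notation K := (K R).
Local Notation v := (vK R).
Local Notation W := (W n).
Local Notation H := (hecke R n).
Local Notation gens := (gens n).
Local Notation T := (@T R n : W -> H).
Local Notation C := (@KC R n).
Local Notation cc := (@cc R n).
Local Notation Nm := (@Nm R n).
Local Notation E := (@esgn R n).
Local Notation mv := (- v^-1 : K).
Implicit Types (l m : Lam n) (s t w x y z u d : W) (h k : H).

Lemma T_mul x y : len (x * y)%g = (len x + len y)%N -> T x * T y = T (x * y)%g.
Proof.
elim/len_ind: x y => [|s w hs hd IH] y; first by rewrite T1E mul1r mul1g.
rewrite (len_gens hs hd) addSn => e.
have wy : (w * y = s * (s * w * y))%g by rewrite !mulgA gens_sqr // mul1g.
have h1 := len_mul_le (s * w)%g y.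
have nd : ~~ dl s (s * w * y)%g.
  by apply/negP => h; have := len_gens hs h; rewrite -wy e; lia.
have e2 : len (s * w * y)%g = (len (s * w)%g + len y)%N.
  by move: e; rewrite wy (len_gensN hs nd) => -[].
by rewrite (T_down R hs hd) -mulrA IH // T_up // -wy.
Qed.

Lemma EsumE l : E l = \sum_(u in youngG l) mv ^+ len u *: T u.
Proof. by rewrite esgn.unlock. Qed.

Lemma EE l x : E l x = (x \in youngG l)%:R * mv ^+ len x :> K.
Proof.
rewrite EsumE hsum; have [hx|hx] := boolP (x \in youngG l).
  rewrite (bigD1 x) //= hZ TE eqxx mulr1 mul1r big1 ?addr0 // => u /andP [_ /negPf ne].
  by rewrite hZ TE eq_sym ne mulr0.
rewrite mul0r big1 // => u hu; rewrite hZ TE; case: eqP hx => [->|]; first by rewrite hu.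
by rewrite mulr0.
Qed.

Lemma TsE_l l s : s \in youngGens l -> T s * E l = mv *: E l.
Proof.
move=> hs; have hg := youngGens_gens hs; apply/ffunP => x; rewrite TsM // hZ !EE.
rewrite (groupMl x (youngGensG hs)); case: (x \in youngG l); last by rewrite !(mulr0n, mul0r, mulr0, addr0).
rewrite !mul1r; case: (boolP (dl s x)) => hd.
  rewrite (len_gens hg hd) exprS mul1r; move: (mv ^+ _) => a.
  have e : v * v^-1 = 1 by rewrite mulfV // v_neq0.
  have -> : a + (v - v^-1) * (mv * a) = a - (v * v^-1) * a + mv * (mv * a) by ring.
  by rewrite e mul1r subrr add0r.
by rewrite (len_gensN hg hd) exprS mul0r mul0r addr0.
Qed.

Lemma flatE_l l : flat (E l) = E l.
Proof. by apply/ffunP => x; rewrite flatE !EE groupV lenV. Qed.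

Lemma ETs l s : s \in youngGens l -> E l * T s = mv *: E l.
Proof.
move=> hs; have hg := youngGens_gens hs.
by rewrite -[E l * T s]flatK flatM flatTs // flatE_l TsE_l // flatZ flatE_l.
Qed.

Lemma youngG_ind l (Q : W -> Prop) : Q 1%g ->
  (forall s u, s \in youngGens l -> dl s u -> u \in youngG l -> Q (s * u)%g -> Q u) ->
  forall u, u \in youngG l -> Q u.
Proof.
move=> Q1 QS u; have [m] := ubnP (len u); elim: m u => // m IH u; rewrite ltnS => lu hu.
have [->//|u1] := eqVneq u 1%g; have [s hs hd] := youngG_desc hu u1.
apply: (QS s) => //; apply: IH; last by rewrite groupM // youngGensG.
by apply: leq_trans lu; rewrite (len_gens (youngGens_gens hs) hd).
Qed.

Lemma TuP l h : (forall s, s \in youngGens l -> T s * h = mv *: h) ->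
  forall u, u \in youngG l -> T u * h = mv ^+ len u *: h.
Proof.
move=> hh; apply: (youngG_ind (l := l)); first by rewrite len1 T1E mul1r scale1r.
move=> s u hs hd _ IH; have hg := youngGens_gens hs.
rewrite (T_down R hg hd) -mulrA IH ZMr hh // scalerA (len_gens hg hd) exprS.
by rewrite mulrC.
Qed.

Lemma flatP l h : (forall s, s \in youngGens l -> h * T s = mv *: h) ->
  forall s, s \in youngGens l -> T s * flat h = mv *: flat h.
Proof.
move=> hh s hs; have hg := youngGens_gens hs.
by rewrite -[T s]flatTs // -flatM hh // flatZ.
Qed.

(** The Poincare polynomial of $\mathfrak S_l$ at $v^{-2}$, the scalar by which $e_l$ acts on sign
    eigenvectors. *)
Definition Poin l : K := \sum_(u in youngG l) (mv ^+ len u) ^+ 2.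

Lemma E_mulP l h : (forall s, s \in youngGens l -> T s * h = mv *: h) -> E l * h = Poin l *: h.
Proof.
move=> hh; rewrite (EsumE l) mulr_suml /Poin scaler_suml; apply: eq_bigr => u hu.
by rewrite ZMl (TuP hh) // scalerA expr2.
Qed.

Lemma P_mulE l h : (forall s, s \in youngGens l -> h * T s = mv *: h) -> h * E l = Poin l *: h.
Proof.
move=> hh; have := E_mulP (flatP hh) => /(congr1 (@flat R n)).
by rewrite flatM flatK flatE_l flatZ flatK.
Qed.

Lemma E_C l y : decblk l y -> E l * C y = Poin l *: C y.
Proof.
move=> /decblkP hy; apply: E_mulP => s hs.
by rewrite TsC_down ?hy // (youngGens_gens hs).
Qed.

Lemma Nm_E l z y : Nm (E l) z y != 0 -> decblk l z.
Proof.
move=> nz; apply/decblkP => s hs; apply: (@cc_supp _ _ s (E l * C y)) => //.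
  exact: youngGens_gens hs.
by rewrite mulrA TsE_l // ZMl.
Qed.

(** The term of [u] becomes $v^{2(a(l)-l(u))}$, so [N] counts the elements of maximal length
    $a(l)$. *)
Lemma Poin_reg0 l : exists N : nat, (0 < N)%N /\ reg0 (v ^+ (2 * aL l) * Poin l) (N%:R : R).
Proof.
exists #|[set u in youngG l | len u == aL l]|; split.
  have [u hu e] := eq_bigmax_cond (@len n) (introT card_gt0P (ex_intro _ 1%g (group1 [group of youngG l]))).
  by apply/card_gt0P; exists u; rewrite inE hu /aL e eqxx.
rewrite -sum1_card natr_sum mulr_sumr.
rewrite [X in reg0 _ X](eq_bigl (fun u => (u \in youngG l) && (len u == aL l))); last by move=> u; rewrite inE.
rewrite [X in reg0 _ X]big_mkcondr /=; apply: reg0_sum => u hu.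
have le : (len u <= aL l)%N by rewrite /aL; apply: (@leq_bigmax_cond _ _ _ u).
have -> : v ^+ (2 * aL l) * (mv ^+ len u) ^+ 2 = v ^+ (2 * (aL l - len u)).
  rewrite mulnBr exprAC sqrrN exprVn exprVn -exprM.
  have -> : v ^+ (2 * aL l) = v ^+ (2 * aL l - 2 * len u) * v ^+ (2 * len u).
    by rewrite -exprD subnK // leq_mul2l le.
  by rewrite mulfK // expf_neq0 // v_neq0.
case: eqP => [->|/eqP ne]; first by rewrite subnn muln0; exact: reg0_1.
have := reg0X (2 * (aL l - len u)) (reg0_v R); rewrite expr0n.
have -> : (2 * (aL l - len u) == 0)%N = false by apply/negbTE; move: ne le; lia.
by [].
Qed.

Lemma Poin_neq0 l : Poin l != 0.
Proof.
apply/eqP => e; have [N [N0 h]] := Poin_reg0 l; rewrite e mulr0 in h.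
by have /esym/eqP := reg0_uniq (reg0_0 R) h; rewrite pnatr_eq0 => /eqP e'; rewrite e' in N0.
Qed.

Lemma trace_basis (f : H -> H) : linP f -> \sum_w (f (T w) w : K) = \sum_y cc (f (C y)) y.
Proof.
move=> lf; transitivity (\sum_w \sum_y cc (T w) y * (f (C y) w : K)).
  apply: eq_bigr => w _; rewrite {1}[T w]ccE linsum // hsum; apply: eq_bigr => y _.
  by rewrite linZ // hZ.
rewrite exchange_big /=; apply: eq_bigr => y _.
by rewrite [RHS]cc_expand; apply: eq_bigr => w _; rewrite mulrC.
Qed.

Lemma coef_P l h : (forall s, s \in youngGens l -> h * T s = mv *: h) ->
  forall d u, d \in minReps l -> u \in youngG l -> h (d * u)%g = mv ^+ len u * h d :> K.
Proof.
move=> hh d u hd hu.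
(* The induction peels generators off the left of [u], while the relation acts at the right end of
   $d\,u$; hence the passage to $u^{-1}$. *)
suff aux : forall u, u \in youngG l -> h (d * u^-1)%g = mv ^+ len u * h d :> K.
  by have := aux u^-1%g; rewrite invgK lenV groupV => /(_ hu).
apply: (youngG_ind (l := l)) => {u hu}; first by rewrite invg1 mulg1 len1 mul1r.
move=> s u hs hd' hu IH; have hg := youngGens_gens hs.
have hus : (s * u)%g \in youngG l by rewrite groupM // youngGensG.
have e : (d * (s * u)^-1 * s)%g = (d * u^-1)%g by rewrite invMg (gens_inv hg) mulgA gens_mulKr.
have nd : dr s (d * (s * u)^-1)%g = false.
  rewrite /dr e !(len_min_mul hd) ?groupV // !lenV (len_gens hg hd').
  by apply/negbTE; rewrite -leqNgt leq_add2l.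
have := hh s hs => /(congr1 (fun h : H => h (d * (s * u)^-1)%g : K)).
rewrite MTs // hZ nd !mul0r addr0 e IH => ->.
by rewrite (len_gens hg hd') exprS mulrA.
Qed.

(* Both sides, multiplied by the Poincare polynomial, are the trace of k |-> h k E_l on the Hecke algebra,
   computed in the basis T_w and in the basis C_w. *)
Lemma IndSignE l h : IndSign l h = \sum_(y | [forall s in youngGens l, dr s y]) Nm h y y.
Proof.
apply: (mulfI (Poin_neq0 l)).
pose f k := h * k * E l.
have lf : linP f by move=> a k k'; rewrite /f mulrDr ZMr mulrDl ZMl.
have fP k s : s \in youngGens l -> f k * T s = mv *: f k.
  by move=> hs; rewrite /f -mulrA ETs // ZMr.
transitivity (\sum_w (f (T w) w : K)); last first.
  rewrite trace_basis // mulr_sumr [RHS]big_mkcond /=; apply: eq_bigr => y _.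
  case: ifP => [/forall_inP hy|/negbT hy].
    rewrite /f -mulrA P_mulE ?ZMr ?ccZ // => s hs.
    by rewrite CTs_down ?hy // (youngGens_gens hs).
  apply/eqP; apply: contraR hy => nz; apply/forall_inP => s hs.
  by apply: (@cc_suppr _ _ s (f (C y))) => //; [exact: youngGens_gens hs|exact: fP].
rewrite (sum_decomp l) /IndSign mulr_sumr; apply: eq_bigr => d hd.
have -> : Poin l * (\sum_(u in youngG l) hmul h (Defs.T R d) (d * u)%g * (sgnK R u * v ^- len u)) =
          Poin l * (f (T d) d : K).
  congr (_ * _); rewrite /f hmulE; set k : H := h * T d.
  (* $T_{d'u}e_l=(-v^{-1})^{l(u)}T_{d'}e_l$ is supported on the coset of $d'$ and $T_{d'}e_l$ has
     coefficient 1 at $d'$; at [d] only $d'=d$ contributes. *)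
  rewrite [k in RHS]hexp mulr_suml hsum (sum_decomp l) [RHS](bigD1 d) //= [X in _ + X]big1 ?addr0.
    apply: eq_bigr => u hu; rewrite ZMl hZ -T_mul ?(len_min_mul hd) //.
    rewrite -mulrA (TuP (@TsE_l l)) // ZMr hZ (EsumE l) mulr_sumr hsum.
    rewrite (bigD1 1%g) ?group1 //= ZMr hZ T1E mulr1 TE eqxx len1 mulr1 big1 ?addr0.
      by rewrite mulr1 /sgnK -exprVn -exprMn mulN1r.
    move=> u' /andP [hu' u'1]; rewrite ZMr hZ T_mul ?(len_min_mul hd) // TE.
    case: eqP => [e|]; last by rewrite mulr0.
    by case/eqP: u'1; apply: (@mulgI _ d); rewrite -e mulg1.
  move=> d' /andP [hd' ne]; apply: big1 => u hu; rewrite ZMl hZ -T_mul ?(len_min_mul hd') //.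
  rewrite -mulrA (TuP (@TsE_l l)) // ZMr hZ (EsumE l) mulr_sumr hsum big1 ?mulr0 //.
  move=> u' hu'; rewrite ZMr hZ T_mul ?(len_min_mul hd') // TE.
  case: eqP => [e|]; last by rewrite mulr0.
  case/eqP: ne; have := @min_decomp_uniq _ l d d' 1%g u' hd hd' (group1 [group of youngG l]) hu'.
  by rewrite mulg1 => /(_ e) [].
(* One factor $(-v^{-1})^{l(u)}$ comes from $T_{du}e_l$, the other from reading the right
   eigenvector $f(T_d)$ at $du$. *)
rewrite /Poin mulr_suml; apply: eq_bigr => u hu.
have -> : f (T (d * u)%g) = mv ^+ len u *: f (T d).
  rewrite /f -T_mul ?(len_min_mul hd) // mulrA -mulrA (TuP (@TsE_l l)) // ZMr.
  by rewrite -mulrA.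
by rewrite hZ (coef_P (fP (T d)) hd hu) mulrA expr2.
Qed.

End Esgn.

(** * Representations and characters *)

Lemma mulmx1C_eq (F : fieldType) (p d : nat) (A : 'M[F]_(p, d)) (B : 'M[F]_(d, p)) :
  p = d -> A *m B = 1%:M -> B *m A = 1%:M.
Proof. by move=> e; case: d / e A B => A B; exact: mulmx1C. Qed.

(* Coordinates adapted to a submodule: B spans it and D' spans its annihilator. *)
Lemma split_rows (F : fieldType) (d : nat) (U : 'M[F]_d) :
  exists e (B : 'M[F]_(\rank U, d)) (B' : 'M[F]_(d, \rank U)) (D : 'M[F]_(e, d)) (D' : 'M[F]_(d, e)),
  [/\ (\rank U + e)%N = d, B *m B' = 1%:M, D *m D' = 1%:M, B' *m B + D' *m D = 1%:M &
      forall N : 'M[F]_d, (U *m N <= U)%MS -> B *m N *m D' = 0].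
Proof.
pose B := row_base U; pose B' := pinvmx B.
pose D' := col_base (cokermx U); pose D0 := pinvmx D'.
have BB' : B *m B' = 1%:M by rewrite mulmxVp // row_base_free.
have DD0 : D0 *m D' = 1%:M by rewrite mulVpmx // col_base_full.
have UD' : U *m D' = 0.
  have fr : row_free (row_base (cokermx U)) := row_base_free _.
  by apply: (row_free_inj fr); rewrite mul0mx -mulmxA mulmx_base mulmx_coker.
have BD' : B *m D' = 0.
  have /submxP [Z ->] : (B <= U)%MS by rewrite eq_row_base.
  by rewrite -mulmxA UD' mulmx0.
(* The one-sided inverse [D0] of [D'] is corrected so that also $DB'=0$, which makes the two block
   matrices inverse to each other. *)
pose D := D0 *m (1%:M - B' *m B).
have DB' : D *m B' = 0 by rewrite -mulmxA mulmxBl mul1mx -[B' *m B *m B']mulmxA BB' mulmx1 subrr mulmx0.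
have DD' : D *m D' = 1%:M by rewrite -mulmxA mulmxBl mul1mx -[B' *m B *m D']mulmxA BD' mulmx0 subr0.
exists (\rank (cokermx U)), B, B', D, D'.
have rk : (\rank U + \rank (cokermx U))%N = d by rewrite mxrank_coker subnKC // rank_leq_row.
split=> //.
  have := @mulmx1C_eq F _ _ (col_mx B D) (row_mx B' D') rk.
  rewrite mul_col_row BB' BD' DB' DD' -scalar_mx_block => /(_ erefl).
  by rewrite mul_row_col.
move=> N UN; have /submxP [Z ->] : (B *m N <= U)%MS.
  by apply: submx_trans UN; apply: submxMr; rewrite eq_row_base.
by rewrite -mulmxA UD' mulmx0.
Qed.

Section Compression.
Variables (F : fieldType) (p q d : nat).
Variables (B : 'M[F]_(p, d)) (B' : 'M[F]_(d, p)) (D : 'M[F]_(q, d)) (D' : 'M[F]_(d, q)).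
Hypothesis dec : B' *m B + D' *m D = 1%:M.

Lemma compress_sub (Y Z : 'M[F]_d) : B *m Y *m D' = 0 ->
  B *m (Y *m Z) *m B' = (B *m Y *m B') *m (B *m Z *m B').
Proof.
move=> h; rewrite -[Y]mulmx1 -{1}dec mulmx1 mulmxDr mulmxDl mulmxDr mulmxDl !mulmxA h.
by rewrite !mul0mx addr0.
Qed.

Lemma compress_quo (Y Z : 'M[F]_d) : B *m Z *m D' = 0 ->
  D *m (Y *m Z) *m D' = (D *m Y *m D') *m (D *m Z *m D').
Proof.
move=> h; rewrite -[Y]mulmx1 -{1}dec mulmx1 mulmxDr mulmxDl mulmxDr mulmxDl.
have -> : D *m (Y *m (B' *m B) *m Z) *m D' = D *m Y *m B' *m (B *m Z *m D') by rewrite !mulmxA.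
by rewrite h mulmx0 add0r !mulmxA.
Qed.

End Compression.

Section Rep.
Variables (R : realType) (n : nat).
Local Notation K := (K R).
Local Notation W := (W n).
Local Notation H := (hecke R n).
Local Notation gens := (gens n).
Local Notation T := (@T R n : W -> H).
Implicit Types (s t w x y : W) (h k : H).

Definition rX d (X : W -> 'M[K]_d) (h : H) : 'M[K]_d := reprX X h.

Section OneRep.
Variables (d : nat) (X : W -> 'M[K]_d).
Lemma rXE h : rX X h = \sum_w (h w : K) *: X w. Proof. by []. Qed.
Lemma rXD h k : rX X (h + k) = rX X h + rX X k.
Proof. by rewrite !rXE -big_split; apply: eq_bigr => w _ /=; rewrite hD scalerDl. Qed.
Lemma rXZ (a : K) h : rX X (a *: h) = a *: rX X h.
Proof. by rewrite !rXE scaler_sumr; apply: eq_bigr => w _; rewrite hZ scalerA. Qed.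
Lemma rX0 : rX X 0 = 0.
Proof. by rewrite -(scale0r (0 : H)) rXZ scale0r. Qed.
Lemma rX_sum (I : Type) (r : seq I) (P : pred I) (F : I -> H) :
  rX X (\sum_(i <- r | P i) F i) = \sum_(i <- r | P i) rX X (F i).
Proof. exact: (big_morph (rX X) rXD rX0). Qed.
Lemma rXT w : rX X (T w) = X w.
Proof.
rewrite rXE (bigD1 w) //= TE eqxx scale1r big1 ?addr0 // => x /negPf ne.
by rewrite TE ne scale0r.
Qed.
Hypothesis repX : isRep X.
Lemma rX1 : rX X 1 = 1%:M.
Proof. by rewrite -T1E; case: repX. Qed.
Lemma rXM h k : rX X (h * k) = rX X h *m rX X k.
Proof. by rewrite -hmulE; case: repX => _; apply. Qed.
End OneRep.

Lemma isRep_fun d (N : H -> 'M[K]_d) : (forall h k, N (h + k) = N h + N k) ->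
  (forall (a : K) h, N (a *: h) = a *: N h) -> N 1 = 1%:M -> (forall h k, N (h * k) = N h *m N k) ->
  isRep (fun w => N (T w)) /\ forall h, rX (fun w => N (T w)) h = N h.
Proof.
move=> ND NZ N1 NM; have e h : rX (fun w => N (T w)) h = N h.
  have N0 : N 0 = 0 by rewrite -(scale0r (0 : H)) NZ scale0r.
  rewrite {2}[h]hexp (big_morph N ND N0) rXE.
  by apply: eq_bigr => w _; rewrite NZ.
split=> //; split; first by rewrite -[reprX _ _]/(rX _ _) e T1E.
by move=> h k; rewrite -![reprX _ _]/(rX _ _) !e hmulE NM.
Qed.

Definition intertw d e (X : W -> 'M[K]_d) (Y : W -> 'M[K]_e) (M : 'M[K]_(d, e)) :=
  forall h, rX X h *m M = M *m rX Y h.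

Lemma schur d e (X : W -> 'M[K]_d) (Y : W -> 'M[K]_e) M : irrRep X -> irrRep Y ->
  intertw X Y M -> M != 0 -> exists M', M *m M' = 1%:M /\ M' *m M = 1%:M.
Proof.
move=> [_ iX] [_ iY] IM nz; have IMw w : X w *m M = M *m Y w by have := IM (T w); rewrite !rXT.
have fr : row_free M.
  have hk w : (kermx M *m X w <= kermx M)%MS.
    by apply/sub_kermxP; rewrite -mulmxA IMw mulmxA mulmx_ker mul0mx.
  rewrite -kermx_eq0; have /orP [//|full] := iX _ hk.
  have /submxP [Z e1] : (1%:M <= kermx M)%MS by rewrite sub1mx.
  by case/negP: nz; rewrite -[M]mul1mx e1 -mulmxA mulmx_ker mulmx0.
have fl : row_full M.
  have : (<<M>>%MS == 0) || row_full <<M>>%MS.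
    by apply: iY => w; rewrite (eqmxMr _ (genmxE M)) genmxE -IMw submxMl.
  by rewrite -mxrank_eq0 /row_full genmxE mxrank_eq0 (negPf nz).
exists (pinvmx M); split; [exact: mulmxVp|exact: mulVpmx].
Qed.

Lemma intertw_tr d e (X : W -> 'M[K]_d) (Y : W -> 'M[K]_e) M M' :
  intertw X Y M -> M *m M' = 1%:M -> M' *m M = 1%:M -> forall h, \tr (rX X h) = \tr (rX Y h).
Proof.
move=> IM e1 e2 h; rewrite -[rX X h]mulmx1 -e1 mulmxA IM -mulmxA mxtrace_mulC -mulmxA e2.
by rewrite mulmx1.
Qed.

Definition casimir d e (X : W -> 'M[K]_d) (Y : W -> 'M[K]_e) (f : 'M[K]_(d, e)) :=
  \sum_w X w *m f *m Y w^-1%g.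

(** $T_w$ and $T_{w^{-1}}$ are dual bases for the trace form. Concretely, for a generator the
    substitution $w\mapsto sw$ matches the main terms and the quadratic terms agree. *)
Lemma casimirP d e (X : W -> 'M[K]_d) (Y : W -> 'M[K]_e) f : isRep X -> isRep Y ->
  intertw X Y (casimir X Y f).
Proof.
move=> rx ry; elim/gens_ind => [|h k IH IH'|a h IH|s h hs IH].
- by rewrite !rX1 // mul1mx mulmx1.
- by rewrite !rXD mulmxDl mulmxDr IH IH'.
- by rewrite !rXZ -scalemxAl -scalemxAr IH.
rewrite !rXM // -mulmxA IH !mulmxA; congr (_ *m _).
rewrite !rXT /casimir mulmx_sumr mulmx_suml.
have eX w : X s *m X w = X (s * w)%g + ((dl s w)%:R * (vK R - (vK R)^-1)) *: X w.
  by rewrite -!(rXT X) -rXM // T_TsM // rXD rXZ.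
have eY w : Y w^-1%g *m Y s = Y (s * w)^-1%g + ((dl s w)%:R * (vK R - (vK R)^-1)) *: Y w^-1%g.
  by rewrite -!(rXT Y) -rXM // hM_Ts // Rop_T // rXD rXZ dr_dl // invgK invMg (gens_inv hs).
under eq_bigr => w _ do rewrite !mulmxA eX !mulmxDl -!scalemxAl.
under [RHS]eq_bigr => w _ do rewrite -mulmxA eY mulmxDr -scalemxAr.
rewrite !big_split; apply: congr2; last by apply: eq_bigr.
rewrite (reindex_inj (mulgI s)) /=; apply: eq_bigr => w _.
by rewrite gens_mulK.
Qed.

Lemma casimir_delta d e (X : W -> 'M[K]_d) (Y : W -> 'M[K]_e) (i j : 'I_d) (k l : 'I_e) :
  casimir X Y (delta_mx j k) i l = \sum_w X w i j * Y w^-1%g k l.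
Proof.
rewrite /casimir summxE; apply: eq_bigr => w _.
rewrite mxE (bigD1 k) //= big1 ?addr0 => [|k' ne].
  rewrite mxE (bigD1 j) //= big1 ?addr0 => [|j' ne]; first by rewrite mxE !eqxx mulr1.
  by rewrite mxE (negPf ne) mulr0.
rewrite mxE big1 ?mul0r // => j' _.
by rewrite mxE (negPf ne) andbF mulr0.
Qed.

Definition chr d (X : W -> 'M[K]_d) h : K := \tr (rX X h).

(* Schur's orthogonality without splitness: a nonzero sum only produces a nonzero intertwiner. *)
Lemma chr_orth d e (X : W -> 'M[K]_d) (Y : W -> 'M[K]_e) :
  isRep X -> isRep Y -> irrRep X -> irrRep Y ->
  \sum_w chr X (T w) * chr Y (T w^-1%g) != 0 ->
  exists M M', [/\ intertw X Y M, M *m M' = 1%:M & M' *m M = 1%:M].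
Proof.
move=> rx ry ix iy nz.
have [[M [IM M0]]|none] := excluded_middle_informative (exists M, intertw X Y M /\ M != 0).
  by have [M' [e1 e2]] := schur ix iy IM M0; exists M, M'.
case/negP: nz; apply/eqP.
transitivity (\sum_i \sum_k casimir X Y (delta_mx i k) i k).
  rewrite /chr; under eq_bigr => w _ do rewrite !rXT /mxtrace mulr_suml.
  rewrite exchange_big; apply: eq_bigr => i _ /=.
  under eq_bigr => w _ do rewrite mulr_sumr.
  by rewrite exchange_big; apply: eq_bigr => k _ /=; rewrite casimir_delta.
rewrite big1 // => i _; rewrite big1 // => k _.
have [-> |c0] := eqVneq (casimir X Y (delta_mx i k)) 0; first by rewrite mxE.
by case: none; exists (casimir X Y (delta_mx i k)); split; [exact: casimirP|].
Qed.

Lemma chr_orth_eq d e (X : W -> 'M[K]_d) (Y : W -> 'M[K]_e) :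
  isRep X -> isRep Y -> irrRep X -> irrRep Y ->
  (exists h, chr X h <> chr Y h) -> \sum_w chr X (T w) * chr Y (T w^-1%g) = 0.
Proof.
move=> rx ry ix iy [h ne]; apply/eqP; apply: contraT => /(chr_orth rx ry ix iy) [M [M' [IM e1 e2]]].
by case: ne; apply: intertw_tr IM e1 e2 h.
Qed.

(** The two pieces are the submodule and the quotient. The last clause is what later transfers the
    vanishing of $e_m$ from a cell module to its constituents. *)
Lemma rep_reducible d (X : W -> 'M[K]_d) : isRep X -> (0 < d)%N -> ~ irrRep X ->
  exists d1 d2 (A : W -> 'M[K]_d1) (B : W -> 'M[K]_d2),
  [/\ (0 < d1 < d)%N /\ (0 < d2 < d)%N, isRep A /\ isRep B, forall h, chr X h = chr A h + chr B h &
      forall h, rX X h = 0 -> rX A h = 0 /\ rX B h = 0].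
Proof.
move=> rx d0 nirr.
have [U [invU [U0 Uf]]] : exists U : 'M[K]_d, (forall w, (U *m X w <= U)%MS) /\ U != 0 /\ ~~ row_full U.
  have [//|no] := excluded_middle_informative (exists U : 'M[K]_d, (forall w, (U *m X w <= U)%MS) /\ U != 0 /\ ~~ row_full U).
  case: nirr; split=> // U hU; apply: contraT; rewrite negb_or => /andP [h1 h2].
  by case: no; exists U.
have [e [B [B' [D [D' [rk BB DD dec inv]]]]]] := split_rows U.
have invh h : (U *m rX X h <= U)%MS.
  rewrite rXE mulmx_sumr; apply: summx_sub => w _.
  by rewrite -scalemxAr; apply: scalemx_sub.
have BD' h : B *m rX X h *m D' = 0 by apply: inv.
have BD0 : B *m D' = 0 by have := BD' 1; rewrite rX1 // mulmx1.
have sub1 : (0 < \rank U)%N by rewrite lt0n mxrank_eq0.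
have e0 : (0 < e)%N.
  by have : \rank U != d := Uf; move: (\rank U) rk => r rk; lia.
pose NA h := B *m rX X h *m B'; pose NB h := D *m rX X h *m D'.
have [rA eA] : isRep (fun w => NA (T w)) /\ forall h, rX (fun w => NA (T w)) h = NA h.
  apply: isRep_fun.
  - by move=> h k; rewrite /NA rXD mulmxDr mulmxDl.
  - by move=> a h; rewrite /NA rXZ -scalemxAr -scalemxAl.
  - by rewrite /NA rX1 // mulmx1.
  by move=> h k; rewrite /NA rXM // (compress_sub dec _ (BD' h)).
have [rB eB] : isRep (fun w => NB (T w)) /\ forall h, rX (fun w => NB (T w)) h = NB h.
  apply: isRep_fun.
  - by move=> h k; rewrite /NB rXD mulmxDr mulmxDl.
  - by move=> a h; rewrite /NB rXZ -scalemxAr -scalemxAl.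
  - by rewrite /NB rX1 // mulmx1.
  by move=> h k; rewrite /NB rXM // (compress_quo dec _ (BD' k)).
exists (\rank U), e, (fun w => NA (T w)), (fun w => NB (T w)); split=> //.
- by move: (\rank U) sub1 rk {B B' D D' BB DD dec inv BD' BD0 NA NB rA eA rB eB} => r; lia.
- move=> h; rewrite /chr eA eB -[rX X h]mulmx1 -dec mulmxDr mxtraceD !mulmxA.
  by rewrite mxtrace_mulC mulmxA; congr (_ + _); rewrite mxtrace_mulC mulmxA.
by move=> h h0; rewrite eA eB /NA /NB h0 !mulmx0 !mul0mx.
Qed.

End Rep.

(** * Linear independence of the irreducible characters and multiplicities of constituents *)

Section Constituents.
Variables (R : realType) (n : nat).
Local Notation K := (K R).
Local Notation W := (W n).
Local Notation H := (hecke R n).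
Local Notation T := (@T R n : W -> H).
Variables (chi : Lam n -> HK R n -> K) (dd : Lam n -> nat) (X : forall l, W -> 'M[K]_(dd l)).
Hypothesis Hirr : forall l, irrChar (chi l).
Hypothesis Hinj : forall l m, (forall h, chi l h = chi m h) -> l = m.
Hypothesis Hall : forall psi : HK R n -> K, irrChar psi -> exists l, forall h, psi h = chi l h.
Hypothesis HXrep : forall l, isRep (X l).
Hypothesis HXaff : forall l, affords (X l) (chi l).
Hypothesis Hsym : forall l w, chi l (T w^-1%g) = chi l (T w).
Implicit Types (l m : Lam n) (h k : H) (w : W).

Lemma chi_chr l h : chi l h = chr (X l) h.
Proof. exact: HXaff. Qed.

Lemma irr_model l : exists e (Y : W -> 'M[K]_e), [/\ isRep Y, irrRep Y & forall h, chr Y h = chi l h].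
Proof. by have [e [Y [h1 [h2 h3]]]] := Hirr l; exists e, Y; split=> // h; rewrite h3. Qed.

Definition zel l : H := \sum_w chi l (T w^-1%g) *: T w.

Lemma chi_zel l m : chi m (zel l) = \sum_w chi l (T w^-1%g) * chi m (T w).
Proof.
rewrite chi_chr /chr rX_sum raddf_sum; apply: eq_bigr => w _ /=.
by rewrite rXZ mxtraceZ -[\tr _]/(chr _ _) -chi_chr.
Qed.

Lemma chi_zel_neq l m : l <> m -> chi m (zel l) = 0.
Proof.
move=> ne; have [e [Y [rY iY cY]]] := irr_model l; have [e' [Y' [rY' iY' cY']]] := irr_model m.
rewrite chi_zel; transitivity (\sum_w chr Y' (T w) * chr Y (T w^-1%g)).
  by apply: eq_bigr => w _; rewrite cY cY' mulrC.
apply: chr_orth_eq => //.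
have [//|none] := excluded_middle_informative (exists h, chr Y' h <> chr Y h).
case: ne; apply: Hinj => h; have [//|ne] := excluded_middle_informative (chi l h = chi m h).
by case: none; exists h; rewrite cY cY' => e''; case: ne.
Qed.

Lemma chi1_neq0 l : chi l (1 : H) != 0.
Proof.
have [e [Y [rY [e0 _] cY]]] := irr_model l; rewrite -cY /chr rX1 // mxtrace1 natK_eq0.
by rewrite -lt0n.
Qed.

(** By the symmetry of $\chi_l$ this is a sum of squares in $K$, one of them $\chi_l(T_1)^2\ne0$. *)
Lemma chi_zel_eq l : chi l (zel l) != 0.
Proof.
rewrite chi_zel; apply/eqP => e; case/negP: (chi1_neq0 l); rewrite -T1E; apply/eqP.
apply: (sum_sqr_eq0 (x := fun w => chi l (T w))); rewrite -[RHS]e.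
by apply: eq_bigr => w _; rewrite Hsym expr2.
Qed.

Lemma chi_indep (a : Lam n -> K) : (forall h, \sum_l a l * chi l h = 0) -> forall l, a l = 0.
Proof.
move=> e l; have := e (zel l); rewrite (bigD1 l) //= big1 ?addr0 => [/eqP|m ne].
  by rewrite mulf_eq0 (negPf (chi_zel_eq l)) orbF => /eqP.
by rewrite chi_zel_neq ?mulr0 //; apply/eqP; rewrite eq_sym.
Qed.

Lemma chi_indep_nat (a b : Lam n -> nat) :
  (forall h, \sum_l (a l)%:R * chi l h = \sum_l (b l)%:R * chi l h) -> a =1 b.
Proof.
move=> e l; have := @chi_indep (fun l => (a l)%:R - (b l)%:R) _ l.
have h0 h : \sum_l ((a l)%:R - (b l)%:R) * chi l h = 0.
  by under eq_bigr => m _ do rewrite mulrBl; rewrite sumrB e subrr.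
move=> /(_ h0) /eqP; rewrite subr_eq0 => /eqP ab.
have ra := reg0_nat R (a l); rewrite ab in ra.
by have /eqP := reg0_uniq ra (reg0_nat R (b l)); rewrite eqr_nat => /eqP.
Qed.

Lemma constituents_aux d (N : W -> 'M[K]_d) : isRep N -> exists m : Lam n -> nat,
  [/\ forall h, chr N h = \sum_l (m l)%:R * chi l h,
      forall l, (0 < m l)%N -> exists e (Y : W -> 'M[K]_e),
        [/\ isRep Y, irrRep Y, forall h, chr Y h = chi l h & forall h, rX N h = 0 -> rX Y h = 0] &
      (0 < d)%N -> (0 < \sum_l m l)%N].
Proof.
have [b] := ubnP d; elim: b d N => // b IH d N; rewrite ltnS => db rN.
case: (posnP d) => [d0|d0].
  exists (fun=> 0%N); split=> [h|//|]; last by move=> dp; exfalso; lia.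
  rewrite big1 => [|l _]; last by rewrite mul0r.
  by rewrite /chr /mxtrace big1 // => i; have := ltn_ord i; lia.
have [iN|nN] := excluded_middle_informative (irrRep N).
  have [l hl] := Hall (psi := chr N) (ex_intro _ d (ex_intro _ N (conj rN (conj iN (fun h => erefl))))).
  exists (fun m => (m == l) : nat); split.
  - move=> h; rewrite hl (bigD1 l) //= eqxx mul1r big1 ?addr0 // => m /negPf ->.
    by rewrite mul0r.
  - by move=> m; case: eqP => // -> _; exists d, N.
  by move=> _; rewrite (bigD1 l) //= eqxx.
have [d1 [d2 [A [B [[/andP [a0 ad] /andP [b0 bd]] [rA rB] cAB kAB]]]]] := rep_reducible rN d0 nN.
have [mA [cA kA pA]] := IH _ A (leq_trans ad db) rA.
have [mB [cB kB pB]] := IH _ B (leq_trans bd db) rB.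
exists (fun l => (mA l + mB l)%N); split.
- move=> h; rewrite cAB cA cB -big_split; apply: eq_bigr => l _ /=.
  by rewrite natrD mulrDl.
- move=> l; rewrite addn_gt0 => /orP [/kA|/kB] [e [Y [h1 h2 h3 h4]]]; exists e, Y; split=> // h /kAB [e1 e2];
    exact: h4.
by move=> _; rewrite big_split addn_gt0 pA.
Qed.

(** A proper submodule and its quotient would contribute at least two constituents, but by
    independence the total multiplicity is 1. *)
Lemma irr_of_chr d (N : W -> 'M[K]_d) l : isRep N -> (forall h, chr N h = chi l h) -> irrRep N.
Proof.
move=> rN cN; have d0 : (0 < d)%N.
  have := chi1_neq0 l; rewrite -cN /chr rX1 // mxtrace1 natK_eq0.
  by rewrite -lt0n.
have [//|nN] := excluded_middle_informative (irrRep N).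
have [d1 [d2 [A [B [[/andP [a0 ad] /andP [b0 bd]] [rA rB] cAB kAB]]]]] := rep_reducible rN d0 nN.
have [mA [cA kA pA]] := constituents_aux rA; have [mB [cB kB pB]] := constituents_aux rB.
have E : (fun m => (mA m + mB m)%N) =1 (fun m => (m == l) : nat).
  apply: chi_indep_nat => h; rewrite [RHS](bigD1 l) //= eqxx mul1r [X in _ + X]big1 ?addr0 => [|m /negPf ->].
    by rewrite -cN cAB cA cB -big_split; apply: eq_bigr => m _ /=; rewrite natrD mulrDl.
  by rewrite mul0r.
have := pA a0; have := pB b0.
have : (\sum_m mA m + \sum_m mB m = 1)%N.
  rewrite -big_split /= (eq_bigr _ (fun m _ => E m)) (bigD1 l) //= eqxx big1 // => m /negPf ->.
  by [].
lia.
Qed.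

Lemma irrX l : irrRep (X l).
Proof. by apply: (irr_of_chr (l := l)) => // h; rewrite chi_chr. Qed.

(** The orthogonality sum is $\chi_l(z_l)\ne0$, so [chr_orth] yields an invertible intertwiner. *)
Lemma iso_of_chr d (N : W -> 'M[K]_d) l : isRep N -> (forall h, chr N h = chi l h) ->
  exists M M', [/\ intertw (X l) N M, M *m M' = 1%:M & M' *m M = 1%:M].
Proof.
move=> rN cN; apply: chr_orth => //; [exact: irrX|exact: irr_of_chr cN|].
have := chi_zel_eq l; rewrite chi_zel; congr (_ != 0).
by apply: eq_bigr => w _; rewrite cN -chi_chr mulrC.
Qed.

Lemma constituents d (N : W -> 'M[K]_d) : isRep N -> exists m : Lam n -> nat,
  [/\ forall h, chr N h = \sum_l (m l)%:R * chi l h &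
      forall l, (0 < m l)%N -> forall h, rX N h = 0 -> rX (X l) h = 0].
Proof.
move=> rN; have [m [h1 h2 _]] := constituents_aux rN; exists m; split=> // l /h2 [e [Y [rY iY cY kY]]] h /kY h0.
have [M [M' [IM e1 e2]]] := iso_of_chr rY cY.
by rewrite -[rX (X l) h]mulmx1 -e1 mulmxA IM h0 mulmx0 mul0mx.
Qed.

End Constituents.

(** * Characters of the left cell modules *)

Section CellModule.
Variables (R : realType) (n : nat).
Local Notation K := (K R).
Local Notation W := (W n).
Local Notation H := (hecke R n).
Local Notation T := (@T R n : W -> H).
Local Notation cell := (@cell R n).
Local Notation cell_iso := (@cell_iso R n).
Implicit Types (s t w x y z : W) (h k : H) (l m : Lam n).

Definition cellM x h : 'M[K]_#|cell x| := \matrix_(i, j) Nm h (enum_val i) (enum_val j).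
Definition cellX x w := cellM x (T w).

Lemma cellP x y : y \in cell x -> cell y = cell x.
Proof. by move=> hy; apply/cell_eq; move: hy; rewrite inE. Qed.

(** An intermediate [u] with nonzero contribution satisfies $a\le_{\mathcal L}u\le_{\mathcal L}b$,
    so it lies in the cell. *)
Lemma Nm_cell x a b h k : a \in cell x -> b \in cell x ->
  Nm (h * k) a b = \sum_(u in cell x) Nm h a u * Nm k u b.
Proof.
move=> ha hb; rewrite NmM [RHS]big_mkcond /=; apply: eq_bigr => u _; case: ifPn => // hu.
have [->|nz] := eqVneq (Nm h a u) 0; first by rewrite mul0r.
have [->|nz'] := eqVneq (Nm k u b) 0; first by rewrite mulr0.
have /andP [_ hab] : simL R a b by move: ha; rewrite -(cellP hb) inE.
have hba : leL R b a by move: hb; rewrite -(cellP ha) inE => /andP [].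
case/negP: hu; rewrite -(cellP ha) inE /simL (Nm_leL nz) andbT.
exact: leL_trans (Nm_leL nz') hba.
Qed.

Lemma cell_rep x : isRep (cellX x) /\ forall h, rX (cellX x) h = cellM x h.
Proof.
apply: isRep_fun.
- by move=> h k; apply/matrixP => i j; rewrite !mxE NmD.
- by move=> a h; apply/matrixP => i j; rewrite !mxE NmZ.
- by apply/matrixP => i j; rewrite !mxE Nm1 (inj_eq enum_val_inj).
move=> h k; apply/matrixP => i j; rewrite !mxE (Nm_cell _ _ (enum_valP i) (enum_valP j)).
by rewrite big_enum_val; apply: eq_bigr => u _; rewrite !mxE.
Qed.

Lemma chr_cell x h : chr (cellX x) h = chiCell (cell x) h.
Proof.
rewrite /chr (proj2 (cell_rep x)) chiCellE big_enum_val /mxtrace.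
by apply: eq_bigr => i _; rewrite mxE.
Qed.

Lemma rconn_ind_inv (Q : W -> W -> Prop) : (forall x, Q x x) ->
  (forall x y z, rstep x y -> rconn y z -> Q y z -> Q x z) -> forall x y, rconn x y -> Q x y.
Proof.
move=> h1 h2 x y; rewrite /rconn -{2}[x]invgK -{2}[y]invgK.
elim=> [{}x|{}x {}y z hs hc IH]; first exact: h1.
by apply: h2 IH => //; rewrite /rconn !invgK.
Qed.

Lemma rconn_cell_iso x y : rconn x y -> exists f, cell_iso f x y.
Proof.
elim/rconn_ind_inv => {x y} [x|x y z [s [t [st hx ->]]] _ [g hg]].
  by exists id; apply: cell_iso_id.
by exists (g \o star s t); apply: cell_iso_comp hg; apply: cell_iso_star.
Qed.

Lemma cell_iso_chi f x y : cell_iso f x y ->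
  (forall h, chiCell (cell x) h = chiCell (cell y) h) /\ #|cell x| = #|cell y|.
Proof.
case=> _ fi <- fN; split; last by rewrite card_in_imset.
by move=> h; rewrite !chiCellE big_imset //=; apply: eq_bigr => a ha; rewrite fN.
Qed.

Lemma conn_cell x y : conn x y ->
  (forall h, chiCell (cell x) h = chiCell (cell y) h) /\ #|cell x| = #|cell y|.
Proof.
elim=> {x y} [x y h|x y h|y x z _ [h1 h2] _ [h3 h4]].
- by rewrite (cell_eq (lconn_simL R h)).
- by have [f /cell_iso_chi] := rconn_cell_iso h.
by split=> [h|]; rewrite ?h1 ?h2.
Qed.

End CellModule.

(** * The cell module of $w_l$ affords $\chi_l$ and has only scalar endomorphisms *)

Section CellCharacters.
Variables (R : realType) (n : nat).
Local Notation K := (K R).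
Local Notation W := (W n).
Local Notation H := (hecke R n).
Local Notation T := (@T R n : W -> H).
Local Notation E := (@esgn R n).
Local Notation Poin := (@Poin R n).
Local Notation cell := (@cell R n).
Variables (chi : Lam n -> HK R n -> K) (dd : Lam n -> nat) (X : forall l, W -> 'M[K]_(dd l)).
Hypothesis Hirr : forall l, irrChar (chi l).
Hypothesis Hinj : forall l m, (forall h, chi l h = chi m h) -> l = m.
Hypothesis Hall : forall psi : HK R n -> K, irrChar psi -> exists l, forall h, psi h = chi l h.
Hypothesis HXrep : forall l, isRep (X l).
Hypothesis HXaff : forall l, affords (X l) (chi l).
Hypothesis Hsym : forall l w, chi l (T w^-1%g) = chi l (T w).
Hypothesis Hind : forall l, exists mult : Lam n -> nat, forall h,
  IndSign l h = chi l h + \sum_(mu | domlt l mu) (mult mu)%:R * chi mu h.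
Implicit Types (l m k : Lam n) (h : H) (w x y z : W).

Let indep := chi_indep_nat Hirr Hinj HXaff Hsym.

(** The guard [leftCell R Cl] lets [mult] be chosen as a function on all sets. By the second clause,
    what acts as 0 on the cell acts as 0 on its constituents. *)
Definition is_mult (Cl : {set W}) (mu : Lam n -> nat) := leftCell R Cl ->
  (forall h, chiCell Cl h = \sum_l (mu l)%:R * chi l h) /\
  forall l, (0 < mu l)%N -> forall h, {in Cl &, forall a b, Nm h a b = 0} -> rX (X l) h = 0.

Lemma is_mult_ex (Cl : {set W}) : exists mu, is_mult Cl mu.
Proof.
have [/leftCellP [x ->]|no] := boolP (leftCell R Cl); last by exists (fun=> 0%N) => /(negP no).
have [rx ex] := cell_rep R x.
have [mu [h1 h2]] := constituents Hirr Hinj Hall HXrep HXaff Hsym rx.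
exists mu => _; split=> [h|l hl h h0]; first by rewrite -chr_cell h1.
apply: (h2 l hl); rewrite ex; apply/matrixP => i j; rewrite !mxE.
exact: h0 (enum_valP i) (enum_valP j).
Qed.

Definition mult Cl := projT1 (constructive_indefinite_description _ (is_mult_ex Cl)).

Lemma multP Cl : is_mult Cl (mult Cl).
Proof. exact: (projT2 (constructive_indefinite_description _ (is_mult_ex Cl))). Qed.

Lemma leftCell_cell x : leftCell R (cell x). Proof. by apply/leftCellP; exists x. Qed.

Lemma mult_eq x y : (forall h, chiCell (cell x) h = chiCell (cell y) h) -> mult (cell x) =1 mult (cell y).
Proof.
move=> e; apply: indep => h.
by rewrite -(proj1 (multP (leftCell_cell x))) -(proj1 (multP (leftCell_cell y))) e.
Qed.

Lemma mult_conn x y : conn x y -> mult (cell x) =1 mult (cell y).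
Proof. by move=> /(conn_cell R) [h _]; apply: mult_eq. Qed.

Definition indCells l := [set Cl : {set W} | [exists y, (cell y == Cl) && [forall s in youngGens l, dr s y]]].

Lemma IndSign_cells l h : IndSign l h = \sum_(Cl in indCells l) chiCell Cl h.
Proof.
rewrite IndSignE (partition_big cell (mem (indCells l))) /=; last first.
  by move=> y hy; rewrite inE; apply/existsP; exists y; rewrite eqxx.
apply: eq_bigr => Cl; rewrite inE => /existsP [y /andP [/eqP <- hy]].
rewrite chiCellE; apply: eq_bigl => z; rewrite [in RHS]inE; apply/andP/idP.
  by case=> _ /eqP e; have := mem_cell R z; rewrite e inE.
move=> hz; split; last by apply/eqP/cell_eq.
apply/forall_inP => s hs; rewrite -(simL_dr (youngGens_gens hs) hz).
exact: (forall_inP hy).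
Qed.

Lemma indCells_mult l : exists mu : Lam n -> nat, forall m,
  (\sum_(Cl in indCells l) mult Cl m = (m == l) + domlt l m * mu m)%N.
Proof.
have [mu hmu] := Hind l; exists mu => m.
apply: (@indep (fun m => \sum_(Cl in indCells l) mult Cl m)%N
  (fun m => (m == l) + domlt l m * mu m)%N) => h.
transitivity (IndSign l h).
  rewrite IndSign_cells; under [RHS]eq_bigr => Cl hC.
    have lC : leftCell R Cl.
      by move: hC; rewrite inE => /existsP [y /andP [/eqP <- _]]; apply: leftCell_cell.
    rewrite (proj1 (multP lC)); over.
  by rewrite exchange_big /=; apply: eq_bigr => k _; rewrite natr_sum mulr_suml.
rewrite hmu; under [RHS]eq_bigr => k _ do rewrite natrD mulrDl.
rewrite big_split /=; congr (_ + _).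
  rewrite (bigD1 l) //= eqxx mul1r big1 ?addr0 // => k /negPf ->.
  by rewrite mul0r.
rewrite big_mkcond; apply: eq_bigr => k _; case: domlt; first by rewrite mul1n.
by rewrite mul0n mul0r.
Qed.

Lemma indCells_cell l y : decblk l y^-1%g -> cell y \in indCells l.
Proof.
by move=> /decblkV hy; rewrite inE; apply/existsP; exists y; rewrite eqxx; apply/forall_inP.
Qed.

Lemma mult_domle l m y : decblk l y^-1%g -> (0 < mult (cell y) m)%N -> domle l m.
Proof.
move=> /indCells_cell hy; have [mu /(_ m)] := indCells_mult l.
rewrite (bigD1 (cell y)) //=; case: eqP => [->|_]; first by rewrite domle_refl.
by rewrite /domlt; case: domle => //=; rewrite mul0n; lia.
Qed.

Lemma mult_le1 l y : decblk l y^-1%g -> (mult (cell y) l <= 1)%N.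
Proof.
move=> /indCells_cell hy; have [mu /(_ l)] := indCells_mult l.
by rewrite (bigD1 (cell y)) //= /domlt !eqxx andbF mul0n; lia.
Qed.

Local Notation G l := (cell (wrev l)).

Lemma wrev_decV l : decblk l (wrev l)^-1%g.
Proof. by rewrite wrevV; apply: wrev_dec. Qed.
Arguments wrev_decV : clear implicits.

(** $\chi_l$ occurs in the cell of some [y] with right descents containing $S_l$. If [y] were
    connected to $w_k$ with $k$ strictly above $l$, all constituents of that cell would dominate
    $k$, including $\chi_l$. *)
Lemma mult_wrev_gt0 l : (0 < mult (G l) l)%N.
Proof.
have [y hy yl] : exists2 y, decblk l y^-1%g & (0 < mult (cell y) l)%N.
  have [mu /(_ l)] := indCells_mult l; rewrite eqxx => e.
  have [Cl hC p] : exists2 Cl, Cl \in indCells l & (0 < mult Cl l)%N.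
    have : (\sum_(Cl in indCells l) mult Cl l != 0)%N by rewrite e.
    by rewrite sum_nat_eq0 => /forall_inPn [Cl hC]; rewrite -lt0n; exists Cl.
  move: hC p; rewrite inE => /existsP [y /andP [/eqP <- hy]] p; exists y => //.
  by apply/decblkV => s hs; apply: (forall_inP hy).
case: (lconn_wrev R hy) => [c|[k [lk nlk c]]].
  by rewrite -(cell_eq (lconn_simL R c)).
case: nlk; apply: domle_antisym => //; apply: (mult_domle (wrev_decV k)).
by rewrite -(mult_conn c).
Qed.

Lemma mult_wrev_inj l m : mult (G l) =1 mult (G m) -> l = m.
Proof.
move=> e; apply: domle_antisym.
  by apply: (mult_domle (wrev_decV l)); rewrite e mult_wrev_gt0.
by apply: (mult_domle (wrev_decV m)); rewrite -e mult_wrev_gt0.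
Qed.

(** [y] is connected to some $w_k$ with $m\trianglelefteq k$, and equality of multiplicities forces
    $k=l$. For $m=l$ this leaves only the case of a chain of right star operations. *)
Lemma cell_decblk l m y : y \in G l -> decblk m y -> domle m l /\ (m = l -> rconn y (wrev l)).
Proof.
move=> /cellP yG hy; case: (rconn_wrev R hy) => [c|[k [mk nmk c]]].
  have e : m = l by apply: mult_wrev_inj => k; rewrite -yG (mult_conn (ConnR c)).
  by rewrite -e; split=> //; apply: domle_refl.
have e : k = l by apply: mult_wrev_inj => j; rewrite -yG (mult_conn c).
by rewrite -e; split.
Qed.

Lemma mult_E l m k : (0 < mult (G l) k)%N -> rX (X k) (E m) <> 0 -> domle m l.
Proof.
move=> hk nz; have [//|no] := boolP (domle m l); case: nz.
apply: (proj2 (multP (leftCell_cell (wrev l))) k hk) => a b ha _.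
have [//|nz] := eqVneq (Nm (E m) a b) 0.
by case/negP: no; apply: (proj1 (cell_decblk ha (Nm_E nz))).
Qed.

Definition decblkb l y := [forall s in youngGens l, dl s y].
Lemma decblkbP l y : reflect (decblk l y) (decblkb l y).
Proof. by apply: (iffP forall_inP); rewrite decblkP. Qed.

Lemma Nm_E_diag l y : Nm (E l) y y = (decblkb l y)%:R * Poin l.
Proof.
case: decblkbP => h; first by rewrite /Nm E_C // ccZ ccC eqxx mulr1 mul1r.
rewrite mul0r; have [//|nz] := eqVneq (Nm (E l) y y) 0.
by case: h; apply: Nm_E nz.
Qed.

Lemma chiCell_E l : chiCell (G l) (E l) = #|[set y in G l | decblkb l y]|%:R * Poin l.
Proof.
rewrite chiCellE; under eq_bigr => y _ do rewrite Nm_E_diag.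
rewrite -mulr_suml; congr (_ * _); rewrite -sum1_card natr_sum.
rewrite [RHS](eq_bigl (fun y => (y \in G l) && decblkb l y)); last by move=> y; rewrite inE.
by rewrite [RHS]big_mkcondr; apply: eq_bigr => y _; case: ifP.
Qed.

Lemma wrev_in l : wrev l \in [set y in G l | decblkb l y].
Proof. by rewrite inE mem_cell; apply/decblkbP/wrev_dec. Qed.

Lemma chiCell_E_neq0 l : chiCell (G l) (E l) != 0.
Proof.
rewrite chiCell_E; apply: mulf_neq0 (Poin_neq0 R l); rewrite natK_eq0 -lt0n.
by apply/card_gt0P; exists (wrev l); apply: wrev_in.
Qed.

(* Since E_k has nonzero trace on the cell module of w_k, it acts nontrivially on a constituent th k of it;
   th is injective and dominates the identity, hence is the identity. *)
Lemma chi_E l : rX (X l) (E l) <> 0.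
Proof.
have ex k : exists nu, (0 < mult (G k) nu)%N /\ rX (X nu) (E k) <> 0.
  have [//|no] := excluded_middle_informative (exists nu, (0 < mult (G k) nu)%N /\ rX (X nu) (E k) <> 0).
  case/negP: (chiCell_E_neq0 k); apply/eqP.
  rewrite (proj1 (multP (leftCell_cell (wrev k)))) big1 // => nu _.
  case: (posnP (mult (G k) nu)) => [->|p]; first by rewrite mul0r.
  have [e|e] := excluded_middle_informative (rX (X nu) (E k) = 0).
    by rewrite HXaff -/(rX (X nu) (E k)) e mxtrace0 mulr0.
  by case: no; exists nu.
pose th k := projT1 (constructive_indefinite_description _ (ex k)).
have [th1 th2] : (forall k, (0 < mult (G k) (th k))%N) /\ (forall k, rX (X (th k)) (E k) <> 0).
  by split=> k; case: (projT2 (constructive_indefinite_description _ (ex k))).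
have thinj : injective th.
  move=> k k' e; apply: domle_antisym.
    by apply: (mult_E (th1 k')); rewrite -e; apply: th2.
  by apply: (mult_E (th1 k)); rewrite e; apply: th2.
have thge k : domle k (th k) := mult_domle (wrev_decV k) (th1 k).
suff e : th l = l by have := th2 l; rewrite e.
apply/esym; have [//|ne] := excluded_middle_informative (l = th l).
(* An injection of a finite set permutes it, so the total rank is unchanged; but every term grows
   weakly, and the one at [l] strictly. *)
have e : (\sum_k psum_sum (th k) = \sum_(k : Lam n) psum_sum k)%N by apply/esym; rewrite (reindex_inj thinj).
have le : (\sum_(k | k != l) psum_sum k <= \sum_(k | k != l) psum_sum (th k))%N.
  apply: leq_sum => k _; have [<-//|nk] := excluded_middle_informative (k = th k).
  by apply: ltnW; apply: psum_sum_lt.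
have lt := psum_sum_lt (thge l) ne; exfalso; move: e.
rewrite (bigD1 l) //= [X in _ = X](bigD1 l) //= => e.
by have := leq_add lt le; rewrite addSn e ltnn.
Qed.

Lemma chiCell_wrev l h : chiCell (G l) h = chi l h.
Proof.
rewrite (proj1 (multP (leftCell_cell (wrev l)))) (bigD1 l) //= big1 ?addr0 => [|k nk].
  have -> : mult (G l) l = 1%N.
    by have := mult_le1 (wrev_decV l); have := mult_wrev_gt0 l; lia.
  by rewrite mul1r.
case: (posnP (mult (G l) k)) => [->|p]; first by rewrite mul0r.
case/eqP: nk; apply: domle_antisym; first exact: mult_E p (@chi_E k).
exact: mult_domle (wrev_decV l) p.
Qed.

Lemma cell_type y : exists l, forall h, chiCell (cell y) h = chi l h.
Proof.
have [l c] := conn_wrev R y; exists l => h.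
by rewrite -chiCell_wrev; apply: (proj1 (conn_cell R c)).
Qed.

Lemma irr_cell l : irrRep (cellX R (wrev l)).
Proof.
apply: (irr_of_chr Hirr Hinj Hall HXaff Hsym (l := l)).
  exact: (proj1 (cell_rep R _)).
by move=> h; rewrite chr_cell chiCell_wrev.
Qed.

Lemma schur0 l (M : 'M[K]_#|G l|) (u : 'cV[K]_#|G l|) :
  intertw (cellX R (wrev l)) (cellX R (wrev l)) M -> M *m u = 0 -> u != 0 -> M = 0.
Proof.
move=> IM Mu u0; have [//|nz] := eqVneq M 0.
have [M' [_ e]] := schur (irr_cell l) (irr_cell l) IM nz.
by case/negP: u0; rewrite -[u]mul1mx -e -mulmxA Mu mulmx0.
Qed.

(* Star operations leading from y to w_l permute the basis of the cell module. The permutation matrix minus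
   the identity is a singular endomorphism of an irreducible module, hence zero. *)
Lemma decblk_wrev l y : y \in G l -> decblk l y -> y = wrev l.
Proof.
move=> yG hy; have [_ /(_ erefl) /(rconn_cell_iso R) [f [fy fi fG fN]]] := cell_decblk yG hy.
rewrite (cellP yG) in fi fG fN.
have fin a : a \in G l -> f a \in G l by rewrite -{2}fG => ha; apply: imset_f.
have fsur b : b \in G l -> exists2 a, a \in G l & b = f a.
  by rewrite -{1}fG => /imsetP.
pose Phi : 'M[K]_#|G l| := \matrix_(i, j) (enum_val i == f (enum_val j))%:R.
have M0 : Phi - 1%:M = 0.
  (* The all-ones vector is fixed by every permutation matrix, so it witnesses the singularity. *)
  apply: (@schur0 l _ (const_mx 1)).
  - move=> h; rewrite (proj2 (cell_rep R _)).
    suff comm : cellM (wrev l) h *m Phi = Phi *m cellM (wrev l) h.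
      by rewrite mulmxBl mulmxBr comm mul1mx mulmx1.
    apply/matrixP => i j; rewrite !mxE.
    have [a ha ea] := fsur _ (enum_valP i).
    transitivity (Nm h (f a) (f (enum_val j))).
      rewrite -ea; under eq_bigr => u _ do rewrite !mxE.
      rewrite -(big_enum_val (fun u => Nm h (enum_val i) u * (u == f (enum_val j))%:R)) /=.
      rewrite (bigD1 (f (enum_val j))) ?fin ?enum_valP //= eqxx mulr1 big1 ?addr0 // => u /andP [_ /negPf ->].
      by rewrite mulr0.
    rewrite fN ?enum_valP //; under eq_bigr => u _ do rewrite !mxE ea.
    rewrite -(big_enum_val (fun u => (f a == f u)%:R * Nm h u (enum_val j))) /=.
    rewrite (bigD1 a) //= eqxx mul1r big1 ?addr0 // => u /andP [hu /negPf ne].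
    by rewrite (inj_in_eq fi) // eq_sym ne mul0r.
  - rewrite mulmxBl mul1mx; apply/eqP; rewrite subr_eq0; apply/eqP/matrixP => i j; rewrite !mxE.
    have [a ha ea] := fsur _ (enum_valP i).
    under eq_bigr => u _ do rewrite !mxE ea mulr1.
    rewrite -(big_enum_val (fun u => (f a == f u)%:R)) /=.
    rewrite (bigD1 a) //= eqxx big1 ?addr0 // => u /andP [hu /negPf ne].
    by rewrite (inj_in_eq fi) // eq_sym ne.
  apply/eqP => /matrixP /(_ (enum_rank_in yG y) ord0); rewrite !mxE => /eqP.
  by rewrite oner_eq0.
have /matrixP /(_ (enum_rank_in yG y) (enum_rank_in yG y)) := M0.
rewrite !mxE eqxx enum_rankK_in // fy; case: eqP => // _ /eqP.
by rewrite sub0r oppr_eq0 oner_eq0.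
Qed.

Lemma chi_E_Poin l : chi l (E l) = Poin l.
Proof.
rewrite -chiCell_wrev chiCell_E; have -> : [set y in G l | decblkb l y] = [set wrev l].
  apply/setP => y; rewrite inE in_set1; apply/andP/eqP => [[yG /decblkbP]|->].
    exact: decblk_wrev.
  by have := wrev_in l; rewrite inE => /andP.
by rewrite cards1 mul1r.
Qed.

(* E_l acts with rank one on the cell module. *)
Lemma cell_scalar l (M : 'M[K]_#|G l|) :
  intertw (cellX R (wrev l)) (cellX R (wrev l)) M -> exists a, M = a%:M.
Proof.
move=> IM; have w0G : wrev l \in G l := mem_cell R (wrev l).
pose o := enum_rank_in w0G (wrev l).
have eo i : (enum_val i == wrev l) = (i == o).
  by rewrite -(inj_eq enum_val_inj) enum_rankK_in.
have N0 i j : i != o -> cellM (wrev l) (E l) i j = 0.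
  move=> io; rewrite mxE; have [//|/Nm_E h] := eqVneq (Nm (E l) (enum_val i) (enum_val j)) 0.
  by case/negP: io; rewrite -eo; apply/eqP/(decblk_wrev (enum_valP i) h).
have No : cellM (wrev l) (E l) o o = Poin l.
  rewrite mxE enum_rankK_in // Nm_E_diag.
  by case: decblkbP => [_|[]]; [rewrite mul1r|exact: wrev_dec].
have e := IM (E l); rewrite (proj2 (cell_rep R _)) in e.
(* Only row [o] of the matrix of $e_l$ is nonzero; compare the entries $(i,o)$ of $e_lM=Me_l$. *)
have Mo i : i != o -> M i o = 0.
  move=> io; have /matrixP /(_ i o) := e; rewrite !mxE big1 => [|j _]; last by rewrite N0 ?mul0r.
  rewrite (bigD1 o) //= No big1 ?addr0 => [|j jo]; last by rewrite N0 ?mulr0.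
  by move=> /esym/eqP; rewrite mulf_eq0 (negPf (Poin_neq0 R l)) orbF => /eqP.
(* $M-M_{oo}$ is an endomorphism killing the basis vector at [o], hence 0. *)
exists (M o o); apply/eqP; rewrite -subr_eq0; apply/eqP; apply: (@schur0 l _ (delta_mx o ord0)).
- by move=> h; rewrite mulmxBr mulmxBl IM scalar_mxC.
- rewrite -colE; apply/matrixP => i j; rewrite !mxE.
  have [->|io] := eqVneq i o; first by rewrite mulr1n subrr.
  by rewrite (Mo i io) mulr0n subr0.
apply/eqP => /matrixP /(_ o ord0); rewrite !mxE !eqxx => /eqP.
by rewrite oner_eq0.
Qed.

Lemma X_scalar l (M : 'M[K]_(dd l)) : intertw (X l) (X l) M -> exists a, M = a%:M.
Proof.
move=> IM; have cG h : chr (cellX R (wrev l)) h = chi l h by rewrite chr_cell chiCell_wrev.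
have [U [U' [IU e1 e2]]] := iso_of_chr Hirr Hinj Hall HXrep HXaff Hsym (proj1 (cell_rep R _)) cG.
have IU' h : rX (cellX R (wrev l)) h *m U' = U' *m rX (X l) h.
  by rewrite -[LHS]mul1mx -e2 -!mulmxA (mulmxA U) -IU -mulmxA e1 mulmx1.
have [a ea] : exists a, U' *m M *m U = a%:M.
  by apply: cell_scalar => h; rewrite !mulmxA IU' -(mulmxA U') IM -!mulmxA IU.
exists a; have -> : M = U *m (U' *m M *m U) *m U' by rewrite !mulmxA e1 mul1mx -mulmxA e1 mulmx1.
by rewrite ea scalar_mxC -mulmxA e1 mulmx1.
Qed.

End CellCharacters.

(** * Leading coefficients *)

(** For [c_diag_neq0], with $a=v^{a(l)-l(u)}$, $b=v^{l(u)}$ and $s=\varepsilon_u$. *)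
Lemma cancel_pow (F : fieldType) (a b s x : F) : b != 0 ->
  (a * b) * (a * b) * (s * b^-1 * x) = (s * a) * (a * b * x).
Proof. by move=> b0; field. Qed.

Section Leading.
Variables (R : realType) (n : nat).
Local Notation K := (K R).
Local Notation W := (W n).
Local Notation H := (hecke R n).
Local Notation T := (@T R n : W -> H).
Local Notation C := (@KC R n).
Local Notation Poin := (@Poin R n).
Local Notation cell := (@cell R n).
Local Notation v := (vK R).
Variables (chi : Lam n -> HK R n -> K) (d : Lam n -> nat) (X : forall l, W -> 'M[K]_(d l)).
Variables (P : forall l : Lam n, 'M[K]_(d l)) (c : forall l : Lam n, 'I_(d l) -> 'I_(d l) -> W -> int).
Hypothesis Hirr : forall l, irrChar (chi l).
Hypothesis Hinj : forall l m, (forall h, chi l h = chi m h) -> l = m.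
Hypothesis Hall : forall psi : HK R n -> K, irrChar psi -> exists l, forall h, psi h = chi l h.
Hypothesis Hind : forall l, exists mult : Lam n -> nat, forall h,
  IndSign l h = chi l h + \sum_(mu | domlt l mu) (mult mu)%:R * chi mu h.
Hypothesis HXrep : forall l, isRep (X l).
Hypothesis HXaff : forall l, affords (X l) (chi l).
Hypothesis HPdiag : forall l (i j : 'I_(d l)), i != j -> P l i j = 0.
Hypothesis HPent : forall l (i : 'I_(d l)), exists p : {poly R}, P l i i = 1 + v * evalR p v.
Hypothesis HPunit : forall l, P l \in unitmx.
Hypothesis HXorth : forall l (w : W), X l (w^-1)%g = invmx (P l) *m (X l w)^T *m P l.
Hypothesis Hc : forall l (i j : 'I_(d l)) w, reg0 (v ^+ aL l * X l w i j) (sgnR R w * (c i j w)%:~R).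
Implicit Types (l m : Lam n) (h : H) (w x y z : W).

Lemma P_reg0 l (i : 'I_(d l)) : reg0 (P l i i) (1 : R).
Proof.
have [p ->] := HPent i; rewrite evalR_v.
have := reg0D (reg0_1 R) (reg0M (reg0_v R) (reg0_poly p)).
by rewrite mul0r addr0.
Qed.

Lemma P_neq0 l (i : 'I_(d l)) : P l i i != 0.
Proof.
apply/eqP => e; have := P_reg0 i; rewrite e => /(reg0_uniq (reg0_0 R)) /eqP.
by rewrite eq_sym oner_eq0.
Qed.

Lemma X_inv l w (i j : 'I_(d l)) : X l w^-1%g i j = (P l i i)^-1 * P l j j * X l w j i.
Proof.
apply: (mulfI (P_neq0 i)); rewrite !mulrA mulfV ?mul1r; last exact: P_neq0.
have /matrixP /(_ i j) : P l *m X l w^-1%g = (X l w)^T *m P l.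
  by rewrite HXorth -mulmxA mulKVmx.
rewrite !mxE (bigD1 i) //= [X in _ + X]big1 ?addr0 => [->|k ki]; last first.
  by rewrite HPdiag ?mul0r // eq_sym.
rewrite (bigD1 j) //= [X in _ + X]big1 ?addr0 => [|k kj]; last by rewrite HPdiag ?mulr0.
by rewrite mxE mulrC.
Qed.

Lemma chiT l w : chi l (T w) = \tr (X l w).
Proof. by rewrite HXaff -[reprX _ _]/(rX _ (T w)) rXT. Qed.

Lemma chi_sym l w : chi l (T w^-1%g) = chi l (T w).
Proof.
rewrite !chiT; apply: eq_bigr => i _.
by rewrite X_inv mulVf ?mul1r //; apply: P_neq0.
Qed.

Lemma sgnR_sqr w : sgnR R w * sgnR R w = 1.
Proof. by rewrite -expr2 sqrr_sign. Qed.

Lemma sgnRV w : sgnR R w^-1%g = sgnR R w.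
Proof. by rewrite /sgnR lenV. Qed.

(** The ratio of diagonal entries of $P_l$ by which the two matrix coefficients differ has value 1
    at $v=0$. *)
Lemma c_inv l (i j : 'I_(d l)) w : c i j w^-1%g = c j i w.
Proof.
have e : v ^+ aL l * X l w^-1%g i j = (P l i i)^-1 * P l j j * (v ^+ aL l * X l w j i).
  by rewrite X_inv mulrCA.
have := Hc i j w^-1%g; rewrite e sgnRV => h1.
have h2 := reg0M (reg0M (reg0V (oner_neq0 R) (P_reg0 i)) (P_reg0 j)) (Hc j i w).
have := reg0_uniq h1 h2; rewrite invr1 !mul1r => /(congr1 (fun a => sgnR R w * a)).
by rewrite !mulrA sgnR_sqr !mul1r => /intr_inj.
Qed.

Let scalar := X_scalar Hirr Hinj Hall HXrep HXaff chi_sym Hind.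

(** The Schur relations; [g] is the Schur element. Scalar Casimir operators settle the dependence on
    the outer indices $i,p$, and $w\mapsto w^{-1}$ exchanges these with $k,j$. *)
Lemma schur_gamma l : exists g : K, forall i j k p : 'I_(d l),
  \sum_w X l w i j * X l w^-1%g k p = g *+ ((i == p) && (j == k)).
Proof.
pose S i j k p : K := \sum_w X l w i j * X l w^-1%g k p.
have S1 i j k p : i != p -> S i j k p = 0.
  move=> ip; have [a ea] := scalar (casimirP (delta_mx j k) (HXrep l) (HXrep l)).
  by rewrite /S -casimir_delta ea mxE (negPf ip).
have S2 i i' j k : S i j k i = S i' j k i'.
  have [a ea] := scalar (casimirP (delta_mx j k) (HXrep l) (HXrep l)).
  by rewrite /S -!casimir_delta ea !mxE !eqxx.
have S3 i j k p : S i j k p = S k p i j.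
  rewrite /S (reindex_inj invg_inj) /=; apply: eq_bigr => w _.
  by rewrite invgK mulrC.
case: (posnP (d l)) => [d0|d0]; first by exists 0 => i; have := ltn_ord i; lia.
pose o := Ordinal d0; exists (S o o o o) => i j k p; rewrite -/(S i j k p).
have [<-|ip] := eqVneq i p; last by rewrite S1.
have [<-|jk] := eqVneq j k; last by rewrite S3 S1 // eq_sym.
by rewrite (S2 i o) (S3 o j) (S2 j o).
Qed.

Definition gam l := projT1 (constructive_indefinite_description _ (schur_gamma l)).
Lemma gamP l (i j k p : 'I_(d l)) :
  \sum_w X l w i j * X l w^-1%g k p = gam l *+ ((i == p) && (j == k)).
Proof. exact: (projT2 (constructive_indefinite_description _ (schur_gamma l))). Qed.

Lemma rX_zel l m (i j : 'I_(d m)) :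
  rX (X m) (zel chi l) i j = \sum_k \sum_w X m w i j * X l w^-1%g k k.
Proof.
rewrite exchange_big /= /zel rX_sum summxE; apply: eq_bigr => w _.
by rewrite rXZ rXT mxE chiT mulrC mulr_sumr.
Qed.

Lemma rX_zel_eq l : rX (X l) (zel chi l) = (gam l)%:M.
Proof.
apply/matrixP => i j; rewrite rX_zel mxE; under eq_bigr => k _ do rewrite gamP.
rewrite (bigD1 i) //= eqxx big1 ?addr0 => [|k ki]; first by rewrite eq_sym.
by rewrite eq_sym (negPf ki).
Qed.

Lemma rX_zel_neq l m : l <> m -> rX (X m) (zel chi l) = 0.
Proof.
move=> ne; apply/matrixP => i j; rewrite rX_zel mxE big1 // => k _; rewrite -casimir_delta.
have [-> |nz] := eqVneq (casimir (X m) (X l) (delta_mx j k)) 0; first by rewrite mxE.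
have irr := irrX Hirr Hinj Hall HXrep HXaff chi_sym.
have IM := casimirP (delta_mx j k) (HXrep m) (HXrep l).
have [M' [e1 e2]] := schur (irr m) (irr l) IM nz.
case: ne; apply: Hinj => h; rewrite !HXaff; apply/esym.
exact: (intertw_tr IM e1 e2 h).
Qed.

Lemma Nm_zel l m y : (forall h, chiCell (cell y) h = chi m h) ->
  Nm (zel chi l) y y = gam l *+ (l == m).
Proof.
move=> hy; have hy' h : chr (cellX R y) h = chi m h by rewrite chr_cell hy.
have [U [U' [IU e1 e2]]] := iso_of_chr Hirr Hinj Hall HXrep HXaff chi_sym (proj1 (cell_rep R y)) hy'.
have ez : rX (X m) (zel chi l) = (gam l *+ (l == m))%:M.
  have [<-|/eqP ne] := eqVneq l m; first by rewrite rX_zel_eq mulr1n.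
  by rewrite rX_zel_neq // mulr0n raddf0.
have e : cellM y (zel chi l) = (gam l *+ (l == m))%:M.
  by rewrite -(proj2 (cell_rep R y)) -[rX _ _]mul1mx -e2 -mulmxA -IU ez -scalar_mxC mulmxA e2 mul1mx.
have /matrixP /(_ (enum_rank_in (mem_cell R y) y) (enum_rank_in (mem_cell R y) y)) := e.
by rewrite !mxE eqxx mulr1n enum_rankK_in // mem_cell.
Qed.

Lemma chiM l h k' : chi l (h * k') = chi l (k' * h).
Proof.
have cM a b : chi l (a * b : H) = \tr (rX (X l) a *m rX (X l) b) by rewrite HXaff -rXM.
by rewrite !cM mxtrace_mulC.
Qed.

Lemma chiD l h k' : chi l (h + k' : H) = chi l h + chi l k'.
Proof. by rewrite !HXaff -!/(rX _ _) rXD mxtraceD. Qed.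
Lemma chiZ l (a : K) h : chi l (a *: h : H) = a * chi l h.
Proof. by rewrite !HXaff -!/(rX _ _) rXZ mxtraceZ. Qed.

Lemma zelE l w : zel chi l w = chi l (T w^-1%g) :> K.
Proof.
rewrite /zel hsum; under eq_bigr => x _ do rewrite hZ TE.
exact: sum_delta.
Qed.

(** $z_l$ represents $\chi_l$ for the trace form. The induction on [h] works because [key] and
    [key'] show that $z_l$ commutes with every $T_s$. *)
Lemma zel_coef l h w : (zel chi l * h) w = chi l (h * T w^-1%g) :> K.
Proof.
have key s x : s \in gens n ->
    zel chi l (s * x)%g + (dl s x)%:R * (v - v^-1) * zel chi l x = chi l (T x^-1%g * T s) :> K.
  move=> hs; rewrite hM_Ts // Rop_T // chiD chiZ !zelE invMg (gens_inv hs).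
  by rewrite dr_dl // invgK.
have key' s x : s \in gens n ->
    zel chi l (x * s)%g + (dr s x)%:R * (v - v^-1) * zel chi l x = chi l (T x^-1%g * T s) :> K.
  move=> hs; rewrite chiM T_TsM // chiD chiZ !zelE invMg (gens_inv hs).
  by rewrite dl_dr // invgK.
move: w; elim/gens_ind: h => [w|h1 h2 IH1 IH2 w|a h IH w|s h hs IH w].
- by rewrite mulr1 mul1r zelE.
- by rewrite mulrDr hD mulrDl chiD IH1 IH2.
- by rewrite ZMr hZ ZMl chiZ IH.
have -> : zel chi l * (T s * h) = T s * (zel chi l * h).
  rewrite !mulrA; congr (_ * _); apply/ffunP => x.
  rewrite -[LHS]/((zel chi l * T s : H) x : K) -[RHS]/((T s * zel chi l : H) x : K).
  by rewrite MTs // TsM // key // key'.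
rewrite TsM // !IH -[T s * h * _]mulrA [in RHS]chiM -[h * _ * T s]mulrA (hM_Ts _ hs) Rop_T // [h * (_ + _)]mulrDr ZMr chiD chiZ.
by rewrite invMg (gens_inv hs) dr_dl // invgK.
Qed.

Lemma Nm_zelE l y : Nm (zel chi l) y y =
  \sum_i \sum_j (\sum_u (C y u : K) * X l u i j) * (\sum_w X l w^-1%g j i * cc (T w) y).
Proof.
rewrite /Nm cc_expand.
transitivity (\sum_w \tr (rX (X l) (C y) *m X l w^-1%g) * cc (T w) y).
  apply: eq_bigr => w _; rewrite zel_coef; congr (_ * _).
  by rewrite HXaff -[reprX _ _]/(rX _ _) rXM // rXT.
under eq_bigr => w _ do rewrite /mxtrace mulr_suml.
rewrite exchange_big /=; apply: eq_bigr => i _.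
under eq_bigr => w _ do rewrite mxE mulr_suml.
rewrite exchange_big /=; apply: eq_bigr => j _.
rewrite mulr_sumr; apply: eq_bigr => w _.
rewrite -mulrA; congr (_ * _); rewrite rXE summxE; apply: eq_bigr => u _.
by rewrite mxE.
Qed.

(* The diagonal coefficients of the central element zel l, renormalized, have a limit at v = 0 because C_y and T_y
   agree modulo v. *)
Lemma reg0_Nm_zel l y : reg0 (v ^+ aL l * v ^+ aL l * Nm (zel chi l) y y)
  (\sum_i \sum_j ((c (l := l) i j y)%:~R ^+ 2) : R).
Proof.
rewrite Nm_zelE mulr_sumr; apply: reg0_sum => i _; rewrite mulr_sumr; apply: reg0_sum => j _.
rewrite mulrACA.
have sgnc (F : W -> K) (f : W -> R) : (forall u, reg0 (F u) ((u == y)%:R * f u)) ->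
    reg0 (\sum_u F u) (f y).
  move=> h; have -> : f y = \sum_u (u == y)%:R * f u.
    rewrite (bigD1 y) //= eqxx mul1r big1 ?addr0 // => u /negPf ->.
    by rewrite mul0r.
  exact: reg0_sum.
have e1 : reg0 (v ^+ aL l * (\sum_u (C y u : K) * X l u i j)) (sgnR R y * (c i j y)%:~R).
  rewrite mulr_sumr; apply: (sgnc _ (fun u => sgnR R u * (c i j u)%:~R)) => u.
  rewrite mulrCA; apply: reg0M (Hc i j u).
  have [->|ne] := eqVneq u y; first by rewrite C_diag; exact: reg0_1.
  by apply: in_vZv_reg0; apply: C_vZv.
have e2 : reg0 (v ^+ aL l * (\sum_w X l w^-1%g j i * cc (T w) y)) (sgnR R y * (c i j y)%:~R).
  rewrite mulr_sumr; apply: (sgnc _ (fun u => sgnR R u * (c i j u)%:~R)) => u.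
  rewrite mulrA [X in reg0 X]mulrC; apply: reg0M; last first.
    by have := Hc j i u^-1%g; rewrite sgnRV c_inv.
  have := reg0D (in_vZv_reg0 (ccT R u y)) (reg0_nat R (u == y)).
  by rewrite TE [in X in _ - X]eq_sym subrK add0r.
have := reg0M e1 e2; rewrite [X in reg0 _ X -> _]mulrACA sgnR_sqr mul1r.
by rewrite -expr2.
Qed.

(** The Schur relation with indices $i,j,j,i$ at $v=0$. Its left side does not involve $i,j$, so the
    sum of squares is the same for all matrix positions. *)
Lemma reg0_gam l (i j : 'I_(d l)) : reg0 (v ^+ aL l * v ^+ aL l * gam l)
  (\sum_w ((c i j w)%:~R ^+ 2) : R).
Proof.
have := gamP i j j i; rewrite !eqxx mulr1n => <-.
rewrite mulr_sumr; apply: reg0_sum => w _; rewrite mulrACA.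
have := reg0M (Hc i j w) (Hc j i w^-1%g).
by rewrite sgnRV c_inv (mulrACA (sgnR R w)) sgnR_sqr mul1r -expr2.
Qed.

(** If all diagonal leading coefficients vanished, each $v^{a(l)}\chi_l(T_u)$ would be 0 at $v=0$.
    Since $l(u)\le a(l)$ on $\mathfrak S_l$, so would $v^{2a(l)}\chi_l(e_l)$, against
    [Poin_reg0]. *)
Lemma c_diag_neq0 l : exists i u, c (l := l) i i u != 0.
Proof.
have [//|no] := excluded_middle_informative (exists i u, c (l := l) i i u != 0).
have c0 i u : c (l := l) i i u = 0.
  by have [//|nz] := eqVneq (c (l := l) i i u) 0; case: no; exists i, u.
have r0 u : reg0 (v ^+ aL l * chi l (T u)) (0 : R).
  have z0 : (0 : R) = \sum_(i < d l) 0 by rewrite big1_eq.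
  rewrite chiT /mxtrace mulr_sumr [X in reg0 _ X]z0.
  apply: reg0_sum => i _.
  by have := Hc i i u; rewrite c0 mulr0.
have [N [N0 hN]] := Poin_reg0 R l.
have e := chi_E_Poin Hirr Hinj Hall HXrep HXaff chi_sym Hind l.
have : reg0 (v ^+ (2 * aL l) * Poin l) (0 : R).
  rewrite -e EsumE -[reg0 _ _]/(reg0 (v ^+ (2 * aL l) * chi l _) 0).
  have -> : chi l (\sum_(u in youngG l) (- v^-1) ^+ len u *: T u) =
            \sum_(u in youngG l) (- v^-1) ^+ len u * chi l (T u).
    rewrite HXaff -[reprX _ _]/(rX _ _) rX_sum raddf_sum /=; apply: eq_bigr => u _.
    by rewrite rXZ mxtraceZ rXT chiT.
  have z0 : (0 : R) = \sum_(u in youngG l) 0 by rewrite big1_eq.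
  rewrite mulr_sumr [X in reg0 _ X]z0.
  apply: reg0_sum => u hu.
  have le : (len u <= aL l)%N by rewrite /aL; apply: (@leq_bigmax_cond _ _ _ u).
  have -> : v ^+ (2 * aL l) * ((- v^-1) ^+ len u * chi l (T u)) =
     ((- 1) ^+ len u * v ^+ (aL l - len u)) * (v ^+ aL l * chi l (T u)).
    rewrite -(mulN1r v^-1) exprMn exprVn mul2n -addnn exprD.
    have -> : v ^+ aL l = v ^+ (aL l - len u) * v ^+ len u by rewrite -exprD subnK.
    by apply: cancel_pow; apply: expf_neq0; apply: v_neq0.
  have := reg0M (reg0M (reg0X (len u) (reg0N (reg0_1 R))) (reg0X (aL l - len u) (reg0_v R))) (r0 u).
  by rewrite mulr0.
move=> /(reg0_uniq hN) /eqP; rewrite pnatr_eq0 => /eqP e0.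
by rewrite e0 in N0.
Qed.

Definition cset l : {set W} := [set w | [exists i, exists j, c (l := l) i j w != 0]].

(** Two evaluations at $v=0$ of the $(y,y)$ coefficient of $z_l$: by [reg0_Nm_zel], and by the
    scalar of $z_l$ on a cell affording $\chi_m$. *)
Lemma sum_c_eq l m y : (forall h, chiCell (cell y) h = chi m h) ->
  if l == m then forall i j : 'I_(d l),
    \sum_i' \sum_j' ((c (l := l) i' j' y)%:~R ^+ 2) = \sum_w ((c i j w)%:~R ^+ 2) :> R
  else \sum_i \sum_j ((c (l := l) i j y)%:~R ^+ 2) = 0 :> R.
Proof.
move=> hy; have := reg0_Nm_zel l y; rewrite (Nm_zel l hy).
case: eqP => [_ h i j|_]; first by apply: reg0_uniq h _; rewrite mulr1n; apply: reg0_gam.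
by rewrite mulr0n mulr0 => h; apply: reg0_uniq h (reg0_0 R).
Qed.

Lemma mem_cset l y : (y \in cset l) = (\sum_i \sum_j ((c (l := l) i j y)%:~R ^+ 2) != 0 :> R).
Proof.
have ge0 i j : 0 <= (c (l := l) i j y)%:~R ^+ 2 :> R by apply: sqr_ge0.
have ge0' i : 0 <= \sum_j (c (l := l) i j y)%:~R ^+ 2 :> R by apply: sumr_ge0 => j _; apply: ge0.
rewrite inE; apply/existsP/idP => [[i /existsP [j cn]]|].
  apply: contraNneq cn => /(psumr_eq0P (fun i _ => ge0' i)) /(_ i erefl).
  move=> /(psumr_eq0P (fun j _ => ge0 i j)) /(_ j erefl) /eqP.
  by rewrite sqrf_eq0 intr_eq0.
move=> nz; have [//|no] := excluded_middle_informative (exists i, [exists j, c (l := l) i j y != 0]).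
case/negP: nz; rewrite big1 // => i _; rewrite big1 // => j _.
have [->|cn] := eqVneq (c (l := l) i j y) 0; first by rewrite expr2 mulr0.
by case: no; exists i; apply/existsP; exists j.
Qed.

Lemma sum_c_gt0 l (i : 'I_(d l)) : 0 < \sum_w ((c i i w)%:~R ^+ 2) :> R.
Proof.
have [i0 [u nz]] := c_diag_neq0 l.
have <- : \sum_w ((c i0 i0 w)%:~R ^+ 2) = \sum_w ((c i i w)%:~R ^+ 2) :> R.
  exact: reg0_uniq (reg0_gam i0 i0) (reg0_gam i i).
rewrite (bigD1 u) //=; apply: ltr_pwDl; last by apply: sumr_ge0 => w _; apply: sqr_ge0.
by rewrite exprn_even_gt0 //= intr_eq0.
Qed.

Lemma cset_type l m y : (forall h, chiCell (cell y) h = chi m h) -> (y \in cset l) = (l == m).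
Proof.
move=> hy; rewrite mem_cset; have := sum_c_eq l hy.
case: (l == m) => [h|->]; last by rewrite eqxx.
have [i _] := c_diag_neq0 l.
by rewrite (h i i) lt0r_neq0 ?sum_c_gt0.
Qed.

Let type := cell_type Hirr Hinj Hall HXrep HXaff chi_sym Hind.

Lemma cset_chi l y : y \in cset l -> forall h, chiCell (cell y) h = chi l h.
Proof. by have [m hy] := type y; rewrite (cset_type l hy) => /eqP ->. Qed.

Lemma cell_cset l y : (cell y \subset cset l) = (y \in cset l).
Proof.
apply/subsetP/idP => [|hy z hz]; first by apply; apply: mem_cell.
by rewrite (@cset_type l l z) ?eqxx // => h; rewrite (cellP hz) (cset_chi hy).
Qed.

(** Double counting of the squares of all $c^{ij}_{y,l}$: each [y] in the set contributes [F], and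
    so does each of the $d_l^2$ positions $(i,j)$. *)
Lemma card_cset l : #|cset l| = (d l * d l)%N.
Proof.
have [i _] := c_diag_neq0 l; set F : R := \sum_w ((c i i w)%:~R ^+ 2).
have F0 : F != 0 by apply: lt0r_neq0; apply: sum_c_gt0.
have e1 : \sum_y \sum_i' \sum_j' ((c (l := l) i' j' y)%:~R ^+ 2) = #|cset l|%:R * F :> R.
  rewrite -sum1_card natr_sum mulr_suml [RHS]big_mkcond /=; apply: eq_bigr => y _.
  have [m hy] := type y; rewrite (cset_type l hy); have := sum_c_eq l hy.
  by case: (l == m) => [/(_ i i) ->|//]; rewrite mul1r.
have e2 : \sum_y \sum_i' \sum_j' ((c (l := l) i' j' y)%:~R ^+ 2) = (d l * d l)%:R * F :> R.
  rewrite exchange_big /=.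
  transitivity (\sum_(i' < d l) \sum_(j' < d l) F); last first.
    by rewrite !sumr_const !card_ord -mulrnA mulr_natl.
  apply: eq_bigr => i' _; rewrite exchange_big /=; apply: eq_bigr => j' _.
  exact: reg0_uniq (reg0_gam i' j') (reg0_gam i i).
have := e1; rewrite e2 => /(mulIf F0) /eqP.
by rewrite eqr_nat => /eqP.
Qed.

Lemma card_cell l y : y \in cset l -> #|cell y| = d l.
Proof.
move=> /cset_chi /(_ (T 1%g)); rewrite chiCellE.
have rep := HXrep l; rewrite chiT -rXT T1E rX1 // mxtrace1.
under eq_bigr => x _ do rewrite Nm1 eqxx.
rewrite -natr_sum sum1_card => e.
have r := reg0_nat R #|cell y|; rewrite e in r.
by have /eqP := reg0_uniq r (reg0_nat R (d l)); rewrite eqr_nat => /eqP.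
Qed.

Lemma card_cells l : #|[set Cl : {set W} | leftCell R Cl & Cl \subset cset l]| = d l.
Proof.
set B := [set Cl | _ & _]; have d0 : (0 < d l)%N.
  by have [i _] := c_diag_neq0 l; have := ltn_ord i; lia.
have Bcell y : (cell y \in B) = (y \in cset l).
  by rewrite inE cell_cset; have -> : leftCell R (cell y) by apply/leftCellP; exists y.
apply/eqP; rewrite -(eqn_pmul2r d0) -card_cset -sum_nat_const -[#|cset l|]sum1_card.
rewrite (partition_big cell (mem B)) /=; last by move=> y hy; rewrite Bcell.
apply/eqP; apply: eq_bigr => Cl hC.
have [y eC] : exists y, Cl = cell y by move: hC; rewrite inE => /andP [/leftCellP].
move: hC; rewrite eC Bcell => hy; rewrite -(card_cell hy) -sum1_card; apply: eq_bigl => z.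
apply/idP/andP => [hz|[_ /eqP <-]]; last exact: mem_cell.
by rewrite (cellP hz) -cell_cset (cellP hz) cell_cset.
Qed.

(** After exchanging the sums, each left cell is counted once, under the [l] whose character it
    affords. *)
Lemma card_leftCells : #|[set Cl : {set W} | leftCell R Cl]| = (\sum_l d l)%N.
Proof.
rewrite -sum1_card; under [RHS]eq_bigr => l _ do rewrite -card_cells -sum1_card big_mkcond.
rewrite exchange_big [LHS]big_mkcond /=; apply: eq_bigr => Cl _.
rewrite inE; have [/leftCellP [y ->]|no] := boolP (leftCell R Cl); last first.
  by rewrite big1 // => l _; rewrite inE (negPf no).
have [m hy] := type y; rewrite (bigD1 m) //= big1 ?addn0 => [|l /negPf lm]; last first.
  by rewrite inE cell_cset (cset_type l hy) lm andbF.
rewrite inE cell_cset (cset_type m hy) eqxx.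
by have -> : leftCell R (cell y) by apply/leftCellP; exists y.
Qed.

Lemma irrChar_leftCell (Cl : {set W}) : leftCell R Cl -> irrChar (@chiCell R n Cl).
Proof.
move=> /leftCellP [y ->]; have [m hy] := type y.
have [e [Y [h1 [h2 h3]]]] := Hirr m; exists e, Y; split=> //; split=> // h.
by rewrite hy.
Qed.

Lemma leftCell_eq_chi (Cl Cl' : {set W}) : leftCell R Cl -> leftCell R Cl' ->
  ((forall h, chiCell Cl h = chiCell Cl' h :> K) <->
   exists l, Cl \subset cset l /\ Cl' \subset cset l).
Proof.
move=> /leftCellP [y ->] /leftCellP [z ->]; split=> [e|[l]].
  have [m hy] := type y; exists m; rewrite !cell_cset (cset_type m hy) eqxx.
  by rewrite (@cset_type m m z) ?eqxx // => h; rewrite -e hy.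
by rewrite !cell_cset => -[/cset_chi hy /cset_chi hz] h; rewrite hy hz.
Qed.

End Leading.

Theorem theorem5p4 (R : realType) (n : nat)
  (chi : Lam n -> HK R n -> K R)
  (d : Lam n -> nat)
  (X : forall l : Lam n, W n -> 'M[K R]_(d l))
  (P : forall l : Lam n, 'M[K R]_(d l))
  (c : forall l : Lam n, 'I_(d l) -> 'I_(d l) -> W n -> int)
  (* the chi_lambda are exactly the irreducible characters of H_K, without repetition *)
  (Hirr : forall l, irrChar (chi l))
  (Hinj : forall l m, (forall h, chi l h = chi m h) -> l = m)
  (Hall : forall psi : HK R n -> K R, irrChar psi -> exists l, forall h, psi h = chi l h)
  (* labelling via induced sign characters and dominance order *)
  (Hind : forall l, exists mult : Lam n -> nat, forall h,
       IndSign l h = chi l h + \sum_(mu | domlt l mu) (mult mu)%:R * chi mu h)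
  (* X_lambda is a representation affording chi_lambda *)
  (HXrep : forall l, isRep (X l))
  (HXaff : forall l, affords (X l) (chi l))
  (* orthogonality w.r.t. the diagonal matrix P_lambda *)
  (HPdiag : forall l (i j : 'I_(d l)), i != j -> P l i j = 0)
  (HPent : forall l (i : 'I_(d l)), exists p : {poly R}, P l i i = 1 + vK R * evalR p (vK R))
  (HPunit : forall l, P l \in unitmx)
  (HXorth : forall l (w : W n), X l (w^-1)%g = invmx (P l) *m (X l w)^T *m P l)
  (* leading coefficients c^{ij}_{w,lambda} *)
  (Hc : forall l (i j : 'I_(d l)) w,
      reg0 (vK R ^+ aL l * X l w i j) (sgnR R w * (c l i j w)%:~R)) :
  let Rset (l : Lam n) : {set W n} := [set w | [exists i, exists j, c l i j w != 0]] in
  (forall Cl : {set W n}, @leftCell R n Cl -> irrChar (@chiCell R n Cl)) /\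
  (forall Cl Cl' : {set W n}, @leftCell R n Cl -> @leftCell R n Cl' ->
     ((forall h, @chiCell R n Cl h = @chiCell R n Cl' h) <->
      exists l, (Cl \subset Rset l) /\ (Cl' \subset Rset l))) /\
  #|[set Cl : {set W n} | @leftCell R n Cl]| = (\sum_(l : Lam n) d l)%N.
Proof.
split; last split.
- exact: (irrChar_leftCell Hirr Hinj Hall Hind HXrep HXaff HPdiag HPent HPunit HXorth).
- exact: (leftCell_eq_chi Hirr Hinj Hall Hind HXrep HXaff HPdiag HPent HPunit HXorth Hc).
exact: (card_leftCells Hirr Hinj Hall Hind HXrep HXaff HPdiag HPent HPunit HXorth Hc).
Qed.
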